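(* For all $\mu,s,t>0$ and $\lambda\ge 0$, the limit of $\frac1n\log\mathbb{E}\left[e^{\lambda L^\mu_{\lfloor ns\rfloor}(nt)}\right]$ as $n\to\infty$ exists in $(-\infty,\infty]$ and $$\lim_{n\to\infty}\frac1n\log\mathbb{E}\left[e^{\lambda L^\mu_{\lfloor ns\rfloor}(nt)}\right]=\begin{cases}\max\left\{t\left(\frac{\lambda^2}{2}+\mu\lambda\right)+s\log\frac{\mu+\lambda}{\mu},\ \ t\left(-\frac{\lambda^2}{2}+\mu\lambda\right)+s\log\frac{\mu}{\mu-\lambda}\right\}, & \lambda<\mu,\\[4pt] \infty, & \lambda\ge\mu.\end{cases}$$
   Context: Let $\{B_i\}_{i=0}^\infty$ be i.i.d. standard two-sided Brownian motions on $\mathbb{R}$ (with $B_i(0)=0$), and write $B_k(s,t)=B_k(t)-B_k(s)$. For $\mu>0$, $n\in\mathbb{N}=\{1,2,\dots\}$ and $t\in\mathbb{R}$, the last passage time of the increment-stationary Brownian directed percolation model is $$L_n^\mu(t)=\sup_{-\infty<s_0<s_1<\dots<s_{n-1}<s_n=t}\left\{\mu s_0-B_0(s_0)+\sum_{j=1}^n B_j(s_{j-1},s_j)\right\}.$$ In the limit, only $n$ large enough that $\lfloor ns\rfloor\ge1$ are considered. *)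

(* Defs.v *)
From HB Require Import structures.
From mathcomp Require Export all_boot all_order all_algebra finmap.
From mathcomp Require Export all_classical all_reals all_analysis.
Export Order.TTheory GRing.Theory Num.Theory.
Export numFieldNormedType.Exports.

Set Implicit Arguments.
Unset Strict Implicit.
Unset Printing Implicit Defensive.

Local Open Scope classical_set_scope.
Local Open Scope ring_scope.

(* Mutual independence of a family of set systems (in the uses below,
   sigma-algebras): the product rule over every finite subfamily. *)
Definition mutually_independent (d : measure_display) (T : measurableType d)
    (R : realType) (P : probability T R) (I : choiceType)
    (F : I -> set (set T)) : Prop :=
  forall (J : {fset I}) (E : I -> set T),
    (forall j, j \in J -> F j (E j)) ->
    P (\bigcap_(j in [set` J]) E j) = (\prod_(j <- J) P (E j))%E.

Definition increment (T : Type) (R : realType) (X : R -> T -> R) (r t : R) :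
    T -> R :=
  fun w => X t w - X r w.

Definition independent_increments (d : measure_display) (T : measurableType d)
    (R : realType) (P : probability T R) (X : R -> {RV P >-> R}) : Prop :=
  forall (m : nat) (u : nat -> R),
    (forall k, (k < m)%N -> u k < u k.+1) ->
    mutually_independent P (fun k : 'I_m =>
      preimage_set_system setT (increment X (u k) (u k.+1)) measurable).

(* The time parameter ranges over all of R.  The second parameter of
   normal_prob is the standard deviation. *)
Record two_sided_brownian_motion (d : measure_display) (T : measurableType d)
    (R : realType) (P : probability T R) (X : R -> {RV P >-> R}) : Prop := {
  bm_start : {ae P, forall w, X 0 w = 0} ;
  bm_continuous : {ae P, forall w, continuous (fun t : R => X t w)} ;
  bm_increments : independent_increments X ;
  bm_normal : forall r t : R, r < t -> forall A : set R, measurable A ->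
    P (increment X r t @^-1` A) = normal_prob 0 (Num.sqrt (t - r)) A
}.

Definition process_sigma_algebra (d : measure_display) (T : measurableType d)
    (R : realType) (P : probability T R) (X : R -> {RV P >-> R}) :
    set (set T) :=
  <<s \bigcup_(t in [set: R]) preimage_set_system setT (X t) measurable >>.

(* The processes are identically distributed because the four properties of
   two_sided_brownian_motion determine the law. *)
Definition iid_two_sided_brownian_motions (d : measure_display)
    (T : measurableType d) (R : realType) (P : probability T R)
    (B : nat -> R -> {RV P >-> R}) : Prop :=
  (forall i, two_sided_brownian_motion (B i)) /\
  mutually_independent P (fun i => process_sigma_algebra (B i)).

(* Only the values s 0, ..., s n of the sequence s matter.  The supremum is
   taken in the extended reals. *)
Definition last_passage_time (d : measure_display) (T : measurableType d)
    (R : realType) (P : probability T R) (B : nat -> R -> {RV P >-> R})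
    (mu : R) (n : nat) (t : R) (w : T) : \bar R :=
  ereal_sup [set x | exists s : nat -> R,
    [/\ forall j, (j < n)%N -> s j < s j.+1,
        s n = t &
        x = (mu * s 0%N - B 0%N (s 0%N) w
             + \sum_(1 <= j < n.+1) increment (B j) (s j.-1) (s j) w)%:E]].

(* The library's 'E_P[X] requires X real-valued; this is the expectation of
   exp(lambda * Y) for Y with values in the extended reals. *)
Definition exp_moment (d : measure_display) (T : measurableType d)
    (R : realType) (P : probability T R) (lambda : R) (Y : T -> \bar R) :
    \bar R :=
  (\int[P]_w expeR (lambda%:E * Y w))%E.

(* Main.v *)
(** For n levels, time horizon T and 0 < lambda < mu put
    F = exp(T (lambda^2/2 + mu lambda)) ((mu + lambda)/mu)^n and
    G = exp(T (mu lambda - lambda^2/2)) (mu/(mu - lambda))^n.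
    Then max(F, G) <= E exp(lambda L_n(T)) <= F + G, which gives the limit; the case
    lambda >= mu follows because G blows up as the exponent increases to mu.

    For simple random walks of step eps in place of the Brownian motions, the
    gaps between consecutive levels are queues in tandem with Bernoulli service
    and, by Burke's property, the product of geometric laws of parameter
    rho = exp(-2 mu eps) is stationary.  A path achieving the last passage time
    either leaves the bottom level after time 0, and tilting the bottom walk by
    lambda moves the stationary parameter to that of mu + lambda, which gives F;
    or it only sees the stationary gaps at time 0, where tilting from the top
    level moves the parameter to that of mu - lambda, which gives G.

    The Brownian model on a time grid is compared with the walks by a Lindeberg
    replacement: the maximum is smoothed at inverse temperature beta, as a
    function of a single weight the smoothed moment is (U e^(b x) + V)^a with
    |b| = beta and a beta = lambda, and one replacement costs a factor
    1 + O(eps^3 beta^2) because the Gaussian and the Bernoulli means of 1, sinh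
    and cosh agree up to O(eps^3).  With eps ~ 8^-j, beta = 2^j and
    (j + 1) 64^j time steps the total cost tends to 1, and Fatou's lemma and
    continuity of the paths remove the grid. *)
From HB Require Import structures.
Require Import Defs.
From mathcomp Require Import all_boot all_order all_algebra finmap.
From mathcomp Require Import all_classical all_reals all_analysis.
From mathcomp Require Import measurable_realfun zify ring lra.
Import Order.TTheory GRing.Theory Num.Theory.
Import numFieldNormedType.Exports.

Set Implicit Arguments.
Unset Strict Implicit.
Unset Printing Implicit Defensive.

Local Open Scope classical_set_scope.
Local Open Scope ring_scope.


(** * Bernoulli queues in tandem *)

(** Burke's property is proved for walks because there it reduces to a finite identity for one
    queue, and the moments become nested two-point averages in the extended reals, with no
    probability space for the walks. The price is the passage to Brownian motion for an unbounded
    exponential functional: each replacement error must be relative to the moment itself, so that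
    errors multiply over the cells. The scales balance two costs. With eps ~ 8^-j and beta = 2^j one
    replacement costs about 128^-j and there are about (j + 1) 64^j cells, while smoothing costs the
    power lambda/beta of the number of paths, whose logarithm is O(j + 1); both totals are O((j + 1)
    2^-j). The second obstacle is the infinite past: s_0 has no lower bound, whereas a grid is
    finite. The walks start from a flat profile at time -j t, and the gap to the stationary profile
    is bounded by a factor q_j^j, where q_j tends to a limit below 1 because lambda < mu. Finally,
    the last passage time is a supremum over uncountably many sequences, so the integral comparisons
    are arranged to need measurability of the grid quantities only. *)

Section mixture.
Context {R : realType}.
Local Open Scope ereal_scope.
Implicit Types (p q : R) (u v : \bar R).

Definition mix p u v : \bar R := p%:E * u + (1 - p)%:E * v.

Lemma mix_ge0 p u v : (0 <= p <= 1)%R -> 0 <= u -> 0 <= v -> 0 <= mix p u v.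
Proof.
by move=> /andP[p0 p1] u0 v0; rewrite adde_ge0// mule_ge0// lee_fin ?subr_ge0.
Qed.

Lemma le_mix p u u' v v' : (0 <= p <= 1)%R -> u <= u' -> v <= v' ->
  mix p u v <= mix p u' v'.
Proof.
by move=> /andP[p0 p1] uu' vv'; rewrite leeD// lee_wpmul2l// lee_fin ?subr_ge0.
Qed.

Lemma mixD p u u' v v' : 0 <= u -> 0 <= u' -> 0 <= v -> 0 <= v' ->
  mix p (u + u') (v + v') = mix p u v + mix p u' v'.
Proof. by move=> *; rewrite /mix !ge0_muleDr// addeACA. Qed.

Lemma mixZ p c u v : (0 <= p <= 1)%R -> 0 <= u -> 0 <= v ->
  mix p (c * u) (c * v) = c * mix p u v.
Proof.
move=> /andP[p0 p1] u0 v0; rewrite /mix ge0_muleDr.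
- by rewrite (muleCA c) (muleCA c).
- by rewrite mule_ge0// lee_fin.
- by rewrite mule_ge0// lee_fin subr_ge0.
Qed.

Lemma mix_mulr p (a b : R) u : (0 <= p <= 1)%R -> (0 <= a)%R -> (0 <= b)%R ->
  mix p (a%:E * u) (b%:E * u) = (p * a + (1 - p) * b)%:E * u.
Proof.
move=> /andP[p0 p1] a0 b0; rewrite /mix !muleA -!EFinM.
by rewrite -ge0_muleDl ?lee_fin ?mulr_ge0 ?subr_ge0.
Qed.

Lemma mix_id p u : (0 <= p <= 1)%R -> 0 <= u -> mix p u u = u.
Proof.
move=> /andP[p0 p1] u0; rewrite /mix -ge0_muleDl ?lee_fin ?subr_ge0//.
by rewrite -EFinD addrC subrK mul1e.
Qed.

Lemma mix1 u v : mix 1 u v = u.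
Proof. by rewrite /mix mul1e subrr mul0e adde0. Qed.

Lemma le_mix_weight p q u v : (0 <= p)%R -> (p <= q)%R -> (q <= 1)%R ->
  0 <= v -> v <= u -> mix p u v <= mix q u v.
Proof.
move=> p0 pq q1 v0 vu; rewrite /mix.
have -> : (1 - p)%R%:E = (q - p)%R%:E + (1 - q)%R%:E.
  by rewrite -EFinD; congr (_%:E); lra.
have -> : q%:E = p%:E + (q - p)%R%:E by rewrite -EFinD; congr (_%:E); lra.
rewrite !ge0_muleDl ?lee_fin ?subr_ge0// -addeA.
by rewrite leeD// leeD// lee_wpmul2l// lee_fin subr_ge0.
Qed.

Lemma ge_mix_weight p q u v : (0 <= p)%R -> (p <= q)%R -> (q <= 1)%R ->
  0 <= u -> u <= v -> mix q u v <= mix p u v.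
Proof.
move=> p0 pq q1 v0 vu; rewrite /mix addeC [leRHS]addeC.
have h := @le_mix_weight (1 - q) (1 - p) v u.
rewrite /mix !subKr in h; apply: h => //; lra.
Qed.

End mixture.

(** * Geometric laws: memorylessness, tilting, monotonicity in the parameter *)

Section geometric.
Context {R : realType}.
Local Open Scope ereal_scope.
Implicit Types (rho : R) (f g : nat -> \bar R).

Definition geo rho f : \bar R := \sum_(0 <= k <oo) ((1 - rho) * rho ^+ k)%:E * f k.

Section fixed_rho.
Variable (rho : R).
Hypothesis rho01 : (0 <= rho < 1)%R.

Let w_ge0 k : (0 <= (1 - rho) * rho ^+ k)%R.
Proof.
by move: rho01 => /andP[? /ltW ?]; rewrite mulr_ge0 ?subr_ge0// exprn_ge0.
Qed.

Lemma geo_ge0 f : (forall k, 0 <= f k) -> 0 <= geo rho f.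
Proof. by move=> f0; apply: nneseries_ge0 => k _ _; rewrite mule_ge0// lee_fin. Qed.

Lemma le_geo f g : (forall k, 0 <= f k) -> (forall k, f k <= g k) ->
  geo rho f <= geo rho g.
Proof.
move=> f0 fg; apply: lee_nneseries => k _; last by rewrite lee_wpmul2l// lee_fin.
by rewrite mule_ge0// lee_fin.
Qed.

Lemma eq_geo f g : f =1 g -> geo rho f = geo rho g.
Proof. by move=> fg; apply: eq_eseriesr => k _; rewrite fg. Qed.

Lemma geoD f g : (forall k, 0 <= f k) -> (forall k, 0 <= g k) ->
  geo rho (fun k => f k + g k) = geo rho f + geo rho g.
Proof.
move=> f0 g0; rewrite /geo -nneseriesD => [|k _ _|k _ _].
- by apply: eq_eseriesr => k _; rewrite ge0_muleDr.
- by rewrite mule_ge0// lee_fin.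
- by rewrite mule_ge0// lee_fin.
Qed.

Lemma geoZ (c : R) f : (0 <= c)%R -> (forall k, 0 <= f k) ->
  geo rho (fun k => c%:E * f k) = c%:E * geo rho f.
Proof.
move=> c0 f0; rewrite /geo -nneseriesZl => [|k _].
- by apply: eq_eseriesr => k _; rewrite muleCA.
- by rewrite mule_ge0// lee_fin.
Qed.

Lemma geo_mix p f g : (0 <= p <= 1)%R -> (forall k, 0 <= f k) ->
  (forall k, 0 <= g k) ->
  geo rho (fun k => mix p (f k) (g k)) = mix p (geo rho f) (geo rho g).
Proof.
move=> /andP[p0 p1] f0 g0; rewrite /mix geoD => [|k|k].
- by rewrite !geoZ// subr_ge0.
- by rewrite mule_ge0// lee_fin.
- by rewrite mule_ge0// lee_fin subr_ge0.
Qed.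

(** Memorylessness: conditioned to be positive, a geometric variable minus one has its original
    law. *)
Lemma geo_recl f : (forall k, 0 <= f k) ->
  geo rho f = mix rho (geo rho (f \o succn)) (f 0%N).
Proof.
move=> f0; rewrite /geo (@nneseries_split _ _ 0 1); last first.
  by move=> k _; rewrite mule_ge0// lee_fin.
rewrite add0n big_nat1 expr0 mulr1 addeC; congr (_ + _).
rewrite -nneseriesZl; last by move=> k _; rewrite mule_ge0 ?lee_fin ?w_ge0//; exact: f0.
rewrite -(@nneseries_addn _ _ 1); last first.
  by move=> k; rewrite mule_ge0// lee_fin.
apply: eq_eseriesr => k _ /=; rewrite addn1 exprS muleA -EFinM.
by congr (_%:E * _); ring.
Qed.

Lemma geo_cst1 : geo rho (fun=> 1) = 1.
Proof.
move: rho01 => /andP[r0 r1]; rewrite /geo.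
under eq_eseriesr do rewrite mule1.
apply/cvg_lim => //.
have -> : (fun n => \sum_(0 <= k < n) ((1 - rho) * rho ^+ k)%:E) =
    (fun n => (1 - rho ^+ n)%:E).
  apply/funext => n; rewrite sumEFin; congr (_%:E); rewrite -mulr_sumr big_mkord.
  by rewrite -[RHS]opprB (subrX1 rho n) -mulNr opprB.
rewrite -[X in _ --> X](_ : (1 - 0)%:E = _); last by rewrite subr0.
apply: cvg_EFin; first by near=> n.
apply: cvgB; first exact: cvg_cst.
by apply: cvg_expr; rewrite ger0_norm.
Unshelve. all: by end_near. Qed.

Lemma geo_cst (c : R) : (0 <= c)%R -> geo rho (fun=> c%:E) = c%:E.
Proof.
move=> c0; rewrite -[RHS]mule1 -geo_cst1 -geoZ//.
by apply: eq_geo => k; rewrite mule1.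
Qed.

Lemma geo_cste (c : \bar R) : 0 <= c -> geo rho (fun=> c) = c.
Proof.
move: rho01 => /andP[r0 r1]; case: c => [c c0||//]; first by rewrite geo_cst.
move=> _; rewrite /geo (@nneseries_split _ _ 0 1) ?add0n ?big_nat1; last first.
  by move=> k _; rewrite mule_ge0// lee_fin.
rewrite expr0 mulr1 gt0_muley ?lte_fin ?subr_gt0// addye// gt_eqF//.
rewrite (@lt_le_trans _ _ 0)//; apply: nneseries_ge0 => k _ _.
by rewrite mule_ge0// lee_fin.
Qed.

(** Exponential tilting stays within geometric laws, and the constant is the ratio of the
    normalisations. With [rho] = exp(-2 mu eps) and [y] = exp(2 lambda eps) the condition
    [rho * y < 1] is lambda < mu. *)
Lemma geo_tilt (y : R) f : (0 < y)%R -> (rho * y < 1)%R ->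
  (forall k, 0 <= f k) ->
  geo rho (fun k => (y ^+ k)%:E * f k) =
  ((1 - rho) / (1 - rho * y))%:E * geo (rho * y) f.
Proof.
move=> y0 ry1 f0; move: rho01 => /andP[r0 r1]; rewrite /geo -nneseriesZl.
  apply: eq_eseriesr => k _; rewrite !muleA -!EFinM; congr (_%:E * _).
  have ? : (1 - rho * y != 0)%R by rewrite gt_eqF// subr_gt0.
  by rewrite exprMn; field.
move=> k _; rewrite mule_ge0// lee_fin mulr_ge0 ?exprn_ge0//.
  by rewrite subr_ge0 ltW.
by rewrite mulr_ge0// ltW.
Qed.

End fixed_rho.

(** The mean of [f] at a geometric variable stopped at [m]. The finite recursion lets two parameters
    be compared trial by trial. *)
Fixpoint geo_stop rho (m : nat) f : \bar R :=
  if m is m'.+1 then mix rho (geo_stop rho m' (f \o succn)) (f 0%N) else f 0%N.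

Lemma geo_stop_ge rho m f : (0 <= rho <= 1)%R -> {homo f : i j / (i <= j)%N >-> i <= j} ->
  0 <= f 0%N -> f 0%N <= geo_stop rho m f.
Proof.
move=> r01; elim: m f => [//|m IH] f fi f0 /=.
rewrite -[leLHS](mix_id r01)// le_mix//.
apply: (le_trans (fi 0%N 1%N _)) => //; apply: (IH (f \o succn)) => /=.
- by move=> i j ij; apply: fi.
- exact: le_trans f0 (fi _ _ _).
Qed.

Lemma le_geo_stop rho rho' m f : (0 <= rho')%R -> (rho' <= rho)%R -> (rho < 1)%R ->
  {homo f : i j / (i <= j)%N >-> i <= j} ->
  0 <= f 0%N -> geo_stop rho' m f <= geo_stop rho m f.
Proof.
move=> r0 rr r1; elim: m f => [//|m IH] f fi f0 /=.
have f1 : 0 <= (f \o succn) 0%N by exact: le_trans f0 (fi _ _ _).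
have f1i : {homo (f \o succn) : i j / (i <= j)%N >-> i <= j}.
  by move=> i j ij; apply: fi.
apply: (@le_trans _ _ (mix rho' (geo_stop rho m (f \o succn)) (f 0%N))).
  by apply: le_mix; rewrite ?IH// r0 ltW// (le_lt_trans rr).
apply: le_mix_weight => //; first exact: ltW.
apply: le_trans (fi 0%N 1%N _) _ => //.
by apply: geo_stop_ge => //; rewrite (le_trans r0)//= ltW.
Qed.

Lemma geo_stop_le_geo rho m f : (0 <= rho < 1)%R ->
  {homo f : i j / (i <= j)%N >-> i <= j} ->
  (forall k, 0 <= f k) -> geo_stop rho m f <= geo rho f.
Proof.
move=> r01 ; have r01' : (0 <= rho <= 1)%R by case/andP: r01 => -> /ltW ->.
elim: m f => [|m IH] f fi f0 /=.
- by rewrite -[leLHS](geo_cste r01)//; apply: le_geo => // k; exact: fi.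
- rewrite geo_recl// le_mix// IH// => [i j ij|k]; [exact: fi|exact: f0].
Qed.

Lemma geo_partial_le_stop rho m f : (0 <= rho < 1)%R ->
  {homo f : i j / (i <= j)%N >-> i <= j} -> (forall k, 0 <= f k) ->
  \sum_(0 <= k < m) ((1 - rho) * rho ^+ k)%:E * f k <= geo_stop rho m f.
Proof.
move=> /andP[r0 r1]; elim: m f => [|k IH] f fi f0; first by rewrite big_geq ?f0.
rewrite big_nat_recl//= /mix expr0 mulr1 addeC leeD//.
have fi' : {homo (f \o succn) : i j / (i <= j)%N >-> i <= j}.
  by move=> i j ij; apply: fi.
apply: le_trans (lee_wpmul2l _ (IH _ fi' _)); rewrite ?lee_fin//; last first.
  by move=> ?; exact: f0.
rewrite ge0_sume_distrr.
  apply: lee_sum => i _ /=; rewrite muleA -EFinM exprS lee_wpmul2r//.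
  by rewrite lee_fin mulrCA.
move=> i _; rewrite mule_ge0// ?f0// lee_fin mulr_ge0 ?exprn_ge0//.
by rewrite subr_ge0 ltW.
Qed.

(** Stochastic monotonicity. The stopped means interpolate: they dominate the partial sums for
    [rho'], increase with the parameter, and stay below the full mean for [rho]. *)
Lemma le_geo_rho rho rho' f : (0 <= rho')%R -> (rho' <= rho)%R -> (rho < 1)%R ->
  {homo f : i j / (i <= j)%N >-> i <= j} ->
  (forall k, 0 <= f k) -> geo rho' f <= geo rho f.
Proof.
move=> r0 rr r1 fi f0.
have r01 : (0 <= rho < 1)%R by rewrite r1 (le_trans r0).
apply: lime_le.
  apply: is_cvg_nneseries => k _ _; rewrite mule_ge0// lee_fin mulr_ge0 ?exprn_ge0//.
  by rewrite subr_ge0 ltW// (le_lt_trans rr).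
near=> m; apply: le_trans (geo_stop_le_geo m r01 fi f0).
apply: le_trans (le_geo_stop m r0 rr r1 fi (f0 _)).
by apply: geo_partial_le_stop => //; rewrite r0 (le_lt_trans rr).
Unshelve. all: by end_near. Qed.

End geometric.

(** * One time step of queues in tandem, and Burke's property *)

Section tandem.
Context {R : realType}.
Local Open Scope ereal_scope.
Implicit Types (p rho theta : R) (qs rs : seq nat) (a b : bool).
Implicit Type k : seq nat -> bool -> \bar R.

(** The arrival joins before the service is used, so a customer may leave in the slot in which it
    came. The truncated subtraction loses a service offered to an empty queue. *)
Definition queue (q : nat) (a s : bool) : nat := (q + a - s)%N.
Definition departure (q : nat) (a s : bool) : bool := s && ((0 < q)%N || a).

Arguments queue : simpl never.
Arguments departure : simpl never.

Lemma queue_departure q a s : (queue q a s + departure q a s = q + a)%N.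
Proof. by rewrite /queue /departure; case: q a s => [|q] [] []//=; lia. Qed.

(** Expectation over independent fair services, in continuation-passing style: [k] receives the new
    queues together with the departure from the last one. This keeps the joint law available without
    a probability space. *)
Fixpoint lev qs a k : \bar R :=
  if qs is q :: qs' then
    mix 2^-1 (lev qs' (departure q a true) (fun rs => k (queue q a true :: rs)))
             (lev qs' (departure q a false) (fun rs => k (queue q a false :: rs)))
  else k [::] a.

Lemma half01 : (0 <= (2^-1 : R) <= 1)%R.
Proof. by apply/andP; split; lra. Qed.
Hint Resolve half01 : core.

Lemma lev_ge0 qs a k : (forall rs b, 0 <= k rs b) -> 0 <= lev qs a k.
Proof.
elim: qs a k => [|q qs IH] a k k0 /=; first exact: k0.
by rewrite mix_ge0// IH.
Qed.

(** Customers are conserved in every cell, so only configurations obeying the global balance are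
    reached. This is what moves a weight from the arrivals to the departures. *)
Lemma lev_conserve qs a k k' :
  (forall rs b, size rs = size qs -> (sumn rs + b = sumn qs + a)%N ->
     k rs b = k' rs b) -> lev qs a k = lev qs a k'.
Proof.
elim: qs a k k' => [|q qs IH] a k k' H /=; first exact: H.
by congr (mix _ _ _); apply: IH => rs b srs e; apply: H => /=;
  rewrite ?srs// -addnA e addnCA queue_departure; lia.
Qed.

Lemma levZ (c : R) qs a k : (0 <= c)%R -> (forall rs b, 0 <= k rs b) ->
  lev qs a (fun rs b => c%:E * k rs b) = c%:E * lev qs a k.
Proof.
move=> c0; elim: qs a k => [//|q qs IH] a k k0 /=.
by rewrite !IH// mixZ// lev_ge0.
Qed.

Definition lerel (rs rs' : seq nat) := all2 leq rs rs'.

(** Coupling through common services: a longer queue or an extra arrival never shortens a queue or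
    suppresses a departure. The abstract relation [r] serves increasing and decreasing functionals
    alike. *)
Lemma lev_homo (r : \bar R -> \bar R -> Prop) :
  (forall u v u' v', r u u' -> r v v' -> r (mix 2^-1 u v) (mix 2^-1 u' v')) ->
  forall qs qs' a a' k k', lerel qs qs' -> a ==> a' ->
  (forall rs rs' b b', lerel rs rs' -> b ==> b' -> r (k rs b) (k' rs' b')) ->
  r (lev qs a k) (lev qs' a' k').
Proof.
move=> rmix; elim=> [|q qs IH] [|q' qs']//= a a' k k'.
  by move=> _ aa' H; exact: H.
move=> /andP[qq' ss'] aa' H.
have cellP s : (queue q a s <= queue q' a' s)%N /\
    (departure q a s ==> departure q' a' s).
  rewrite /queue /departure; split; last first.
    move: aa' qq'; case: s => //=; case: a; case: a' => //=; rewrite ?orbT// ?orbF//.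
      by move=> _ _; apply/implyP.
    by move=> _ ?; apply/implyP; lia.
  by move: aa'; case: a; case: a' => //= _; case: s; lia.
have [q1 d1] := cellP true; have [q0 d0] := cellP false.
apply: rmix; apply: IH => // rs rs' b b' rr bb; apply: H => //=; exact/andP.
Qed.

Fixpoint geos (n : nat) rho (f : seq nat -> \bar R) : \bar R :=
  if n is n'.+1 then geo rho (fun q => geos n' rho (fun qs => f (q :: qs)))
  else f [::].

Lemma geos_ge0 rho n f : (0 <= rho < 1)%R -> (forall qs, 0 <= f qs) ->
  0 <= geos n rho f.
Proof.
move=> rho01; elim: n f => [|n IH] f f0 /=; first exact: f0.
by apply: (geo_ge0 rho01) => q; apply: IH.
Qed.

Section fixed_rho.
Variable rho : R.
Hypothesis rho01 : (0 <= rho < 1)%R.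

Lemma le_geos n f g : (forall qs, 0 <= f qs) ->
  (forall qs, size qs = n -> f qs <= g qs) -> geos n rho f <= geos n rho g.
Proof.
elim: n f g => [|n IH] f g f0 fg /=; first exact: fg.
apply: le_geo => // [q|q]; first exact: geos_ge0.
by apply: IH => // qs sqs; apply: fg => /=; rewrite sqs.
Qed.

Lemma eq_geos n f g : (forall qs, size qs = n -> f qs = g qs) ->
  geos n rho f = geos n rho g.
Proof.
elim: n f g => [|n IH] f g fg /=; first exact: fg.
by apply: eq_geo => q; apply: IH => qs sqs; apply: fg => /=; rewrite sqs.
Qed.

Lemma geosD n f g : (forall qs, 0 <= f qs) -> (forall qs, 0 <= g qs) ->
  geos n rho (fun qs => f qs + g qs) = geos n rho f + geos n rho g.
Proof.
elim: n f g => [//|n IH] f g f0 g0 /=.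
rewrite -geoD//; [|by move=> q; exact: geos_ge0..].
by apply: eq_geo => q; rewrite -IH.
Qed.

Lemma geosZ n (c : R) f : (0 <= c)%R -> (forall qs, 0 <= f qs) ->
  geos n rho (fun qs => c%:E * f qs) = c%:E * geos n rho f.
Proof.
move=> c0; elim: n f => [//|n IH] f f0 /=.
rewrite -geoZ//; last by move=> q; exact: geos_ge0.
by apply: eq_geo => q; rewrite -IH.
Qed.

Lemma geos_cst n (c : \bar R) : 0 <= c -> geos n rho (fun=> c) = c.
Proof.
move=> c0; elim: n => [//|n IH] /=.
by rewrite -[RHS](geo_cste rho01 c0); apply: eq_geo.
Qed.

Lemma geos_mix n p f g : (0 <= p <= 1)%R -> (forall qs, 0 <= f qs) ->
  (forall qs, 0 <= g qs) ->
  geos n rho (fun qs => mix p (f qs) (g qs)) =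
  mix p (geos n rho f) (geos n rho g).
Proof.
move=> p01; elim: n f g => [//|n IH] f g f0 g0 /=.
rewrite -geo_mix//; [|by move=> q; exact: geos_ge0..].
by apply: eq_geo => q; rewrite -IH.
Qed.

Lemma geos_tilt n (y : R) f : (0 < y)%R -> (rho * y < 1)%R ->
  (forall qs, 0 <= f qs) ->
  geos n rho (fun qs => (y ^+ sumn qs)%:E * f qs) =
  (((1 - rho) / (1 - rho * y)) ^+ n)%:E * geos n (rho * y) f.
Proof.
move=> y0 ry1; have ry01 : (0 <= rho * y < 1)%R.
  by rewrite ry1 mulr_ge0 ?(ltW y0)//; case/andP: rho01.
have c0 : (0 <= (1 - rho) / (1 - rho * y))%R.
  by rewrite divr_ge0 ?subr_ge0 ?ltW//; case/andP: rho01.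
elim: n f => [|n IH] f f0 /=; first by rewrite !expr0.
transitivity (geo rho (fun q => (y ^+ q)%:E *
    ((((1 - rho) / (1 - rho * y)) ^+ n)%:E * geos n (rho * y) (fun qs => f (q :: qs))))).
  apply: eq_geo => q; rewrite -IH// -geosZ ?exprn_ge0//; last 2 first.
  - exact: ltW.
  - by move=> qs; rewrite mule_ge0// lee_fin exprn_ge0// ltW.
  by apply: eq_geos => qs _; rewrite exprD EFinM muleA.
rewrite geo_tilt//; last first.
  by move=> q; rewrite mule_ge0 ?lee_fin ?exprn_ge0// geos_ge0.
rewrite geoZ ?exprn_ge0//; last by move=> q; rewrite geos_ge0.
by rewrite muleA -EFinM -exprS.
Qed.

(* Burke's property of a single cell. *)
Lemma burke_cell p (F : nat -> bool -> \bar R) : (0 <= p <= 1)%R ->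
  p = (rho * (1 - p))%R -> (forall q b, 0 <= F q b) ->
  geo rho (fun q => mix p
    (mix 2^-1 (F (queue q true true) (departure q true true))
              (F (queue q true false) (departure q true false)))
    (mix 2^-1 (F (queue q false true) (departure q false true))
              (F (queue q false false) (departure q false false)))) =
  geo rho (fun q => mix p (F q true) (F q false)).
Proof.
move=> p01 pE F0.
rewrite !(geo_mix rho01)//; [|by move=> q; rewrite ?mix_ge0..].
have r01 : (0 <= rho <= 1)%R by case/andP: rho01 => -> /ltW.
have e11 : geo rho (fun q => F (queue q true true) (departure q true true)) =
    geo rho (F^~ true).
  by apply: eq_geo => q; rewrite /queue /departure orbT addn1 subn1.
have e00 : geo rho (fun q => F (queue q false false) (departure q false false)) =
    geo rho (F^~ false).
  by apply: eq_geo => q; rewrite /queue /departure addn0 subn0.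
have e10 : geo rho (fun q => F (queue q true false) (departure q true false)) =
    geo rho (fun q => F q.+1 false).
  by apply: eq_geo => q; rewrite /queue /departure addn1 subn0.
have e01 : geo rho (fun q => F (queue q false true) (departure q false true)) =
    mix rho (geo rho (F^~ true)) (F 0%N false).
  rewrite (geo_recl rho01)//; congr (mix _ _ _).
  by apply: eq_geo => q /=; rewrite /queue /departure addn0 subn1.
rewrite e11 e00 e10 e01 (geo_recl rho01 (F0^~ false)).
have := geo_ge0 rho01 (F0^~ true); set U := geo rho (F^~ true) => U0.
have : 0 <= geo rho ((F^~ false) \o succn) by apply: geo_ge0 => // k; exact: F0.
rewrite -[geo rho ((F^~ false) \o succn)]/(geo rho (fun q => F q.+1 false)).
set V := geo rho _ => V0; have := F0 0%N false; set w := F 0%N false => w0.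
move: p01 r01 => /andP[p0 p1] /andP[r0 r1].
have [p1' r1'] : (0 <= 1 - p)%R /\ (0 <= 1 - rho)%R by rewrite !subr_ge0.
have h0 : (0 <= 1 - 2^-1 :> R)%R by lra.
have h0' : (0 <= 2^-1 :> R)%R by lra.
rewrite /mix !ge0_muleDr ?mule_ge0 ?adde_ge0 ?mule_ge0 ?lee_fin//.
rewrite !muleA -!EFinM.
(* Both sides are combinations of the same three numbers. Their coefficients agree because
   [p = rho * (1 - p)], the detailed balance between an arrival without service and a service
   without arrival. *)
rewrite [LHS](_ : _ = (p * 2^-1 + (1 - p) * 2^-1 * rho)%R%:E * U +
   ((p * (1 - 2^-1) + (1 - p) * (1 - 2^-1) * rho)%R%:E * V +
   ((1 - p) * 2^-1 * (1 - rho) + (1 - p) * (1 - 2^-1) * (1 - rho))%R%:E * w)).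
  by congr (_%:E * _ + (_%:E * _ + _%:E * _)); have := pE; lra.
rewrite !EFinD !ge0_muleDl ?lee_fin ?mulr_ge0//.
rewrite -!addeA; congr (_ + _).
rewrite [RHS]addeCA; congr (_ + _).
by congr (_ + _); exact: addeCA.
Qed.

(** Induction along the queues: the departure from the first one is again Bernoulli and independent
    of the length left behind, hence a legitimate arrival for the others. *)
Lemma burke n p k : (0 <= p <= 1)%R -> p = (rho * (1 - p))%R ->
  (forall qs b, 0 <= k qs b) ->
  geos n rho (fun qs => mix p (lev qs true k) (lev qs false k)) =
  geos n rho (fun qs => mix p (k qs true) (k qs false)).
Proof.
move=> p01 pE; elim: n k => [//|n IH] k k0 /=.
pose F q b := geos n rho (fun qs => lev qs b (fun rs => k (q :: rs))).
have F0 q b : 0 <= F q b by apply: geos_ge0 => // qs; exact: lev_ge0.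
transitivity (geo rho (fun q => mix p
    (mix 2^-1 (F (queue q true true) (departure q true true))
              (F (queue q true false) (departure q true false)))
    (mix 2^-1 (F (queue q false true) (departure q false true))
              (F (queue q false false) (departure q false false))))).
  apply: eq_geo => q; rewrite geos_mix//; last 2 first.
  - by move=> qs; rewrite mix_ge0// lev_ge0.
  - by move=> qs; rewrite mix_ge0// lev_ge0.
  by congr (mix _ _ _); rewrite geos_mix// => qs; rewrite lev_ge0.
rewrite (burke_cell p01 pE F0); apply: eq_geo => q.
rewrite -(IH (fun rs => k (q :: rs)))//.
by rewrite geos_mix// => qs; rewrite lev_ge0.
Qed.

End fixed_rho.

Lemma lerel_refl qs : lerel qs qs.
Proof. by elim: qs => //= q qs IH; rewrite leqnn. Qed.

Lemma lerel_nseq0 qs : lerel (nseq (size qs) 0%N) qs.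
Proof. by elim: qs => //= q qs IH; rewrite IH. Qed.

Lemma le_geos_rho rho rho' n f : (0 <= rho')%R -> (rho' <= rho)%R ->
  (rho < 1)%R -> (forall qs, 0 <= f qs) ->
  (forall qs qs', lerel qs qs' -> f qs <= f qs') ->
  geos n rho' f <= geos n rho f.
Proof.
move=> r0 rr r1.
have r'01 : (0 <= rho' < 1)%R by rewrite r0 (le_lt_trans rr).
have r01 : (0 <= rho < 1)%R by rewrite r1 (le_trans r0).
elim: n f => [//|n IH] f f0 fi /=.
apply: (@le_trans _ _ (geo rho' (fun q => geos n rho (fun qs => f (q :: qs))))).
  apply: le_geo => // q; first exact: geos_ge0.
  by apply: IH => // qs qs' h; apply: fi => /=; rewrite leqnn.
apply: le_geo_rho => // [q q' qq'|q]; last exact: geos_ge0.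
apply: le_geos => // qs _; apply: fi => /=; rewrite qq'; exact: lerel_refl.
Qed.

Section weighted.
Variable theta : R.

(** An arrival stands for a down-step of the walk below the queue, so with [theta] = lambda eps this
    is exp(lambda * step). *)
Definition weight b : R := (expR (if b then - theta else theta))%R.

Lemma weight_ge0 b : (0 <= weight b)%R.
Proof. exact: expR_ge0. Qed.

Definition tilted_mean p : R := (p * weight true + (1 - p) * weight false)%R.

Lemma tilted_mean_gt0 p : (0 <= p <= 1)%R -> (0 < tilted_mean p)%R.
Proof.
move=> /andP[p0 p1]; rewrite /tilted_mean.
have := expR_gt0 (- theta); have := expR_gt0 theta.
by rewrite /weight; nra.
Qed.

Definition stationary_step p (h : seq nat -> \bar R) qs :=
  mix p (lev qs true (fun rs _ => h rs)) (lev qs false (fun rs _ => h rs)).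

Definition bottom_step p (h : seq nat -> \bar R) qs :=
  mix p ((weight true)%:E * lev qs true (fun rs _ => h rs))
        ((weight false)%:E * lev qs false (fun rs _ => h rs)).

Definition top_step p (h : seq nat -> \bar R) qs :=
  mix p (lev qs true (fun rs b => (weight b)%:E * h rs))
        (lev qs false (fun rs b => (weight b)%:E * h rs)).

(** One customer is a gap of 2 eps between consecutive levels, so this is exp(lambda (top -
    bottom)). *)
Definition growth qs : \bar R := ((expR (2 * theta)) ^+ sumn qs)%R%:E.

Lemma growth_ge0 qs : 0 <= growth qs.
Proof. by rewrite lee_fin exprn_ge0 ?expR_ge0. Qed.

Let wE0 b : 0 <= (weight b)%:E.
Proof. by rewrite lee_fin weight_ge0. Qed.

Lemma stationary_step_ge0 p h : (0 <= p <= 1)%R -> (forall qs, 0 <= h qs) ->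
  forall qs, 0 <= stationary_step p h qs.
Proof. by move=> p01 h0 qs; rewrite mix_ge0// lev_ge0. Qed.

Lemma bottom_step_ge0 p h : (0 <= p <= 1)%R -> (forall qs, 0 <= h qs) ->
  forall qs, 0 <= bottom_step p h qs.
Proof. by move=> p01 h0 qs; rewrite mix_ge0// mule_ge0// lev_ge0. Qed.

Lemma top_step_ge0 p h : (0 <= p <= 1)%R -> (forall qs, 0 <= h qs) ->
  forall qs, 0 <= top_step p h qs.
Proof.
by move=> p01 h0 qs; rewrite mix_ge0// lev_ge0// => rs b; rewrite mule_ge0.
Qed.

Lemma iter_ge0 (step : (seq nat -> \bar R) -> seq nat -> \bar R) h :
  (forall h, (forall qs, 0 <= h qs) -> forall qs, 0 <= step h qs) ->
  (forall qs, 0 <= h qs) -> forall N qs, 0 <= iter N step h qs.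
Proof. by move=> s0 h0; elim=> [//|N IH] qs; exact: s0. Qed.

(** Change of measure on the arrivals: the weighted Bernoulli law is its total mass times another
    Bernoulli law. *)
Lemma bottom_step_tilt p h : (0 <= p <= 1)%R -> (forall qs, 0 <= h qs) ->
  forall qs, bottom_step p h qs = (tilted_mean p)%:E *
    stationary_step (p * weight true / tilted_mean p) h qs.
Proof.
move=> p01 h0 qs; have k0 := tilted_mean_gt0 p01.
case/andP: (p01) => p0 p1.
have u0 a : 0 <= lev qs a (fun rs _ => h rs) by rewrite lev_ge0.
rewrite /stationary_step -mixZ//; last first.
  rewrite divr_ge0 ?mulr_ge0 ?weight_ge0//= ?(ltW k0)//.
  by rewrite ler_pdivrMr// mul1r lerDl mulr_ge0 ?weight_ge0// subr_ge0.
rewrite /bottom_step /mix !muleA -!EFinM; congr (_%:E * _ + _%:E * _).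
  by rewrite divfK// gt_eqF.
have : (tilted_mean p != 0)%R by rewrite gt_eqF.
by rewrite /tilted_mean => ?; field.
Qed.

Lemma growth_conserve rs qs a b : (sumn rs + b = sumn qs + a)%N ->
  ((weight a)%:E * growth rs = growth qs * (weight b)%:E).
Proof.
move=> e; rewrite /growth -!EFinM /weight -!expRM_natl -!expRD; congr ((expR _)%:E).
have : ((sumn rs)%:R + b%:R = (sumn qs)%:R + a%:R :> R)%R by rewrite -!natrD e.
by case: a e; case: b => _ /=; rewrite ?addr0; nra.
Qed.

(** The final height of the top level can be counted as the motion of the bottom level plus the
    final gaps, or as the initial gaps plus the motion of the top level. Conservation in each step
    makes the two counts equal. *)
Lemma bottom_top N p : (0 <= p <= 1)%R -> forall qs,
  iter N (bottom_step p) growth qs = growth qs * iter N (top_step p) (fun=> 1) qs.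
Proof.
move=> p01; elim: N => [|N IH] qs /=; first by rewrite mule1.
have t0 rs : 0 <= iter N (top_step p) (fun=> 1) rs.
  by apply: iter_ge0 => // h h0; exact: top_step_ge0.
have key a : (weight a)%:E * lev qs a (fun rs _ => iter N (bottom_step p) growth rs) =
    growth qs * lev qs a (fun rs b => (weight b)%:E * iter N (top_step p) (fun=> 1) rs).
  rewrite {2}/growth -!levZ ?weight_ge0 ?exprn_ge0 ?expR_ge0//.
  - apply: lev_conserve => rs b _ /growth_conserve e.
    by rewrite IH muleA e muleA.
  - by move=> rs b; rewrite mule_ge0.
  - by move=> rs b; rewrite IH mule_ge0 ?growth_ge0.
rewrite {1}/bottom_step !key mixZ// lev_ge0// => rs b; exact: mule_ge0.
Qed.

End weighted.

End tandem.

(** * Stationary queues under the two tilts *)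

Section stationarity.
Context {R : realType}.
Local Open Scope ereal_scope.
Implicit Types (p rho theta : R) (qs rs : seq nat).
Hint Resolve half01 : core.

(** The arrival probability with odds [rho], which is the one that makes geometric queues of ratio
    [rho] stationary. *)
Definition prob rho : R := (rho / (1 + rho))%R.

Lemma prob01 rho : (0 <= rho)%R -> (0 <= prob rho <= 1)%R.
Proof.
move=> r0; rewrite divr_ge0 ?addr_ge0//= ler_pdivrMr ?mul1r ?lerDr//.
by rewrite ltr_wpDr.
Qed.

Lemma prob_ratio rho : (0 <= rho)%R -> prob rho = (rho * (1 - prob rho))%R.
Proof.
move=> r0; have : (1 + rho != 0)%R by rewrite gt_eqF// ltr_wpDr.
by rewrite /prob => ?; field.
Qed.

Lemma le_prob rho rho' : (0 <= rho)%R -> (rho <= rho')%R -> (prob rho <= prob rho')%R.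
Proof.
move=> r0 rr; rewrite /prob ler_pdivrMr ?ltr_wpDr// mulrAC ler_pdivlMr; nra.
Qed.

(** Tilting multiplies the odds by the ratio of the two weights; this turns exp(-2 mu eps) into
    exp(-2 (mu + lambda) eps). *)
Lemma prob_tilt theta rho : (0 <= rho)%R ->
  (prob rho * weight theta true / tilted_mean theta (prob rho) =
   prob (rho * expR (- (2 * theta))))%R.
Proof.
move=> r0; rewrite /tilted_mean /weight.
have -> : (- (2 * theta) = - theta - theta)%R by ring.
rewrite expRD; have := expR_gt0 (- theta); have := expRxMexpNx_1 theta.
set a := expR theta; set b := expR (- theta) => ab b0.
have a0 : (0 < a)%R by exact: expR_gt0.
have -> : b = (a^-1)%R by rewrite -[RHS]mulr1 -ab mulKf// gt_eqF.
rewrite /prob; field.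
have ha : a != 0%R by rewrite gt_eqF.
have h1 : (1 + rho != 0)%R by rewrite gt_eqF// ltr_wpDr.
have h2 : (a ^+ 2 + rho != 0)%R by rewrite gt_eqF// ltr_wpDr// exprn_gt0.
rewrite ha h1 /=; apply/andP; split; rewrite ?h2//.
Qed.

Section fixed_rho.
Variables (n : nat) (rho : R).
Hypothesis rho01 : (0 <= rho < 1)%R.

Let rho0 : (0 <= rho)%R. Proof. by case/andP: rho01. Qed.
Let p01 := prob01 rho0.

Lemma geos_stationary N h : (forall qs, 0 <= h qs) ->
  geos n rho (iter N (stationary_step (prob rho)) h) = geos n rho h.
Proof.
move=> h0; elim: N => [//|N IH] /=; rewrite -[RHS]IH.
rewrite /stationary_step burke//; last 2 first.
- exact: prob_ratio.
- by move=> qs _; apply: iter_ge0 => // *; exact: stationary_step_ge0.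
apply: eq_geos => // qs _; rewrite mix_id//.
by apply: iter_ge0 => // *; exact: stationary_step_ge0.
Qed.

(** In equilibrium the departure of a step is Bernoulli and independent of the queues after it, so
    the weights factor over time. *)
Lemma geos_top theta N :
  geos n rho (iter N (top_step theta (prob rho)) (fun=> 1)) =
  ((tilted_mean theta (prob rho)) ^+ N)%:E.
Proof.
have k0 := tilted_mean_gt0 theta p01.
have t0 M qs : 0 <= iter M (top_step theta (prob rho)) (fun=> 1) qs.
  by apply: iter_ge0 => // *; exact: top_step_ge0.
elim: N => [|N IH] /=; first by rewrite expr0 geos_cst.
rewrite exprS EFinM -IH -geosZ ?(ltW k0)//.
rewrite /top_step burke//; last 2 first.
- exact: prob_ratio.
- by move=> qs b; rewrite mule_ge0// lee_fin weight_ge0.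
apply: eq_geos => // qs _.
by rewrite mix_mulr ?weight_ge0.
Qed.

Lemma geos_growth theta (f : seq nat -> \bar R) : (rho * expR (2 * theta) < 1)%R ->
  (forall qs, 0 <= f qs) ->
  geos n rho (fun qs => growth theta qs * f qs) =
  (((1 - rho) / (1 - rho * expR (2 * theta))) ^+ n)%:E *
    geos n (rho * expR (2 * theta)) f.
Proof. by move=> ry f0; rewrite geos_tilt ?expR_gt0. Qed.

End fixed_rho.

Section monotonicity.
Variable theta : R.
Hypothesis theta0 : (0 <= theta)%R.

Lemma growth_incr qs qs' : lerel qs qs' -> growth theta qs <= growth theta qs'.
Proof.
move=> qq; rewrite lee_fin ler_weXn2l//.
  by rewrite -expR0 ler_expR mulr_ge0.
by elim: qs qs' qq => [|q qs IH] [|q' qs']//= /andP[? /IH]; lia.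
Qed.

Lemma stationary_step_incr p h : (0 <= p <= 1)%R ->
  (forall qs qs', lerel qs qs' -> h qs <= h qs') ->
  forall qs qs', lerel qs qs' -> stationary_step p h qs <= stationary_step p h qs'.
Proof.
move=> p01 hi qs qs' qq; apply: le_mix => //;
  apply: (lev_homo (r := fun u v => u <= v)) => // *; by [exact: le_mix|exact: hi].
Qed.

Lemma iter_stationary_incr p h : (0 <= p <= 1)%R ->
  (forall qs qs', lerel qs qs' -> h qs <= h qs') ->
  forall N qs qs', lerel qs qs' ->
    iter N (stationary_step p) h qs <= iter N (stationary_step p) h qs'.
Proof. by move=> p01 hi; elim=> [//|N IH] qs qs'; exact: stationary_step_incr. Qed.

Lemma iter_bottomE N p : (0 <= p <= 1)%R -> forall qs,
  iter N (bottom_step theta p) (growth theta) qs = (tilted_mean theta p ^+ N)%:E *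
    iter N (stationary_step (p * weight theta true / tilted_mean theta p)) (growth theta) qs.
Proof.
move=> p01; have k0 := tilted_mean_gt0 theta p01; case/andP: (p01) => p0 p1.
have p'01 : (0 <= p * weight theta true / tilted_mean theta p <= 1)%R.
  rewrite divr_ge0 ?mulr_ge0 ?weight_ge0//= ?(ltW k0)//.
  by rewrite ler_pdivrMr// mul1r lerDl mulr_ge0 ?weight_ge0// subr_ge0.
elim: N => [|N IH] qs /=; first by rewrite mul1e.
rewrite bottom_step_tilt//; last first.
  by move=> *; apply: iter_ge0 => // *; [exact: bottom_step_ge0|exact: growth_ge0].
have s0 rs : 0 <= iter N (stationary_step (p * weight theta true / tilted_mean theta p))
    (growth theta) rs.
  by apply: iter_ge0 => // *; [exact: stationary_step_ge0|exact: growth_ge0].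
rewrite exprS EFinM -muleA; congr (_ * _); rewrite -mixZ// ?lev_ge0//.
by congr (mix _ _ _); rewrite -levZ ?exprn_ge0 ?(ltW k0)//;
  apply: lev_conserve => rs b _ _; rewrite IH.
Qed.

Lemma iter_bottom_incr N p : (0 <= p <= 1)%R -> forall qs qs', lerel qs qs' ->
  iter N (bottom_step theta p) (growth theta) qs <=
  iter N (bottom_step theta p) (growth theta) qs'.
Proof.
move=> p01 qs qs' qq; have k0 := tilted_mean_gt0 theta p01; case/andP: (p01) => p0 p1.
rewrite !iter_bottomE// lee_wpmul2l ?lee_fin ?exprn_ge0 ?(ltW k0)//.
apply: iter_stationary_incr => //; last exact: growth_incr.
rewrite divr_ge0 ?mulr_ge0 ?weight_ge0//= ?(ltW k0)//.
by rewrite ler_pdivrMr// mul1r lerDl mulr_ge0 ?weight_ge0// subr_ge0.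
Qed.

(** More customers or more frequent arrivals produce more departures, and for [theta >= 0] a
    departure carries the smaller weight; all inequalities therefore reverse. *)
Lemma iter_top_decr N p p' : (0 <= p)%R -> (p <= p')%R -> (p' <= 1)%R ->
  forall qs qs', lerel qs qs' ->
  iter N (top_step theta p') (fun=> 1) qs' <= iter N (top_step theta p) (fun=> 1) qs.
Proof.
elim: N p p' => [//|N IH] p p' p0 pp p1 qs qs' qq /=.
have p01 : (0 <= p <= 1)%R by rewrite p0 (le_trans pp).
have p'01 : (0 <= p' <= 1)%R by rewrite p1 (le_trans p0).
have t0 (q : R) rs : (0 <= q <= 1)%R -> 0 <= iter N (top_step theta q) (fun=> 1) rs.
  by move=> q01; apply: iter_ge0 => // *; exact: top_step_ge0.
have wD b b' : b ==> b' -> (weight theta b')%:E <= (weight theta b)%:E :> \bar R.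
  rewrite lee_fin /weight ler_expR; case: b; case: b' => //= _.
  by rewrite (@le_trans _ _ 0%R)// oppr_le0.
have W0 b : 0 <= (weight theta b)%:E :> \bar R by rewrite lee_fin weight_ge0.
have L (q q' : R) rs rs' a a' : (0 <= q)%R -> (q <= q')%R -> (q' <= 1)%R ->
    lerel rs rs' -> a ==> a' ->
    lev rs' a' (fun rs b => (weight theta b)%:E * iter N (top_step theta q') (fun=> 1) rs) <=
    lev rs a (fun rs b => (weight theta b)%:E * iter N (top_step theta q) (fun=> 1) rs).
  move=> q0 qq' q1 rr aa; apply: (lev_homo (r := fun u v => v <= u)) rr aa _ => //.
    by move=> *; exact: le_mix.
  move=> xs xs' b b' xx bb; rewrite lee_pmul ?wD ?IH//.
  by rewrite t0// q1 (le_trans q0).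
apply: (@le_trans _ _ (mix p' (lev qs true (fun rs b => (weight theta b)%:E *
    iter N (top_step theta p) (fun=> 1) rs)) (lev qs false (fun rs b =>
    (weight theta b)%:E * iter N (top_step theta p) (fun=> 1) rs)))).
  by apply: le_mix => //; apply: L.
apply: ge_mix_weight => //; first by rewrite lev_ge0// => *; rewrite mule_ge0// t0.
by apply: L => //; [exact: le_trans p1|exact: lerel_refl].
Qed.

End monotonicity.

(** * The same dynamics in terms of positions *)

Section max_plus.
Variables (eps lam : R).
Hypotheses (eps0 : (0 <= eps)%R) (lam0 : (0 <= lam)%R).
Local Notation theta := (lam * eps)%R.
Implicit Types (x y z u v w : R) (xs ys zs : seq R) (h : R -> seq R -> \bar R).

Fixpoint levX u xs (k : seq R -> \bar R) : \bar R :=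
  if xs is x :: xs' then
    mix 2^-1
      (levX (Num.max (x - eps)%R u) xs' (fun ys => k (Num.max (x - eps)%R u :: ys)))
      (levX (Num.max (x + eps)%R u) xs' (fun ys => k (Num.max (x + eps)%R u :: ys)))
  else k [::].

Definition stepX p h x xs : \bar R :=
  mix p (levX (x - eps) xs (h (x - eps)%R)) (levX (x + eps) xs (h (x + eps)%R)).

Fixpoint positions x qs : seq R :=
  if qs is q :: qs' then
    (x + 2 * eps * q%:R)%R :: positions (x + 2 * eps * q%:R) qs'
  else [::].

Lemma last_positions x qs :
  last x (positions x qs) = (x + 2 * eps * (sumn qs)%:R)%R.
Proof.
elim: qs x => [|q qs IH] x /=; first by rewrite mulr0 addr0.
by rewrite IH natrD mulrDr addrA.
Qed.

(** Lindley's recursion. A down-step of a level is a service for the queue below it, and a down-step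
    actually made is an arrival for the queue above; the maximum pushes a level up exactly when its
    service is lost. *)
Lemma levX_positions x qs (a : bool) (k : seq R -> \bar R) :
  levX (x + (if a then - eps else eps))%R (positions x qs) k =
  lev qs a (fun rs _ => k (positions (x + (if a then - eps else eps))%R rs)).
Proof.
elim: qs x a k => [//|q qs IH] x a k /=.
have e0 := eps0.
have cellE s : Num.max (x + 2 * eps * q%:R + (if s then - eps else eps))%R
      (x + (if a then - eps else eps))%R =
    (x + 2 * eps * q%:R + (if departure q a s then - eps else eps))%R /\
    (x + 2 * eps * q%:R + (if departure q a s then - eps else eps))%R =
    (x + (if a then - eps else eps) + 2 * eps * (queue q a s)%:R)%R.
  rewrite /departure /queue; case: s; case: a => /=.
  - rewrite orbT addn1 subn1 /=; split; last by ring.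
    by rewrite max_l// lerD2r lerDl !mulr_ge0.
  - case: q => [|q] /=; rewrite ?addn0 ?subn1 /=.
      by split; [rewrite max_r//; lra|ring].
    split; [rewrite max_l// -addrA lerD2l|]; rewrite -natr1; first by have := ler0n R q; nra.
    by ring.
  - rewrite addn1 subn0 -natr1; split; last by ring.
    by rewrite max_l//; have := ler0n R q; nra.
  - rewrite addn0 subn0; split; last by ring.
    by rewrite max_l// lerD2r lerDl !mulr_ge0.
have [e1 e2] := cellE true; have [e3 e4] := cellE false.
congr (mix _ _ _).
- by rewrite e1 (IH _ (departure q a true)); apply: lev_conserve => rs b _ _; rewrite e2.
- by rewrite e3 (IH _ (departure q a false)); apply: lev_conserve => rs b _ _; rewrite e4.
Qed.

Lemma stepX_positions p h x qs :
  stepX p h x (positions x qs) =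
  mix p (lev qs true (fun rs _ => h (x - eps)%R (positions (x - eps) rs)))
        (lev qs false (fun rs _ => h (x + eps)%R (positions (x + eps) rs))).
Proof. by rewrite /stepX (levX_positions x qs true) (levX_positions x qs false). Qed.

Definition expX x xs : \bar R := (expR (lam * last x xs))%:E.

Lemma iter_stepX_expX p N x qs : (0 <= p <= 1)%R ->
  iter N (stepX p) expX x (positions x qs) =
  (expR (lam * x))%:E * iter N (bottom_step theta p) (growth theta) qs.
Proof.
move=> p01; elim: N x qs => [|N IH] x qs /=.
  rewrite /expX /growth last_positions -EFinM -expRM_natl -expRD.
  by congr (expR _)%:E; ring.
have b0 rs : 0 <= iter N (bottom_step theta p) (growth theta) rs.
  by apply: iter_ge0 => // *; [exact: bottom_step_ge0|exact: growth_ge0].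
have B0 a : 0 <= lev qs a (fun rs _ => iter N (bottom_step theta p) (growth theta) rs).
  by rewrite lev_ge0.
rewrite stepX_positions {1}/bottom_step -mixZ; [|exact: p01|..]; last 2 first.
- by apply: mule_ge0; [rewrite lee_fin weight_ge0|exact: B0].
- by apply: mule_ge0; [rewrite lee_fin weight_ge0|exact: B0].
congr (mix _ _ _); rewrite muleA -EFinM -levZ ?mulr_ge0 ?weight_ge0 ?expR_ge0//;
  apply: lev_conserve => rs b _ _; rewrite IH; congr (_%:E * _);
  by rewrite /weight -expRD; congr expR; ring.
Qed.

(** Here [x] is the bottom level at time 0, with [M] steps still to come. The normalisation B_0(0) =
    0 means that heights are measured from it. *)
Definition centered M p x xs : \bar R :=
  (expR (- (lam * x)))%:E * iter M (stepX p) expX x xs.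

Lemma iter_stepX_centered p M m x qs : (0 <= p <= 1)%R ->
  iter m (stepX p) (centered M p) x (positions x qs) =
  iter m (stationary_step p) (iter M (bottom_step theta p) (growth theta)) qs.
Proof.
move=> p01; elim: m x qs => [|m IH] x qs /=.
  by rewrite /centered iter_stepX_expX// muleA -EFinM expRN mulVf ?mul1e ?gt_eqF ?expR_gt0.
by rewrite stepX_positions; congr (mix _ _ _); apply: lev_conserve => rs b _ _; rewrite IH.
Qed.

Fixpoint dominated xs ys zs : bool :=
  match xs, ys, zs with
  | x :: xs', y :: ys', z :: zs' => (x <= Num.max y z)%R && dominated xs' ys' zs'
  | [::], [::], [::] => true
  | _, _, _ => false
  end.

Lemma dominated_self xs ys : size xs = size ys -> dominated xs ys xs.
Proof.
elim: xs ys => [|x xs IH] [|y ys]//= [sz].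
by rewrite IH// le_max lexx orbT.
Qed.

(** The dynamics commute with maxima: a profile dominated by the maximum of two others remains so
    when all three use the same steps. *)
Lemma le_levX u v w xs ys zs (k k1 k2 : seq R -> \bar R) (c : R) :
  (0 <= c)%R -> (forall ys, 0 <= k1 ys) -> (forall zs, 0 <= k2 zs) ->
  (u <= Num.max v w)%R -> dominated xs ys zs ->
  (forall xs ys zs, dominated xs ys zs -> k xs <= k1 ys + c%:E * k2 zs) ->
  levX u xs k <= levX v ys k1 + c%:E * levX w zs k2.
Proof.
move=> c0; elim: xs ys zs u v w k k1 k2 => [|x xs IH] [|y ys] [|z zs]//=
  u v w k k1 k2 k10 k20 uvw.
  by move=> _ H; exact: H.
move=> /andP[xyz xyzs] H.
have pos k' a bs : (forall ys, 0 <= k' ys) -> 0 <= levX a bs k'.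
  elim: bs a k' => [|b bs IHb] a k' k'0 /=; first exact: k'0.
  by rewrite mix_ge0// IHb.
rewrite -mixZ ?pos// -mixD ?mule_ge0 ?pos//.
have step e : (Num.max (x + e) u <= Num.max (Num.max (y + e) v) (Num.max (z + e) w))%R.
  move: uvw xyz; rewrite !(ge_max, le_max) => /orP uvw /orP xyz.
  rewrite !lerD2r; apply/andP; split.
    by case: xyz => ->; rewrite ?orbT.
  by case: uvw => ->; rewrite ?orbT.
by apply: le_mix => //; apply: IH => // xs' ys' zs' h; apply: H => /=; rewrite step.
Qed.

Lemma levX_ge0 u xs k : (forall ys, 0 <= k ys) -> 0 <= levX u xs k.
Proof.
elim: xs u k => [|x xs IH] u k k0 /=; first exact: k0.
by rewrite mix_ge0// IH.
Qed.

Lemma stepX_ge0 p h : (0 <= p <= 1)%R -> (forall x xs, 0 <= h x xs) ->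
  forall x xs, 0 <= stepX p h x xs.
Proof. by move=> p01 h0 x xs; rewrite mix_ge0// levX_ge0. Qed.

Lemma iter_stepX_ge0 p N h : (0 <= p <= 1)%R -> (forall x xs, 0 <= h x xs) ->
  forall x xs, 0 <= iter N (stepX p) h x xs.
Proof. by move=> p01 h0; elim: N => [//|N IH] x xs; exact: stepX_ge0. Qed.

Lemma expX_ge0 x xs : 0 <= expX x xs.
Proof. by rewrite lee_fin expR_ge0. Qed.

(** The systems of [h] and [h'] share their bottom level, so domination does not constrain the
    bottom of the third system. It is made to step down always, hence the parameter 1, which keeps
    its contribution small. *)
Lemma stepX_dominated p h h' g (c : R -> R) : (0 <= p <= 1)%R ->
  (forall x, (0 <= c x)%R) -> (forall x ys, 0 <= h' x ys) ->
  (forall z zs, 0 <= g z zs) ->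
  (forall x xs ys z zs, dominated xs ys zs ->
     h x xs <= h' x ys + (c x)%:E * g z zs) ->
  forall x xs ys z zs, dominated xs ys zs ->
    stepX p h x xs <= stepX p h' x ys +
      (p * c (x - eps) + (1 - p) * c (x + eps))%:E * stepX 1 g z zs.
Proof.
move=> p01 c0 h'0 g0 H x xs ys z zs d.
have -> : stepX 1 g z zs = levX (z - eps) zs (g (z - eps)%R) by rewrite /stepX mix1.
have g1 : 0 <= levX (z - eps) zs (g (z - eps)%R) by exact: levX_ge0.
rewrite -mix_mulr// /stepX -mixD ?levX_ge0 ?mule_ge0 ?lee_fin//.
apply: le_mix => //; (apply: le_levX => // [|xs' ys' zs' d'];
  [by rewrite le_max lexx|exact: H]).
Qed.

Lemma last_dominated x z xs ys zs : dominated xs ys zs ->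
  (last x xs <= Num.max (last x ys) (last z zs))%R.
Proof.
have gen x' : (x <= Num.max x' z)%R -> dominated xs ys zs ->
    (last x xs <= Num.max (last x' ys) (last z zs))%R.
  elim: xs ys zs x x' z => [|x1 xs IH] [|y1 ys] [|z1 zs]//= x x' z _ /andP[h1 h2].
  exact: IH.
by apply: gen; rewrite le_max lexx.
Qed.

Lemma iter_expX_dominated p M : (0 <= p <= 1)%R ->
  forall x xs ys z zs, dominated xs ys zs ->
  iter M (stepX p) expX x xs <=
  iter M (stepX p) expX x ys + 1%:E * iter M (stepX 1) expX z zs.
Proof.
move=> p01; have e01 : (0 <= (1 : R) <= 1)%R by rewrite ler01 lexx.
elim: M => [|M IH] x xs ys z zs d.
  rewrite mul1e /= /expX -EFinD lee_fin.
  have /orP[h|h] : (last x xs <= last x ys)%R || (last x xs <= last z zs)%R.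
  - by rewrite -le_max last_dominated.
  - by rewrite ler_wpDr ?expR_ge0// ler_expR ler_wpM2l.
  - by rewrite ler_wpDl ?expR_ge0// ler_expR ler_wpM2l.
have := @stepX_dominated p _ _ _ (fun=> 1%R) p01 _ _ _ IH x xs ys z zs d.
rewrite (_ : (p * 1 + (1 - p) * 1)%R = 1%R); last by ring.
apply => // *; apply: iter_stepX_ge0 => // *; exact: expX_ge0.
Qed.

(** Separates the paths that feel the initial profile. Their system ignores the true bottom walk, so
    the centering factor exp(-lambda x) averages on its own and gives the power of
    [tilted_mean (- theta) p]. *)
Lemma iter_centered_dominated p M m : (0 <= p <= 1)%R ->
  forall x xs ys z zs, dominated xs ys zs ->
  iter m (stepX p) (centered M p) x xs <=
  iter m (stepX p) (centered M p) x ys +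
  (tilted_mean (- theta) p ^+ m * expR (- (lam * x)))%:E *
    iter (m + M) (stepX 1) expX z zs.
Proof.
move=> p01; have e01 : (0 <= (1 : R) <= 1)%R by rewrite ler01 lexx.
have e0 N q x xs : (0 <= q <= 1)%R -> 0 <= iter N (stepX q) expX x xs.
  by move=> q01; apply: iter_stepX_ge0 => // *; exact: expX_ge0.
elim: m => [|m IH] x xs ys z zs d.
  rewrite expr0 mul1r /= /centered -ge0_muleDr// ?e0//.
  rewrite lee_wpmul2l ?lee_fin ?expR_ge0//.
  by rewrite -[X in _ + X]mul1e; exact: iter_expX_dominated.
have := @stepX_dominated p _ _ _
  (fun x => tilted_mean (- theta) p ^+ m * expR (- (lam * x)))%R p01 _ _ _ IH x xs ys z zs d.
rewrite [X in _ + X%:E * _](_ : _ =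
    tilted_mean (- theta) p ^+ m.+1 * expR (- (lam * x)))%R; last first.
  rewrite exprS; set K := (_ ^+ m)%R; rewrite /tilted_mean /weight opprK.
  rewrite (_ : - (lam * (x - eps)) = - (lam * x) + theta)%R; last by ring.
  rewrite (_ : - (lam * (x + eps)) = - (lam * x) - theta)%R; last by ring.
  by rewrite !expRD; ring.
apply => //.
- by move=> ?; rewrite mulr_ge0 ?expR_ge0// exprn_ge0// ltW// tilted_mean_gt0.
- by move=> *; apply: iter_stepX_ge0 => // ? ?; rewrite mule_ge0 ?lee_fin ?expR_ge0// e0.
- by move=> *; exact: e0.
Qed.

End max_plus.

(** * Two-sided bounds for the walk moment *)

Section walk_bounds.
Variables (eps lam : R) (n M m : nat) (rho : R).
Hypotheses (eps0 : (0 <= eps)%R) (lam0 : (0 <= lam)%R).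
Hypothesis rho01 : (0 <= rho < 1)%R.
Local Notation theta := (lam * eps)%R.
Local Notation y := (expR (2 * theta)).

Let theta0 : (0 <= theta)%R. Proof. exact: mulr_ge0. Qed.
Let rho0 : (0 <= rho)%R. Proof. by case/andP: rho01. Qed.
Let p01 := prob01 rho0.
Let p101 : (0 <= (1 : R) <= 1)%R. Proof. by rewrite ler01 lexx. Qed.

Definition walk_moment : \bar R :=
  iter m (stepX eps (prob rho)) (centered eps lam M (prob rho)) 0%R (nseq n 0%R).

Let H N p := iter N (bottom_step theta p) (growth theta).

Let H_ge0 N p qs : (0 <= p <= 1)%R -> 0 <= H N p qs.
Proof.
by move=> ?; apply: iter_ge0 => // *; [exact: bottom_step_ge0|exact: growth_ge0].
Qed.

Let positions0 k : positions eps 0 (nseq k 0%N) = nseq k 0%R.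
Proof. by elim: k => //= k IH; rewrite mulr0 addr0 IH. Qed.

Let dominated_positions qs : size qs = n ->
  dominated (positions eps 0 qs) (nseq n 0%R) (positions eps 0 qs).
Proof.
move=> sz; apply: dominated_self; rewrite size_nseq -sz.
by elim: (qs) 0%R => //= q rs IH x; rewrite IH.
Qed.

Let walk_momentE : walk_moment = iter m (stationary_step (prob rho)) (H M (prob rho)) (nseq n 0%N).
Proof. by rewrite /walk_moment -positions0 iter_stepX_centered. Qed.

Definition bottom_moment : R :=
  tilted_mean theta (prob rho) ^+ M * ((1 - rho / y) / (1 - rho)) ^+ n.

Definition side_moment r N : R :=
  ((1 - r) / (1 - r * y)) ^+ n * tilted_mean theta (prob (r * y)) ^+ N.

Let y_gt0 : (0 < y)%R. Proof. exact: expR_gt0. Qed.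
Let y_ge1 : (1 <= y)%R. Proof. by rewrite -expR0 ler_expR mulr_ge0. Qed.

(** Moving the tilt to the top changes the ratio from [r] to [r * y]. With arrival probability
    [prob (r * y)] the moment would be exact; probability 1 can only lower it, a smaller probability
    only raise it. *)
Lemma geos_side r N : (0 <= r)%R -> (r * y < 1)%R ->
  geos n r (H N 1) <= (side_moment r N)%:E /\
  (forall p, (0 <= p)%R -> (p <= prob (r * y))%R ->
    (side_moment r N)%:E <= geos n r (H N p)).
Proof.
move=> r0 ry; have r01 : (0 <= r < 1)%R.
  by rewrite r0 (le_lt_trans _ ry)// ler_peMr.
have ry01 : (0 <= r * y < 1)%R by rewrite ry mulr_ge0// ltW.
have q01 := prob01 (proj1 (andP ry01)).
have t0 q rs : (0 <= q <= 1)%R -> 0 <= iter N (top_step theta q) (fun=> 1) rs.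
  by move=> ?; apply: iter_ge0 => // *; exact: top_step_ge0.
have e q : (0 <= q <= 1)%R -> geos n r (H N q) = (((1 - r) / (1 - r * y)) ^+ n)%:E *
    geos n (r * y) (iter N (top_step theta q) (fun=> 1)).
  move=> q01'; rewrite -geos_growth//; last by move=> *; exact: t0.
  by apply: eq_geos => qs _; rewrite /H bottom_top.
have c0 : (0 <= ((1 - r) / (1 - r * y)) ^+ n)%R.
  by rewrite exprn_ge0// divr_ge0// subr_ge0 ltW//; case/andP: r01.
rewrite /side_moment EFinM -(geos_top n ry01); split.
  rewrite e// lee_wpmul2l ?lee_fin// le_geos// => [qs|qs _]; first exact: t0.
  by apply: iter_top_decr => //; [case/andP: q01..|exact: lerel_refl].
move=> p p0 pq; have p01' : (0 <= p <= 1)%R.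
  by rewrite p0 (le_trans pq)//; case/andP: q01.
rewrite e// lee_wpmul2l ?lee_fin// le_geos// => [qs|qs _]; first exact: t0.
by apply: iter_top_decr => //; [case/andP: q01|exact: lerel_refl].
Qed.

Let rhoy0 : (0 <= rho / y)%R. Proof. by rewrite divr_ge0// ltW. Qed.
Let rhoy_le : (rho / y <= rho)%R.
Proof. by rewrite ler_pdivrMr// ler_peMr. Qed.

Let kM0 : (0 <= tilted_mean theta (prob rho) ^+ M)%R.
Proof. by rewrite exprn_ge0// ltW// tilted_mean_gt0. Qed.

Let q01 := prob01 rhoy0.

Let HE qs : H M (prob rho) qs = (tilted_mean theta (prob rho) ^+ M)%:E *
  iter M (stationary_step (prob (rho / y))) (growth theta) qs.
Proof. by rewrite /H iter_bottomE// prob_tilt// expRN. Qed.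

(** The ratio [rho / y] is stationary for the tilted bottom walk, so only the mean of [growth]
    remains, and this is another tilt, from [rho / y] back to [rho]. *)
Let geos_bottom : geos n (rho / y) (H M (prob rho)) = bottom_moment%:E.
Proof.
have ry01 : (0 <= rho / y < 1)%R.
  by rewrite rhoy0 (le_lt_trans rhoy_le)//; case/andP: rho01.
rewrite /bottom_moment EFinM -[X in _ = _ * X]mule1.
transitivity (geos n (rho / y) (fun qs => (tilted_mean theta (prob rho) ^+ M)%:E *
    iter M (stationary_step (prob (rho / y))) (growth theta) qs)).
  by apply: eq_geos => qs _; exact: HE.
rewrite geosZ//; last first.
  by move=> *; apply: iter_ge0 => // *; [exact: stationary_step_ge0|exact: growth_ge0].
congr (_ * _); rewrite geos_stationary//; last exact: growth_ge0.
transitivity (geos n (rho / y) (fun qs => growth theta qs * 1)).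
  by apply: eq_geos => qs _; rewrite mule1.
have ry1 : (rho / y * y < 1)%R by rewrite divfK ?gt_eqF//; case/andP: rho01.
rewrite geos_growth// divfK ?gt_eqF//; congr (_ * _).
by rewrite geos_cst// -[X in (_ <= X < _)%R](divfK (lt0r_neq0 y_gt0)).
Qed.

Let H_incr N p qs qs' : (0 <= p <= 1)%R -> lerel qs qs' -> H N p qs <= H N p qs'.
Proof. by move=> ? ?; apply: iter_bottom_incr. Qed.

Let geos_walk : geos n rho (iter m (stationary_step (prob rho)) (H M (prob rho))) =
  geos n rho (H M (prob rho)).
Proof. by rewrite geos_stationary// => qs; exact: H_ge0. Qed.

Let nseq_lerel qs : size qs = n -> lerel (nseq n 0%N) qs.
Proof. by move=> <-; exact: lerel_nseq0. Qed.

Lemma walk_moment_le : (rho * y < 1)%R ->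
  walk_moment <= (bottom_moment + side_moment rho M)%:E.
Proof.
move=> ry; rewrite walk_momentE.
have s0 qs : 0 <= iter m (stationary_step (prob rho)) (H M (prob rho)) qs.
  by apply: iter_ge0 => // *; [exact: stationary_step_ge0|exact: H_ge0].
rewrite -[leLHS](geos_cst rho01 n)//.
(* The flat profile lies below every stationary one, and stationarity erases the [m] steps before
   time 0. *)
apply: (@le_trans _ _ (geos n rho (H M (prob rho)))).
  rewrite -geos_walk; apply: le_geos => // qs sq.
  by apply: iter_stationary_incr => // [rs rs' rr|]; [exact: H_incr|exact: nseq_lerel].
(* Split at time 0: a path either follows the bottom level from a flat profile or uses only the gaps
   present at time 0. *)
apply: (@le_trans _ _ (geos n rho (fun qs => H M (prob rho) (nseq n 0%N) + H M 1 qs))).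
  apply: le_geos => // [qs|qs sq]; first exact: H_ge0.
  have := iter_expX_dominated eps lam0 M p01 0%R 0%R (dominated_positions sq).
  rewrite -positions0 !iter_stepX_expX// mulr0 expR0 !mul1e; apply.
rewrite geosD//; [|by move=> *; exact: H_ge0..].
rewrite EFinD leeD//; last by have [] := geos_side M rho0 ry.
(* Monotonicity once more: the flat profile is bounded by the average over the law for which the
   moment is exact. *)
rewrite geos_cst ?H_ge0// -geos_bottom.
have ry01 : (0 <= rho / y < 1)%R.
  by rewrite rhoy0 (le_lt_trans rhoy_le)//; case/andP: rho01.
rewrite -[leLHS](geos_cst ry01 n) ?H_ge0//; apply: le_geos => // [qs|qs sq].
  exact: H_ge0.
by apply: H_incr => //; exact: nseq_lerel.
Qed.

(** Flat and stationary starts at time [-m] differ only through paths that use the initial gaps. The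
    free ratio [r] is chosen later so that the error decays in [m]; [r = rho] would leave no decay
    in the limit. *)
Lemma walk_moment_ge r : (rho <= r)%R -> (r * y < 1)%R ->
  geos n rho (H M (prob rho)) <= walk_moment +
    (tilted_mean (- theta) (prob rho) ^+ m * side_moment r (m + M))%:E.
Proof.
move=> rr ry; rewrite -geos_walk.
have r0 : (0 <= r)%R by exact: le_trans rr.
have r1 : (r < 1)%R by rewrite (le_lt_trans _ ry)// ler_peMr.
have k0 : (0 <= tilted_mean (- theta) (prob rho) ^+ m)%R.
  by rewrite exprn_ge0// ltW// tilted_mean_gt0.
have s0 qs : 0 <= iter m (stationary_step (prob rho)) (H M (prob rho)) qs.
  by apply: iter_ge0 => // *; [exact: stationary_step_ge0|exact: H_ge0].
apply: (@le_trans _ _ (geos n rho (fun qs => walk_moment +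
    (tilted_mean (- theta) (prob rho) ^+ m)%:E * H (m + M) 1 qs))).
  apply: le_geos => // qs sq.
  have := iter_centered_dominated eps lam0 M m p01 0%R 0%R (dominated_positions sq).
  rewrite -/walk_moment iter_stepX_centered// iter_stepX_expX// mulr0 oppr0 expR0 mulr1 mul1e.
  by apply.
rewrite geosD//; last 2 first.
- by move=> *; rewrite walk_momentE.
- by move=> *; rewrite mule_ge0// H_ge0.
rewrite geos_cst ?walk_momentE// leeD2l// geosZ//; last by move=> *; exact: H_ge0.
rewrite EFinM lee_wpmul2l ?lee_fin//.
apply: le_trans (proj1 (geos_side (m + M) r0 ry)).
by apply: le_geos_rho => // [qs|qs qs' qq]; [exact: H_ge0|exact: H_incr].
Qed.

Lemma geos_ge_bottom : bottom_moment%:E <= geos n rho (H M (prob rho)).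
Proof.
rewrite -geos_bottom; apply: le_geos_rho => //.
- by case/andP: rho01.
- by move=> qs; exact: H_ge0.
- by move=> qs qs' qq; exact: H_incr.
Qed.

Lemma geos_ge_side : (rho * y < 1)%R ->
  (side_moment rho M)%:E <= geos n rho (H M (prob rho)).
Proof.
move=> ry; apply: (proj2 (geos_side M rho0 ry)); first by case/andP: p01.
by apply: le_prob => //; rewrite ler_peMr.
Qed.

Lemma walk_moment_ge_max r : (rho <= r)%R -> (r * y < 1)%R ->
  (Num.max bottom_moment (side_moment rho M))%:E <= walk_moment +
    (tilted_mean (- theta) (prob rho) ^+ m * side_moment r (m + M))%:E.
Proof.
move=> rr ry; apply: le_trans (walk_moment_ge rr ry).
rewrite EFin_max ge_max geos_ge_bottom geos_ge_side//.
by rewrite (le_lt_trans _ ry)// ler_wpM2r// ltW.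
Qed.

End walk_bounds.
End stationarity.

(** * Gaussian against Bernoulli steps *)

Section lindeberg_function.
Context {R : realType}.
Implicit Types (x s : R).

(** One integration of a derivative bound by the mean value theorem. Iterated, it replaces Taylor's
    formula with remainder at the price of the factorials. *)
Lemma MVT_bound (f df : R -> R) (C c : R) k : (forall s, is_derive s 1 f (df s)) ->
  f 0 = 0 -> 0 <= C -> 0 <= c ->
  (forall s, 0 <= s -> `|df s| <= C * s ^+ k * expR (c * s)) ->
  forall x, 0 <= x -> `|f x| <= C * x ^+ k.+1 * expR (c * x).
Proof.
move=> fd f0 C0 c0 dfb x x0.
have [|z] := @MVT_segment R f df 0 x x0 (fun s _ => fd s).
  apply: derivable_within_continuous => s _; exact: ex_derive.
rewrite in_itv /= => /andP[z0 zx]; rewrite f0 !subr0 => ->.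
rewrite normrM (ger0_norm x0) exprSr mulrA mulrAC ler_wpM2r//.
apply: le_trans (dfb _ z0) _; rewrite ler_pM ?mulr_ge0 ?exprn_ge0 ?expR_ge0//.
  by rewrite ler_wpM2l// lerXn2r.
by rewrite ler_expR ler_wpM2l.
Qed.

Definition sinh x : R := (expR x - expR (- x)) / 2.
Definition cosh x : R := (expR x + expR (- x)) / 2.

Lemma is_derive_expRN x : is_derive x 1 (fun s => expR (- s)) (- expR (- x)).
Proof. by apply: is_derive_eq; rewrite mulrN1. Qed.

Lemma is_derive_sinh x : is_derive x 1 sinh (cosh x).
Proof.
rewrite (_ : sinh = 2^-1 *: (expR - (fun s => expR (- s)))).
  have h := is_derive_expRN x.
  by apply: is_derive_eq; rewrite opprK /cosh mulrC.
by apply/funext => s; rewrite /sinh mulrC.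
Qed.

Lemma is_derive_cosh x : is_derive x 1 cosh (sinh x).
Proof.
rewrite (_ : cosh = 2^-1 *: (expR + (fun s => expR (- s)))).
  have h := is_derive_expRN x.
  by apply: is_derive_eq; rewrite /sinh mulrC.
by apply/funext => s; rewrite /cosh mulrC.
Qed.

Lemma is_derive_mul (f g : R -> R) x (df dg : R) : is_derive x 1 f df ->
  is_derive x 1 g dg -> is_derive x 1 (fun s => f s * g s) (f x * dg + g x * df).
Proof. by move=> hf hg; exact: (is_deriveM hf hg). Qed.

Lemma is_derive_lin (c1 c2 : R) (f g : R -> R) x (df dg : R) :
  is_derive x 1 f df -> is_derive x 1 g dg ->
  is_derive x 1 (fun s => c1 * f s + c2 * g s) (c1 * df + c2 * dg).
Proof.
by move=> hf hg; exact: (is_deriveD (is_deriveZ c1 hf) (is_deriveZ c2 hg)).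
Qed.

Lemma expR_bound (c d s : R) : 0 <= s -> c <= d -> expR (c * s) <= expR (d * s).
Proof. by move=> s0 cd; rewrite ler_expR ler_wpM2r. Qed.

Lemma cosh_bound (c s : R) : 0 <= s -> 1 <= c -> `|cosh s| <= expR (c * s).
Proof.
move=> s0 c1; rewrite ger0_norm /cosh ?divr_ge0 ?addr_ge0 ?expR_ge0//.
have e2 : expR (- s) <= expR s by rewrite ler_expR ge0_cp.
have := expR_bound s0 c1; rewrite mul1r => e1.
by rewrite ler_pdivrMr// mulr_natr mulr2n lerD// (le_trans e2).
Qed.

Lemma sinh_bound (c s : R) : 0 <= s -> 1 <= c -> `|sinh s| <= expR (c * s).
Proof.
move=> s0 c1; have e2 : expR (- s) <= expR s by rewrite ler_expR ge0_cp.
rewrite ger0_norm /sinh ?divr_ge0 ?subr_ge0//.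
apply: le_trans (cosh_bound s0 c1); rewrite ger0_norm /cosh; last first.
  by rewrite divr_ge0 ?addr_ge0 ?expR_ge0.
rewrite ler_pM2r ?invr_gt0// lerBlDr -addrA lerDl.
by rewrite addr_ge0 ?expR_ge0.
Qed.

Lemma third_derivative_bound (a t : R) : 0 <= a -> a <= 1 -> 0 <= t -> t <= 1 ->
  `|a * t * (t + (a - 1) * t ^+ 2) + (1 + 2 * (a - 1) * t) * (t - t ^+ 2)| <= 5.
Proof.
move=> a0 a1 t0 t1.
have h1 : 0 <= t + (a - 1) * t ^+ 2 <= 1 by apply/andP; split; nra.
have h2 : -1 <= 1 + 2 * (a - 1) * t <= 1 by apply/andP; split; nra.
have h3 : 0 <= t - t ^+ 2 <= 1 by apply/andP; split; nra.
have h4 : 0 <= a * t <= 1 by apply/andP; split; nra.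
move: (t + _) (1 + _) (t - _) (a * t) h1 h2 h3 h4 => q1 q2 q3 q4.
move=> /andP[? ?] /andP[? ?] /andP[? ?] /andP[? ?].
by rewrite ler_norml; apply/andP; split; nra.
Qed.

Section smoothed.
Variables (U V a b : R).
Hypotheses (U0 : 0 <= U) (V0 : 0 <= V) (UV0 : 0 < U + V).

Definition affexp x := U * expR (b * x) + V.
Definition smoothed x := expR (a * ln (affexp x)).
(** The logistic function. Every derivative of [smoothed] is a polynomial in [frac] times
    [smoothed], and [frac] lies in [0, 1], so all bounds are uniform in [U] and [V]. *)
Definition frac x := U * expR (b * x) / affexp x.

Lemma affexp_gt0 x : 0 < affexp x.
Proof.
have u0 := U0; have v0 := V0; have uv := UV0; rewrite /affexp.
have e0 := expR_gt0 (b * x).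
have [Uz|Uz] := eqVneq U 0; first by rewrite Uz mul0r add0r; rewrite Uz add0r in uv.
by rewrite ltr_pwDl// mulr_gt0// lt0r Uz.
Qed.

Lemma frac01 x : 0 <= frac x <= 1.
Proof.
have h := affexp_gt0 x; have u0 := U0; have v0 := V0.
rewrite divr_ge0 ?mulr_ge0 ?expR_ge0 ?(ltW h)//=.
by rewrite ler_pdivrMr// mul1r /affexp lerDl.
Qed.

Lemma is_derive_affexp x : is_derive x 1 affexp (b * (U * expR (b * x))).
Proof.
rewrite (_ : affexp = U *: (expR \o (b *: id)) + cst V); last first.
  by apply/funext => s.
apply: is_derive_eq; rewrite addr0 /=.
rewrite /GRing.scale /=; ring.
Qed.

Lemma is_derive_smoothed x :
  is_derive x 1 smoothed (a * b * frac x * smoothed x).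
Proof.
rewrite (_ : smoothed = expR \o (a *: (@ln R \o affexp))); last exact/funext.
have h := is_derive_affexp x; have h1 := is_derive1_ln (affexp_gt0 x).
apply: is_derive_eq; rewrite /smoothed /frac /GRing.scale /=; ring.
Qed.

Lemma is_derive_frac x : is_derive x 1 frac (b * (frac x - frac x ^+ 2)).
Proof.
rewrite (_ : frac = cst 1 - V *: (fun s => (affexp s)^-1)); last first.
  apply/funext => s; rewrite fctE /frac.
  have : affexp s != 0 by rewrite gt_eqF// affexp_gt0.
  by rewrite /affexp => ?; rewrite !fctE /GRing.scale /=; field.
have h := is_derive_affexp x.
have ha : affexp x != 0 by rewrite gt_eqF// affexp_gt0.
have h1 : is_derive x 1 (fun s => (affexp s)^-1)
    (- (affexp x) ^- 2 *: (b * (U * expR (b * x)))).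
  exact: is_deriveV.
apply: is_derive_eq; rewrite !fctE /GRing.scale /=.
by move: ha; rewrite /affexp => ?; field.
Qed.

Lemma is_derive_frac_smoothed (c1 c2 : R) x :
  is_derive x 1 (fun s => (c1 * frac s + c2 * frac s ^+ 2) * smoothed s)
    ((a * b * frac x * (c1 * frac x + c2 * frac x ^+ 2) +
      (c1 + 2 * c2 * frac x) * (b * (frac x - frac x ^+ 2))) * smoothed x).
Proof.
have h := is_derive_frac x; have h1 := is_derive_smoothed x.
have h2 := is_derive_mul h h.
have h3 := is_derive_mul (is_derive_lin c1 c2 h h2) h1.
rewrite (_ : (fun s => _) =
  fun s => (c1 * frac s + c2 * (frac s * frac s)) * smoothed s); last first.
  by apply/funext => s; rewrite expr2.
by apply: is_derive_eq h3 _; move: (frac x) (smoothed x) => t u; ring.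
Qed.

Hypotheses (a0 : 0 <= a) (a1 : a <= 1) (b1 : 1 <= `|b|).
Let beta : R := `|b|.
Let lam : R := a * beta.

Let lam0 : 0 <= lam. Proof. by rewrite /lam mulr_ge0 ?normr_ge0. Qed.

Lemma smoothed_gt0 x : 0 < smoothed x. Proof. exact: expR_gt0. Qed.

(** The logarithm of [smoothed] has Lipschitz constant [lam], the product of the power and the
    inverse temperature, which stays fixed as [b] grows. *)
Lemma smoothed_le x s : smoothed s <= smoothed x * expR (lam * `|s - x|).
Proof.
rewrite /smoothed -expRD ler_expR /lam -mulrA -mulrDr ler_wpM2l//.
rewrite -(expRK (beta * _)) -lnM ?posrE ?expR_gt0 ?affexp_gt0//.
rewrite ler_ln ?posrE ?mulr_gt0 ?expR_gt0 ?affexp_gt0// /affexp mulrDl lerD//.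
  rewrite -mulrA ler_wpM2l// -expRD ler_expR -lerBlDl -mulrBr /beta -normrM.
  exact: ler_norm.
by rewrite ler_peMr// -expR0 ler_expR mulr_ge0 ?normr_ge0.
Qed.

Definition smoothed1 := a * b * frac 0 * smoothed 0.
Definition smoothed2 :=
  (a * b ^+ 2 * frac 0 + ((a * b) ^+ 2 - a * b ^+ 2) * frac 0 ^+ 2) * smoothed 0.

Let bnorm : b ^+ 2 = beta ^+ 2. Proof. by rewrite real_normK// num_real. Qed.

Lemma smoothed1_bound : `|smoothed1| <= lam * smoothed 0.
Proof.
have /andP[f0 f1] := frac01 0; have s0 := ltW (smoothed_gt0 0).
rewrite /smoothed1; move: (frac 0) f0 f1 (smoothed 0) s0 => t t0 t1 u u0.
rewrite !normrM (ger0_norm u0) (ger0_norm t0) (ger0_norm a0).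
by rewrite ler_wpM2r// ler_piMr// mulr_ge0.
Qed.

Let beta1 : 1 <= beta. Proof. exact: b1. Qed.

Lemma smoothed2_bound : `|smoothed2| <= 2 * lam * beta * smoothed 0.
Proof.
have /andP[f0 f1] := frac01 0; have s0 := ltW (smoothed_gt0 0).
rewrite /smoothed2 normrM (ger0_norm s0) ler_wpM2r//.
rewrite exprMn bnorm /lam.
have A0 := a0; have A1 := a1; have B1 := beta1.
move: (frac 0) f0 f1 => t t0 t1.
have -> : a * beta ^+ 2 * t + (a ^+ 2 * beta ^+ 2 - a * beta ^+ 2) * t ^+ 2 =
  (a * beta * beta) * (t * (1 - t) + a * t ^+ 2) by ring.
have -> : 2 * (a * beta) * beta = (a * beta * beta) * 2 by ring.
have h0 : 0 <= a * beta * beta by rewrite mulr_ge0// (le_trans ler01).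
rewrite normrM (ger0_norm h0) ler_wpM2l//.
by rewrite ger0_norm; nra.
Qed.

(** The functions [sinh x] and [cosh x - 1] replace x and x^2/2: they agree with them to second
    order, and their Gaussian and two-point means are explicit. *)
Definition taylor3 x := smoothed x - smoothed 0 - smoothed1 * sinh x
  - smoothed2 * (cosh x - 1).

Lemma taylor3_bound x : 0 <= x ->
  `|taylor3 x| <= 8 * lam * beta ^+ 2 * smoothed 0 * x ^+ 3 * expR ((lam + 1) * x).
Proof.
move=> x0; set D := 8 * _ * _ * _.
have D0 : 0 <= D.
  by rewrite /D !mulr_ge0 ?exprn_ge0 ?(ltW (smoothed_gt0 0)) ?(le_trans ler01 beta1).
(* [t1], [t2] and [t3] are the successive derivatives of [taylor3]. The null term gives [t1] the
   shape to which [is_derive_frac_smoothed] applies. *)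
pose t1 s := (a * b * frac s + 0 * frac s ^+ 2) * smoothed s
  - smoothed1 * cosh s - smoothed2 * sinh s.
pose t2 s := (a * b ^+ 2 * frac s + ((a * b) ^+ 2 - a * b ^+ 2) * frac s ^+ 2) * smoothed s
  - smoothed1 * sinh s - smoothed2 * cosh s.
pose t3 s := (a * b * frac s * (a * b ^+ 2 * frac s +
      ((a * b) ^+ 2 - a * b ^+ 2) * frac s ^+ 2) +
      (a * b ^+ 2 + 2 * ((a * b) ^+ 2 - a * b ^+ 2) * frac s) * (b * (frac s - frac s ^+ 2)))
     * smoothed s - smoothed1 * cosh s - smoothed2 * sinh s.
have sinh0 : sinh 0 = 0 by rewrite /sinh oppr0 subrr mul0r.
have cosh0 : cosh 0 = 1 by rewrite /cosh oppr0 expR0; field.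
have d1 s : is_derive s 1 taylor3 (t1 s).
  have h := is_derive_lin 1 (-1) (is_derive_smoothed s)
    (is_derive_lin smoothed1 smoothed2 (is_derive_sinh s) (is_derive_cosh s)).
  have h' := is_derive_lin 1 (smoothed2 - smoothed 0) h (is_derive_cst (1 : R) s 1).
  rewrite (_ : taylor3 = fun s => 1 * (1 * smoothed s + -1 * (smoothed1 * sinh s +
    smoothed2 * cosh s)) + (smoothed2 - smoothed 0) * 1); last first.
    apply/funext => r; rewrite /taylor3; clear.
    by move: smoothed1 smoothed2 (smoothed r) (smoothed 0) (sinh r) (cosh r) => *; ring.
  by apply: is_derive_eq h' _; rewrite /t1; ring.
have d2 s : is_derive s 1 t1 (t2 s).
  have h := is_derive_lin 1 (-1) (is_derive_frac_smoothed (a * b) 0 s)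
    (is_derive_lin smoothed1 smoothed2 (is_derive_cosh s) (is_derive_sinh s)).
  rewrite (_ : t1 = fun s => 1 * ((a * b * frac s + 0 * frac s ^+ 2) * smoothed s) +
    -1 * (smoothed1 * cosh s + smoothed2 * sinh s)); last first.
    by apply/funext => r; rewrite /t1; ring.
  by apply: is_derive_eq h _; rewrite /t2; ring.
have d3 s : is_derive s 1 t2 (t3 s).
  have h := is_derive_lin 1 (-1)
    (is_derive_frac_smoothed (a * b ^+ 2) ((a * b) ^+ 2 - a * b ^+ 2) s)
    (is_derive_lin smoothed1 smoothed2 (is_derive_sinh s) (is_derive_cosh s)).
  rewrite (_ : t2 = fun s => 1 * ((a * b ^+ 2 * frac s +
      ((a * b) ^+ 2 - a * b ^+ 2) * frac s ^+ 2) * smoothed s) +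
    -1 * (smoothed1 * sinh s + smoothed2 * cosh s)); last first.
    by apply/funext => r; rewrite /t2; ring.
  by apply: is_derive_eq h _; rewrite /t3; ring.
have t30 s : 0 <= s -> `|t3 s| <= D * s ^+ 0 * expR ((lam + 1) * s).
  move=> s0; rewrite expr0 mulr1.
  have /andP[f0 f1] := frac01 s.
  have B0 : 0 <= beta by exact: le_trans beta1.
  have E0 := smoothed_gt0 0.
  have es : smoothed s <= smoothed 0 * expR ((lam + 1) * s).
    apply: le_trans (smoothed_le 0 s) _; rewrite subr0 (ger0_norm s0).
    by rewrite ler_wpM2l ?(ltW E0)// expR_bound// lerDl.
  have l1 : 1 <= lam + 1 by rewrite lerDr.
  have ch := cosh_bound s0 l1; have sh := sinh_bound s0 l1.
  have s1 := smoothed1_bound; have s2 := smoothed2_bound.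
  rewrite /t3; set P := (X in X * smoothed s).
  have Pb : `|P| <= 5 * lam * beta ^+ 2.
    have -> : P = b * (a * b ^+ 2 * (a * frac s * (frac s + (a - 1) * frac s ^+ 2) +
        (1 + 2 * (a - 1) * frac s) * (frac s - frac s ^+ 2))) by rewrite /P; ring.
    rewrite normrM -/beta bnorm normrM (ger0_norm (mulr_ge0 a0 (sqr_ge0 beta))).
    rewrite (_ : 5 * lam * beta ^+ 2 = beta * (a * beta ^+ 2 * 5)); last by rewrite /lam; ring.
    rewrite ler_wpM2l// ler_wpM2l ?mulr_ge0 ?sqr_ge0//.
    exact: third_derivative_bound.
  set E := expR ((lam + 1) * s) in es ch sh *.
  have lb : lam * smoothed 0 <= lam * beta ^+ 2 * smoothed 0.
    by rewrite ler_wpM2r ?(ltW E0)// ler_peMr// expr_ge1.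
  have lb2 : 2 * lam * beta * smoothed 0 <= 2 * lam * beta ^+ 2 * smoothed 0.
    rewrite ler_wpM2r ?(ltW E0)// ler_wpM2l ?mulr_ge0// expr2 ler_peMr//.
  have E00 : 0 <= E by exact: expR_ge0.
  have n1 : `|P * smoothed s| <= 5 * lam * beta ^+ 2 * (smoothed 0 * E).
    by rewrite normrM ler_pM// (ger0_norm (ltW (smoothed_gt0 s))).
  have n2 : `|smoothed1 * cosh s| <= lam * beta ^+ 2 * smoothed 0 * E.
    by rewrite normrM ler_pM// (le_trans s1).
  have n3 : `|smoothed2 * sinh s| <= 2 * lam * beta ^+ 2 * smoothed 0 * E.
    by rewrite normrM ler_pM// (le_trans s2).
  (* The factor 8 in [D] is 5 + 1 + 2, one summand for each term of [t3]; [beta >= 1] has brought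
     all of them to the order [beta ^+ 2]. *)
  apply: le_trans (ler_normB _ _) _; apply: le_trans (lerD (ler_normB _ _) n3) _.
  apply: le_trans (lerD (lerD n1 n2) (lexx _)) _.
  by rewrite /D le_eqVlt; apply/orP; left; apply/eqP; ring.
have l10 : 0 <= lam + 1 by rewrite addr_ge0.
have t20 : t2 0 = 0 by rewrite /t2 sinh0 cosh0 mulr0 mulr1 subr0 /smoothed2 subrr.
have t10 : t1 0 = 0 by rewrite /t1 sinh0 cosh0 mulr0 mulr1 subr0 /smoothed1 mul0r addr0 subrr.
have t00 : taylor3 0 = 0.
  by rewrite /taylor3 sinh0 cosh0 subrr (subrr 1) !mulr0 !subr0.
have b2 := MVT_bound d3 t20 D0 l10 t30.
have b3 := MVT_bound d2 t10 D0 l10 b2.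
exact: (MVT_bound d1 t00 D0 l10 b3).
Qed.

End smoothed.
End lindeberg_function.

(** * Means of exponentials under the normal law *)

Section normal_integral.
Context {R : realType}.
Local Notation leb := (@lebesgue_measure R).

Lemma integral_normal_prob (m s : R) (f : R -> \bar R) :
  (forall x, 0 <= f x)%E -> measurable_fun setT f ->
  (\int[normal_prob m s]_x f x = \int[leb]_x (f x * (normal_pdf m s x)%:E))%E.
Proof.
move=> f0 mf; have dom := normal_prob_dominates m s.
rewrite -(Radon_Nikodym_SigmaFinite.change_of_variables dom f0 measurableT mf).
have ig := Radon_Nikodym_SigmaFinite.f_integrable dom.
have mpdf : measurable_fun setT (fun x : R => (normal_pdf m s x)%:E).
  by apply/measurable_EFinP; exact: measurable_normal_pdf.
apply: ae_eq_integral => //.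
- by apply: emeasurable_funM => //; exact: measurable_int ig.
- exact: emeasurable_funM.
- apply: ae_eqe_mul2l; apply: integral_ae_eq => // E _ mE.
  by rewrite -Radon_Nikodym_SigmaFinite.f_integral.
Qed.

Lemma normal_mgf (s z : R) : 0 < s ->
  (\int[normal_prob 0 s]_x (expR (z * x))%:E = (expR (z ^+ 2 * s ^+ 2 / 2))%:E)%E.
Proof.
move=> s0; have sn0 : s != 0 by rewrite gt_eqF.
rewrite integral_normal_prob; [|by move=> x; rewrite lee_fin expR_ge0|]; last first.
  apply/measurable_EFinP; apply: measurableT_comp => //; exact: measurable_funM.
(* Completing the square shifts the mean from 0 to [z * s ^+ 2]. *)
transitivity (\int[leb]_x ((expR (z ^+ 2 * s ^+ 2 / 2))%:E *
    (normal_pdf (z * s ^+ 2) s x)%:E))%E.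
  apply: eq_integral => x _; rewrite -!EFinM; congr (_%:E).
  rewrite !normal_pdfE// mulrCA [RHS]mulrCA; congr (_ * _).
  rewrite /normal_fun -!expRD; congr expR; field.
  exact: sn0.
rewrite ge0_integralZl//.
- by rewrite integral_normal_pdf mule1.
- by apply/measurable_EFinP; exact: measurable_normal_pdf.
- by move=> x _; rewrite lee_fin normal_pdf_ge0.
Qed.

Section has_mean.
Variables (s : R).
Hypothesis s0 : 0 < s.
Implicit Types f g : R -> R.

Definition has_mean f (v : R) :=
  (normal_prob 0 s).-integrable setT (EFin \o f) /\
  (\int[normal_prob 0 s]_x (f x)%:E = v%:E)%E.

Lemma has_meanD f g u v : has_mean f u -> has_mean g v ->
  has_mean (fun x => f x + g x) (u + v).
Proof.
move=> [fi fu] [gi gv]; split.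
  rewrite (_ : EFin \o _ = ((EFin \o f) \+ (EFin \o g))%E)//.
  exact: integrableD.
rewrite (_ : (fun x => (f x + g x)%:E) = ((EFin \o f) \+ (EFin \o g))%E)//.
by rewrite integralD//= fu gv.
Qed.

Lemma has_meanZ (c : R) f u : has_mean f u -> has_mean (fun x => c * f x) (c * u).
Proof.
move=> [fi fu]; split.
  rewrite (_ : EFin \o _ = (fun x => c%:E * (EFin \o f) x)%E)//.
  exact: integrableZl.
rewrite (_ : (fun x => (c * f x)%:E) = (fun x => c%:E * (EFin \o f) x)%E)//.
by rewrite integralZl//= fu.
Qed.

Lemma has_mean_exp (z d : R) : has_mean (fun x => expR (d + z * x))
  (expR (d + z ^+ 2 * s ^+ 2 / 2)).
Proof.
have -> : (fun x : R => expR (d + z * x)) =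
    fun x => expR d * expR (z * x) by apply/funext => x; rewrite expRD.
rewrite expRD; apply: has_meanZ; split; last exact: normal_mgf.
apply/integrableP; split.
  apply/measurable_EFinP; apply: measurableT_comp => //; exact: measurable_funM.
under eq_integral do rewrite gee0_abs ?lee_fin ?expR_ge0//.
by rewrite normal_mgf// ltry.
Qed.

Lemma has_mean_cst (c : R) : has_mean (cst c) c.
Proof.
have := has_meanZ c (has_mean_exp 0 0).
by rewrite expr0n /= !mul0r addr0 expR0 mulr1; under eq_fun do rewrite mul0r addr0 expR0 mulr1.
Qed.

Lemma has_mean_le f u (g : R -> R) : has_mean f u ->
  measurable_fun setT g -> (forall x, 0 <= g x <= f x) ->
  (\int[normal_prob 0 s]_x (g x)%:E <= u%:E)%E.
Proof.
move=> [fi <-] mg gf; apply: ge0_le_integral => //=.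
- by move=> x _; rewrite lee_fin; case/andP: (gf x).
- exact/measurable_EFinP.
- exact: measurable_int fi.
- by move=> x _; rewrite lee_fin; case/andP: (gf x).
Qed.

(** The minorant [f] may change sign, so integrability of [g] is used; if the integral of [g] is
    infinite there is nothing to show. *)
Lemma has_mean_ge f u (g : R -> R) : has_mean f u ->
  measurable_fun setT g -> (forall x, 0 <= g x) -> (forall x, f x <= g x) ->
  (u%:E <= \int[normal_prob 0 s]_x (g x)%:E)%E.
Proof.
move=> [fi <-] mg g0 gf.
have [goo|] := ltP (\int[normal_prob 0 s]_x (g x)%:E)%E +oo%E; last first.
  by move=> h; rewrite (le_trans (leey _)).
apply: le_integral => //.
- apply/integrableP; split; first exact/measurable_EFinP.
  by under eq_integral do rewrite gee0_abs ?lee_fin//.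
- by move=> x _; rewrite lee_fin.
Qed.

End has_mean.
End normal_integral.

(** * Second-order expansions with cubic error *)

Section jets.
Context {R : realType}.
Implicit Types (f g : R -> R) (a b c : R).

Definition jet f a0 a1 a2 := exists2 C : R, 0 <= C &
  forall e : R, 0 <= e <= 1 -> `|f e - (a0 + a1 * e + a2 * e ^+ 2)| <= C * e ^+ 3.

Lemma jetD f g a0 a1 a2 b0 b1 b2 : jet f a0 a1 a2 -> jet g b0 b1 b2 ->
  jet (fun e => f e + g e) (a0 + b0) (a1 + b1) (a2 + b2).
Proof.
move=> [C C0 Cf] [D D0 Dg]; exists (C + D); first exact: addr_ge0.
move=> e e01; rewrite [leRHS]mulrDl; apply: (le_trans _ (lerD (Cf e e01) (Dg e e01))).
apply: (le_trans _ (ler_normD _ _)); rewrite le_eqVlt; apply/orP; left; apply/eqP.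
by congr (`| _ |); ring.
Qed.

Lemma jetZ c f a0 a1 a2 : jet f a0 a1 a2 ->
  jet (fun e => c * f e) (c * a0) (c * a1) (c * a2).
Proof.
move=> [C C0 Cf]; exists (`|c| * C); first exact: mulr_ge0.
move=> e e01; rewrite -[leRHS]mulrA; apply: (le_trans _ (ler_wpM2l (normr_ge0 c) (Cf e e01))).
rewrite -normrM le_eqVlt; apply/orP; left; apply/eqP; congr (`| _ |); ring.
Qed.

Lemma jetM f g a0 a1 a2 b0 b1 b2 : jet f a0 a1 a2 -> jet g b0 b1 b2 ->
  jet (fun e => f e * g e) (a0 * b0) (a0 * b1 + a1 * b0)
    (a0 * b2 + a1 * b1 + a2 * b0).
Proof.
move=> [C C0 Cf] [D D0 Dg].
pose A := `|a0| + `|a1| + `|a2|; pose B := `|b0| + `|b1| + `|b2|.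
have A0 : 0 <= A by rewrite !addr_ge0.
have B0 : 0 <= B by rewrite !addr_ge0.
exists (A * D + B * C + C * D + A * B + A * B).
  by rewrite !addr_ge0// mulr_ge0.
move=> e e01; have := Cf e e01; have := Dg e e01; case/andP: e01 => e0 e1.
set P := a0 + a1 * e + a2 * e ^+ 2; set Q := b0 + b1 * e + b2 * e ^+ 2.
move=> hg hf.
have P_le a b c : `|a + b * e + c * e ^+ 2| <= `|a| + `|b| + `|c|.
  apply: le_trans (ler_normD _ _) _; rewrite lerD//.
    apply: le_trans (ler_normD _ _) _; rewrite lerD// normrM (ger0_norm e0).
    by rewrite ler_piMr.
  by rewrite normrM (ger0_norm (exprn_ge0 2 e0)) ler_piMr// exprn_ile1.
have hP : `|P| <= A := P_le a0 a1 a2.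
have hQ : `|Q| <= B := P_le b0 b1 b2.
have h1 : `|a1| <= A by rewrite /A -addrA addrCA lerDl addr_ge0.
have h2 : `|a2| <= A by rewrite /A lerDr addr_ge0.
have h3 : `|b2| <= B by rewrite /B lerDr addr_ge0.
have h4 : `|b1 + b2 * e| <= B.
  have := P_le b1 b2 0; rewrite mul0r addr0 normr0 addr0 => h; apply: le_trans h _.
  by rewrite /B -addrA lerDr.
have -> : f e * g e - (a0 * b0 + (a0 * b1 + a1 * b0) * e +
    (a0 * b2 + a1 * b1 + a2 * b0) * e ^+ 2) =
  P * (g e - Q) + Q * (f e - P) + (f e - P) * (g e - Q) +
   (a1 * b2 * e ^+ 3 + a2 * (b1 + b2 * e) * e ^+ 3) by rewrite /P /Q; ring.
have e30 : 0 <= e ^+ 3 by exact: exprn_ge0.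
have e31 : e ^+ 3 <= 1 by exact: exprn_ile1.
move: (f e - P) (g e - Q) hf hg (b1 + b2 * e) h4 => u v hu hv w hw.
move: P Q A B A0 B0 hP hQ h1 h2 h3 hw {P_le} => P Q A B A0 B0 hP hQ h1 h2 h3 hw.
have n1 : `|P * v| <= A * D * e ^+ 3 by rewrite normrM -mulrA ler_pM.
have n2 : `|Q * u| <= B * C * e ^+ 3 by rewrite normrM -mulrA ler_pM.
have n3 : `|u * v| <= C * D * e ^+ 3.
  rewrite normrM -mulrA ler_pM//; first by apply: le_trans hu _; rewrite ler_piMr.
have n4 : `|a1 * b2 * e ^+ 3| <= A * B * e ^+ 3.
  by rewrite normrM (ger0_norm e30) normrM ler_wpM2r// ler_pM.
have n5 : `|a2 * w * e ^+ 3| <= A * B * e ^+ 3.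
  by rewrite normrM (ger0_norm e30) normrM ler_wpM2r// ler_pM.
rewrite (_ : (_ + _ + _ + _ + _) * e ^+ 3 = A * D * e ^+ 3 + B * C * e ^+ 3 +
  C * D * e ^+ 3 + (A * B * e ^+ 3 + A * B * e ^+ 3)); last by ring.
do 3 (apply: le_trans (ler_normD _ _) _; apply: lerD => //).
Qed.

Lemma eq_jet f g a0 a1 a2 b0 b1 b2 : f =1 g -> a0 = b0 -> a1 = b1 -> a2 = b2 ->
  jet f a0 a1 a2 -> jet g b0 b1 b2.
Proof. by move=> /funext -> -> -> ->. Qed.

Lemma is_derive_expRM c (x : R) : is_derive x 1 (fun s => expR (c * s)) (c * expR (c * x)).
Proof.
have h : is_derive x 1 (c *: (@id R)) (c *: 1) by exact: is_deriveZ.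
apply: is_derive_eq (is_derive1_comp (is_derive_expR (c * x)) h) _.
by rewrite /GRing.scale /= mulr1 mulrC.
Qed.

Lemma expR_taylor2 c (s : R) : 0 <= s ->
  `|expR (c * s) - 1 - c * s| <= c ^+ 2 * s ^+ 2 * expR (`|c| * s).
Proof.
have d1 (x : R) : is_derive x 1 (fun s => 1 * (c * expR (c * s)) + (- c) * 1)
    (c ^+ 2 * expR (c * x)).
  have h := is_derive_lin c (- c) (is_derive_expRM c x) (is_derive_cst (1 : R) x 1).
  have -> : (fun s => 1 * (c * expR (c * s)) + - c * 1) =
     (fun s => c * expR (c * s) + - c * cst 1 s) by apply/funext => r; rewrite mul1r.
  by apply: is_derive_eq h _; ring.
have d0 (x : R) : is_derive x 1 (fun s => expR (c * s) - 1 - c * s)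
    (1 * (c * expR (c * x)) + (- c) * 1).
  have h := is_derive_lin 1 (- 1) (is_derive_lin 1 (-1) (is_derive_expRM c x)
    (is_derive_cst (1 : R) x 1)) (is_derive_lin c 0 (is_derive_id x 1) (is_derive_id x 1)).
  rewrite (_ : (fun s => _) = (fun s => 1 * (1 * expR (c * s) + -1 * cst 1 s) +
    -1 * (c * id s + 0 * id s))); last by apply/funext => r /=; ring.
  by apply: is_derive_eq h _; ring.
have b2 (s' : R) : 0 <= s' -> `|c ^+ 2 * expR (c * s')| <= c ^+ 2 * s' ^+ 0 * expR (`|c| * s').
  move=> s'0; rewrite expr0 mulr1 normrM (ger0_norm (sqr_ge0 c)) (ger0_norm (expR_ge0 _)).
  by rewrite ler_wpM2l ?sqr_ge0// expR_bound// ler_norm.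
have c20 : 0 <= c ^+ 2 by exact: sqr_ge0.
have b1 := MVT_bound d1 _ c20 (normr_ge0 c) b2.
apply: (MVT_bound d0 _ c20 (normr_ge0 c)).
  by rewrite mulr0 expR0; ring.
by apply: b1; rewrite mulr0 expR0; ring.
Qed.

Lemma expR_taylor3 c (s : R) : 0 <= s ->
  `|expR (c * s) - 1 - c * s - c ^+ 2 / 2 * s ^+ 2| <=
  `|c| ^+ 3 * s ^+ 3 * expR (`|c| * s).
Proof.
have d0 (x : R) : is_derive x 1 (fun s => expR (c * s) - 1 - c * s - c ^+ 2 / 2 * s ^+ 2)
    (c * (expR (c * x) - 1 - c * x)).
  have h := is_derive_lin 1 (- 1) (is_derive_lin 1 (-1) (is_derive_expRM c x)
    (is_derive_cst (1 : R) x 1)) (is_derive_lin c (c ^+ 2 / 2) (is_derive_id x 1)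
    (is_derive_mul (is_derive_id x 1) (is_derive_id x 1))).
  rewrite (_ : (fun s => _) = (fun s => 1 * (1 * expR (c * s) + -1 * cst 1 s) +
    -1 * (c * id s + c ^+ 2 / 2 * (id s * id s)))); last first.
    by apply/funext => r /=; ring.
  by apply: is_derive_eq h _ => /=; field.
have c30 : 0 <= `|c| ^+ 3 by exact: exprn_ge0.
apply: (MVT_bound d0 _ c30 (normr_ge0 c)).
  by rewrite mulr0 expR0; ring.
move=> r r0; rewrite normrM exprS -(mulrA `|c|) -mulrA ler_wpM2l// mulrA.
by rewrite -mulrA -expr2 real_normK ?num_real//; exact: expR_taylor2.
Qed.

Lemma jet_exp1 c : jet (fun e => expR (c * e)) 1 c (c ^+ 2 / 2).
Proof.
exists (`|c| ^+ 3 * expR `|c|); first by rewrite mulr_ge0 ?exprn_ge0 ?expR_ge0.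
move=> e /andP[e0 e1]; rewrite 2!opprD 2!addrA; apply: le_trans (expR_taylor3 c e0) _.
rewrite mulrAC ler_wpM2r ?exprn_ge0// ler_wpM2l ?exprn_ge0// ler_expR.
by rewrite ler_piMr.
Qed.

Lemma jet_exp2 c : jet (fun e => expR (c * e ^+ 2)) 1 0 c.
Proof.
exists (c ^+ 2 * expR `|c|); first by rewrite mulr_ge0 ?sqr_ge0 ?expR_ge0.
move=> e /andP[e0 e1]; rewrite mul0r addr0 opprD addrA.
have e20 : 0 <= e ^+ 2 by exact: sqr_ge0.
apply: le_trans (expR_taylor2 c e20) _.
rewrite mulrAC ler_pM//.
- by rewrite mulr_ge0 ?sqr_ge0 ?expR_ge0.
- by rewrite sqr_ge0.
- rewrite ler_wpM2l ?sqr_ge0// ler_expR ler_piMr// exprn_ile1//.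
- by rewrite -exprM [leLHS]exprS ler_piMl// exprn_ge0.
Qed.

Lemma jet_sinh1 c : jet (fun e => sinh (c * e)) 0 c 0.
Proof.
apply: eq_jet (jetZ 2^-1 (jetD (jet_exp1 c) (jetZ (-1) (jet_exp1 (- c))))).
- by move=> e; rewrite /sinh mulN1r mulNr mulrC.
- by ring.
- by field.
- by field.
Qed.

Lemma jet_cosh1 c : jet (fun e => cosh (c * e)) 1 0 (c ^+ 2 / 2).
Proof.
apply: eq_jet (jetZ 2^-1 (jetD (jet_exp1 c) (jet_exp1 (- c)))).
- by move=> e; rewrite /cosh mulNr mulrC.
- by field.
- by field.
- by field.
Qed.

Lemma jet_sinh2 c : jet (fun e => sinh (c * e ^+ 2)) 0 0 c.
Proof.
apply: eq_jet (jetZ 2^-1 (jetD (jet_exp2 c) (jetZ (-1) (jet_exp2 (- c))))).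
- by move=> e; rewrite /sinh mulN1r mulNr mulrC.
- by ring.
- by field.
- by field.
Qed.

Lemma jet_cosh2 c : jet (fun e => cosh (c * e ^+ 2)) 1 0 0.
Proof.
apply: eq_jet (jetZ 2^-1 (jetD (jet_exp2 c) (jet_exp2 (- c)))).
- by move=> e; rewrite /cosh mulNr mulrC.
- by field.
- by field.
- by field.
Qed.

(** Gaussian mean of [sinh] against Bernoulli mean, both multiplied by [cosh (mu * e)] so that no
    jet is divided. Both products expand to [mu * e ^+ 2], which is where the odds exp(-2 mu eps)
    match the drift. *)
Lemma jet_sinh_gap (mu : R) : exists2 C : R, 0 <= C & forall e : R, 0 <= e <= 1 ->
  `|sinh (mu * e ^+ 2) * expR (2^-1 * e ^+ 2) * cosh (mu * e) -
    sinh (mu * e) * sinh (1 * e)| <= C * e ^+ 3.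
Proof.
have [C C0 h] : jet (fun e => sinh (mu * e ^+ 2) * expR (2^-1 * e ^+ 2) * cosh (mu * e) +
    -1 * (sinh (mu * e) * sinh (1 * e))) 0 0 0.
  apply: eq_jet (jetD (jetM (jetM (jet_sinh2 mu) (jet_exp2 2^-1)) (jet_cosh1 mu))
    (jetZ (-1) (jetM (jet_sinh1 mu) (jet_sinh1 1)))) => //; ring.
by exists C => // e /h; rewrite !mul0r !addr0 subr0 mulN1r.
Qed.

Lemma jet_cosh_gap (mu : R) : exists2 C : R, 0 <= C & forall e : R, 0 <= e <= 1 ->
  `|cosh (mu * e ^+ 2) * expR (2^-1 * e ^+ 2) - cosh (1 * e)| <= C * e ^+ 3.
Proof.
have [C C0 h] : jet (fun e => cosh (mu * e ^+ 2) * expR (2^-1 * e ^+ 2) +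
    -1 * cosh (1 * e)) 0 0 0.
  apply: eq_jet (jetD (jetM (jet_cosh2 mu) (jet_exp2 2^-1))
    (jetZ (-1) (jet_cosh1 1))) => //; by field.
by exists C => // e /h; rewrite !mul0r !addr0 subr0 mulN1r.
Qed.

End jets.

(** * Exchanging one Gaussian weight for a two-point weight *)

Section gaussian_swap.
Context {R : realType}.
Implicit Types (U V a b x e c mu lam : R).

Lemma smoothedN U V a b x : smoothed U V a (- b) (- x) = smoothed U V a b x.
Proof. by rewrite /smoothed /affexp mulrNN. Qed.

Lemma fracN U V b : frac U V (- b) 0 = frac U V b 0.
Proof. by rewrite /frac /affexp !mulr0. Qed.

Lemma taylor3N U V a b x : taylor3 U V a (- b) (- x) = taylor3 U V a b x.
Proof.
rewrite /taylor3 smoothedN -{1}(oppr0 R) smoothedN.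
have -> : smoothed1 U V a (- b) = - smoothed1 U V a b.
  by rewrite /smoothed1 fracN -{2}(oppr0 R) smoothedN mulrN !mulNr.
have -> : smoothed2 U V a (- b) = smoothed2 U V a b.
  by rewrite /smoothed2 fracN -(smoothedN U V a b 0) oppr0 mulrN !sqrrN.
have -> : sinh (- x) = - sinh x by rewrite /sinh opprK -mulNr opprB.
have -> : cosh (- x) = cosh x by rewrite /cosh opprK addrC.
by rewrite mulrNN.
Qed.

(** Reflecting [x] and [b] together leaves the remainder unchanged, which reduces negative [x] to
    positive. *)
Lemma taylor3_bound_abs U V a b x : 0 <= U -> 0 <= V -> 0 < U + V ->
  0 <= a -> a <= 1 -> 1 <= `|b| ->
  `|taylor3 U V a b x| <= 8 * (a * `|b|) * `|b| ^+ 2 * smoothed U V a b 0 *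
    `|x| ^+ 3 * expR ((a * `|b| + 1) * `|x|).
Proof.
move=> U0 V0 UV0 a0 a1 b1; have [x0|x0] := leP 0 x.
  by rewrite (ger0_norm x0); exact: taylor3_bound.
rewrite -taylor3N -(smoothedN U V a b 0) oppr0 -(normrN b) (ltr0_norm x0).
by apply: taylor3_bound; rewrite ?normrN// oppr_ge0 ltW.
Qed.

Lemma cube_le_expR x : 0 <= x -> x ^+ 3 <= 27 * expR x.
Proof.
move=> x0; have h : x / 3 <= expR (x / 3).
  by apply: le_trans (expR_ge1Dx _); rewrite lerDr.
have -> : expR x = expR (x / 3) ^+ 3.
  by rewrite -expRM_natl; congr expR; field.
have -> : x ^+ 3 = 27 * (x / 3) ^+ 3 by field.
by rewrite ler_wpM2l// lerXn2r// nnegrE ?divr_ge0// expR_ge0.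
Qed.

(** Exchanges the cube for exponentials at the scale 1/e, whose means under a normal law of
    deviation [e] are explicit and bounded; the factor [e ^+ 3] comes out in front. *)
Lemma cube_expR_le e x lam : 0 < e -> 0 <= lam ->
  `|x| ^+ 3 * expR ((lam + 1) * `|x|) <= 27 * e ^+ 3 *
    (expR ((e^-1 + lam + 1) * x) + expR (- ((e^-1 + lam + 1) * x))).
Proof.
move=> e0 lam0; have e30 : 0 < e ^+ 3 by exact: exprn_gt0.
have h := @cube_le_expR (`|x| / e); rewrite expr_div_n ler_pdivrMr// in h.
have {}h : `|x| ^+ 3 <= 27 * expR (`|x| / e) * e ^+ 3.
  by apply: h; rewrite divr_ge0// ltW.
apply: le_trans (ler_wpM2r (expR_ge0 _) h) _.
have h27 : 0 <= 27 * e ^+ 3 by rewrite mulr_ge0// ltW.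
rewrite (mulrAC 27) -[leLHS]mulrA -expRD ler_wpM2l//.
have -> : `|x| / e + (lam + 1) * `|x| = (e^-1 + lam + 1) * `|x| by ring.
have [x0|x0] := leP 0 x.
  by rewrite (ger0_norm x0) lerDl expR_ge0.
by rewrite (ltr0_norm x0) mulrN lerDr expR_ge0.
Qed.

Definition bernoulli_mean (p e : R) (g : R -> R) : R := p * g (- e) + (1 - p) * g e.

Lemma cosh_ge1 x : 1 <= cosh x.
Proof.
rewrite /cosh ler_pdivlMr// mul1r.
have := expRxMexpNx_1 x; have := expR_gt0 x; have := expR_gt0 (- x).
by have := sqr_ge0 (expR x - expR (- x)); nra.
Qed.

Lemma prob_cosh x : prob (expR (- (2 * x))) = expR (- x) / (2 * cosh x).
Proof.
have -> : expR (- (2 * x)) = expR (- x) ^+ 2 by rewrite -expRM_natl; congr expR; ring.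
have h := expRxMexpNx_1 x; have h0 := expR_gt0 x; have h1 := expR_gt0 (- x).
rewrite /prob /cosh.
have -> : expR x = (expR (- x))^-1 by rewrite expRN invrK.
field; have h2 : expR (- x) != 0 by rewrite gt_eqF.
by rewrite h2 /= gt_eqF//; have := mulr_gt0 h1 h1; lra.
Qed.

Lemma bernoulli_mean_sinh mu e :
  bernoulli_mean (prob (expR (- (2 * (mu * e))))) e sinh =
  sinh (mu * e) * sinh e / cosh (mu * e).
Proof.
rewrite /bernoulli_mean prob_cosh.
have : cosh (mu * e) != 0 by rewrite gt_eqF// (lt_le_trans _ (cosh_ge1 _)).
have -> : sinh (- e) = - sinh e by rewrite /sinh opprK -mulNr opprB.
have : sinh (mu * e) = cosh (mu * e) - expR (- (mu * e)) by rewrite /sinh /cosh; field.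
by move=> -> ?; field.
Qed.

Lemma bernoulli_mean_cosh p e : bernoulli_mean p e cosh = cosh e.
Proof.
rewrite /bernoulli_mean (_ : cosh (- e) = cosh e); first by ring.
by rewrite /cosh opprK addrC.
Qed.

Lemma bernoulli_mean_lin p e (A B D : R) (f g h : R -> R) :
  bernoulli_mean p e (fun x => A + B * f x + D * g x + h x) =
  A + B * bernoulli_mean p e f + D * bernoulli_mean p e g + bernoulli_mean p e h.
Proof. by rewrite /bernoulli_mean; ring. Qed.

Lemma bernoulli_mean_norm p e (f : R -> R) C : 0 <= p <= 1 ->
  (forall x, `|x| = `|e| -> `|f x| <= C) -> `|bernoulli_mean p e f| <= C.
Proof.
move=> /andP[p0 p1] fC; have q0 : 0 <= 1 - p by rewrite subr_ge0.
rewrite /bernoulli_mean; apply: le_trans (ler_normD _ _) _.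
rewrite !normrM (ger0_norm p0) (ger0_norm q0).
have h1 := ler_wpM2l p0 (fC (- e) (normrN e)); have h2 := ler_wpM2l q0 (fC e erefl).
apply: le_trans (lerD h1 h2) _.
by rewrite -mulrDl addrC subrK mul1r.
Qed.

Lemma has_mean_base e m c (A B D E k : R) : 0 < e -> c ^+ 2 = 1 ->
  has_mean e (fun y => A + B * expR (m + c * y) + D * expR (- (m + c * y)) +
    E * (expR (k * (m + c * y)) + expR (- (k * (m + c * y)))))
  (A + B * (expR m * expR (2^-1 * e ^+ 2)) + D * (expR (- m) * expR (2^-1 * e ^+ 2)) +
    E * ((expR (k * m) + expR (- (k * m))) * expR (2^-1 * (k * e) ^+ 2))).
Proof.
move=> e0 c2.
have mexp d z : has_mean e (fun y => expR (d + z * y))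
    (expR d * expR (2^-1 * (z * e) ^+ 2)).
  have := has_mean_exp e0 z d; rewrite (_ : z ^+ 2 * e ^+ 2 / 2 = 2^-1 * (z * e) ^+ 2).
    by rewrite expRD.
  by field.
have h1 := mexp m c; have h2 := mexp (- m) (- c).
have h3 := mexp (k * m) (k * c); have h4 := mexp (- (k * m)) (- (k * c)).
have e1 : (c * e) ^+ 2 = e ^+ 2 by rewrite exprMn c2 mul1r.
have e2 : (- c * e) ^+ 2 = e ^+ 2 by rewrite mulNr sqrrN.
have e3 : (k * c * e) ^+ 2 = (k * e) ^+ 2 by rewrite mulrAC exprMn c2 mulr1.
have e4 : (- (k * c) * e) ^+ 2 = (k * e) ^+ 2 by rewrite mulNr sqrrN.
rewrite e1 in h1; rewrite e2 in h2; rewrite e3 in h3; rewrite e4 in h4.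
have := has_meanD (has_meanD (has_meanD (has_mean_cst e0 A)
  (has_meanZ B h1)) (has_meanZ D h2)) (has_meanZ E (has_meanD h3 h4)).
rewrite -mulrDl; congr has_mean; apply/funext => y /=.
have -> : - (m + c * y) = - m + - c * y by ring.
have -> : k * (m + c * y) = k * m + k * c * y by ring.
by have -> : - (k * m + k * c * y) = - (k * m) + - (k * c) * y by ring.
Qed.

(** Turns an error measured by the value at 0 into one relative to the Bernoulli mean, the form that
    can be iterated over cells. *)
Lemma smoothed0_le_bernoulli p e U V a b : 0 <= U -> 0 <= V -> 0 < U + V ->
  0 <= a -> 0 <= p <= 1 -> 0 < e -> e <= 1 ->
  smoothed U V a b 0 <= expR (a * `|b|) * bernoulli_mean p e (smoothed U V a b).
Proof.
move=> U0 V0 UV0 a0 /andP[p0 p1] e0 e1; have q0 : 0 <= 1 - p by rewrite subr_ge0.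
have le (x : R) : `|x| <= 1 ->
    smoothed U V a b 0 <= expR (a * `|b|) * smoothed U V a b x.
  move=> xe; have := @smoothed_le R U V a b U0 V0 UV0 a0 x 0.
  rewrite sub0r normrN mulrC => h; apply: le_trans h _.
  rewrite ler_wpM2r ?(ltW (smoothed_gt0 _ _ _ _ _))// ler_expR ler_piMr//.
  by rewrite mulr_ge0.
have n1 := le (- e); rewrite normrN (ger0_norm (ltW e0)) in n1.
have n2 := le e; rewrite (ger0_norm (ltW e0)) in n2.
have h1 := ler_wpM2l p0 (n1 e1); have h2 := ler_wpM2l q0 (n2 e1).
move: (smoothed U V a b 0) h1 h2 => S0 h1 h2.
have := lerD h1 h2; rewrite -mulrDl addrC subrK mul1r /bernoulli_mean.
move: (smoothed U V a b (- e)) (smoothed U V a b e) (expR (a * `|b|)) => s1 s2 K h.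
by rewrite mulrDr (mulrCA K) (mulrCA K (1 - p)).
Qed.

Lemma measurable_smoothed U V a b : measurable_fun [set: R] (smoothed U V a b).
Proof.
apply: measurableT_comp => //.
have -> : (fun x => a * ln (affexp U V b x)) = (fun x => cst a x * (@ln R \o affexp U V b) x).
  by [].
apply: measurable_funM => //; apply: measurableT_comp => //.
apply: measurable_funD => //; apply: measurable_funM => //.
by apply: measurableT_comp => //; exact: measurable_funM.
Qed.

Definition swap_bounds mu e c eta (g : R -> R) : Prop :=
  (((1 - eta) * bernoulli_mean (prob (expR (- (2 * (mu * e))))) e g)%:E <=
   \int[normal_prob 0 e]_y (g (mu * e ^+ 2 + c * y))%:E /\
   \int[normal_prob 0 e]_y (g (mu * e ^+ 2 + c * y))%:E <=
   ((1 + eta) * bernoulli_mean (prob (expR (- (2 * (mu * e))))) e g)%:E)%E.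

Lemma gaussian_swap mu lam : 0 <= mu -> 0 <= lam -> exists2 C : R, 0 <= C &
  forall U V a b e c : R, 0 <= U -> 0 <= V -> 0 < U + V -> 0 <= a -> a <= 1 ->
    1 <= `|b| -> a * `|b| = lam -> 0 < e -> e <= 1 -> c ^+ 2 = 1 ->
  swap_bounds mu e c (C * (e ^+ 3 * b ^+ 2)) (smoothed U V a b).
Proof.
move=> mu0 lam0.
have [K1 K10 hK1] := jet_sinh_gap mu; have [K2 K20 hK2] := jet_cosh_gap mu.
pose k := 2 + lam; have k0 : 0 <= k by rewrite addr_ge0.
pose Q0 := 2 * expR (k * mu) * expR (2^-1 * k ^+ 2).
have Q00 : 0 <= Q0 by rewrite !mulr_ge0 ?expR_ge0.
(* In this order: the [sinh] gap, the [cosh] gap, the Gaussian remainder with 216 = 8 * 27, and the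
   Bernoulli remainder. *)
pose C' := lam * K1 + 2 * lam * K2 + 216 * lam * Q0 + 8 * lam * expR (lam + 1).
have C'0 : 0 <= C' by rewrite !addr_ge0 ?mulr_ge0 ?expR_ge0.
exists (C' * expR lam); first by rewrite mulr_ge0// expR_ge0.
move=> U V a b e c U0 V0 UV0 a0 a1 b1 abl e0 e1 c2.
rewrite /swap_bounds; set p := prob _; set m := mu * e ^+ 2.
have e0' := ltW e0; have e01 : 0 <= e <= 1 by rewrite e0'.
have p01 : 0 <= p <= 1 by exact: prob01 (expR_ge0 _).
have bb : `|b| ^+ 2 = b ^+ 2 by rewrite real_normK// num_real.
have b21 : 1 <= b ^+ 2 by rewrite -bb expr_ge1.
have bb2 : `|b| <= b ^+ 2 by rewrite -bb expr2 ler_peMr.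
set S := smoothed U V a b; set S0 := S 0.
have S0_gt0 : 0 < S0 by exact: smoothed_gt0.
set w := bernoulli_mean p e S.
pose s1 := smoothed1 U V a b; pose s2 := smoothed2 U V a b.
have s1b : `|s1| <= lam * S0 by rewrite -abl; exact: smoothed1_bound.
have s2b : `|s2| <= 2 * lam * b ^+ 2 * S0.
  apply: le_trans (smoothed2_bound U0 V0 UV0 a0 a1 b1) _.
  by rewrite abl ler_wpM2r ?(ltW S0_gt0)// ler_wpM2l// mulr_ge0.
have tb x : `|taylor3 U V a b x| <= 8 * lam * b ^+ 2 * S0 *
    `|x| ^+ 3 * expR ((lam + 1) * `|x|).
  by rewrite -abl -bb; exact: taylor3_bound_abs.
have D0 : 0 <= 8 * lam * b ^+ 2 * S0 
  by have h1 := sqr_ge0 b; have h2 := ltW S0_gt0; rewrite mulr_ge0// mulr_ge0// mulr_ge0.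
have Sdec x : S x = S0 - s2 + s1 * sinh x + s2 * cosh x + taylor3 U V a b x.
  by rewrite /taylor3 -/S -/S0 -/s1 -/s2; ring.
pose kap := e^-1 + lam + 1.
pose E := 8 * lam * b ^+ 2 * S0 * (27 * e ^+ 3).
have E0 : 0 <= E by rewrite mulr_ge0// mulr_ge0// exprn_ge0.
have tE x : `|taylor3 U V a b x| <= E * (expR (kap * x) + expR (- (kap * x))).
  apply: le_trans (tb x) _; rewrite -mulrA /E -(mulrA (8 * lam * b ^+ 2 * S0)).
  by rewrite ler_wpM2l//; exact: cube_expR_le.
pose A := S0 - s2; pose B := (s1 + s2) / 2; pose D := (s2 - s1) / 2.
have baseE x : S0 - s2 + s1 * sinh x + s2 * cosh x = A + B * expR x + D * expR (- x).
  by rewrite /A /B /D /sinh /cosh; field.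
pose E2 := expR (2^-1 * e ^+ 2).
pose J := S0 - s2 + s1 * (sinh m * E2) + s2 * (cosh m * E2).
pose Q := (expR (kap * m) + expR (- (kap * m))) * expR (2^-1 * (kap * e) ^+ 2).
have JE : A + B * (expR m * E2) + D * (expR (- m) * E2) = J.
  by rewrite /J /A /B /D /sinh /cosh; field.
have hmean F := has_mean_base m A B D F kap e0 c2.
rewrite -/E2 in hmean.
have {}hmean F : has_mean e (fun y => A + B * expR (m + c * y) + D * expR (- (m + c * y)) +
    F * (expR (kap * (m + c * y)) + expR (- (kap * (m + c * y))))) (J + F * Q).
  by rewrite -JE; exact: hmean.
have mS : measurable_fun [set: R] (fun y => S (m + c * y)).
  apply: (measurableT_comp (measurable_smoothed U V a b)).
  by apply: measurable_funD => //; exact: measurable_funM.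
(* Since [kap * e] equals [1 + (lam + 1) * e], it is at most [k] for [e <= 1]; this makes the
   Gaussian mean of the majorant bounded uniformly in [e]. *)
have QQ0 : Q <= Q0.
  have ke : kap * e = 1 + (lam + 1) * e.
    by rewrite /kap -addrA mulrDl mulVf// gt_eqF.
  have ke0 : 0 <= kap * e by rewrite ke addr_ge0// mulr_ge0// addr_ge0.
  have kek : kap * e <= k.
    rewrite ke (_ : k = 1 + (lam + 1)); last by rewrite /k; ring.
    by rewrite lerD2l ler_piMr// addr_ge0.
  have km : kap * m <= k * mu.
    rewrite /m mulrCA [leRHS]mulrC ler_wpM2l// expr2 mulrA.
    by apply: le_trans kek; rewrite ler_piMr.
  have km0 : 0 <= kap * m by rewrite /m mulrCA mulr_ge0// expr2 mulrA mulr_ge0.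
  rewrite /Q /Q0 ler_pM ?addr_ge0 ?expR_ge0//.
    have h1 : expR (kap * m) <= expR (k * mu) by rewrite ler_expR.
    have h2 : expR (- (kap * m)) <= expR (k * mu).
      by apply: le_trans h1; rewrite ler_expR ge0_cp.
    by rewrite mulr_natl mulr2n lerD.
  by rewrite ler_expR ler_wpM2l// lerXn2r// nnegrE.
have wE : w = S0 - s2 + s1 * (sinh (mu * e) * sinh e / cosh (mu * e)) + s2 * cosh e +
    bernoulli_mean p e (taylor3 U V a b).
  rewrite -bernoulli_mean_sinh -(bernoulli_mean_cosh p e) -bernoulli_mean_lin.
  by rewrite /w; congr bernoulli_mean; apply/funext.
have bt : `|bernoulli_mean p e (taylor3 U V a b)| <=
    8 * lam * b ^+ 2 * S0 * e ^+ 3 * expR (lam + 1).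
  apply: bernoulli_mean_norm => // x xe; apply: le_trans (tb x) _.
  have D1 : 0 <= 8 * lam * b ^+ 2 * S0 * e ^+ 3 by apply: mulr_ge0; rewrite ?exprn_ge0.
  rewrite xe (ger0_norm e0') ler_wpM2l//.
  by rewrite ler_expR ler_piMr// addr_ge0.
have g1 : `|sinh m * E2 - sinh (mu * e) * sinh e / cosh (mu * e)| <= K1 * e ^+ 3.
  have := hK1 e e01; rewrite mul1r -/m -/E2.
  have ch1 := cosh_ge1 (mu * e); have ch0 : 0 < cosh (mu * e) by exact: lt_le_trans ch1.
  have -> : sinh m * E2 * cosh (mu * e) - sinh (mu * e) * sinh e =
    (sinh m * E2 - sinh (mu * e) * sinh e / cosh (mu * e)) * cosh (mu * e).
    by field; rewrite gt_eqF.
  rewrite normrM (ger0_norm (ltW ch0)); apply: le_trans.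
  by rewrite ler_peMr.
have g2 : `|cosh m * E2 - cosh e| <= K2 * e ^+ 3.
  by have := hK2 e e01; rewrite mul1r.
have e30 : 0 <= e ^+ 3 by exact: exprn_ge0.
have JW : `|J - w| + E * Q <= C' * (e ^+ 3 * b ^+ 2) * S0.
  have -> : J - w = s1 * (sinh m * E2 - sinh (mu * e) * sinh e / cosh (mu * e)) +
      s2 * (cosh m * E2 - cosh e) - bernoulli_mean p e (taylor3 U V a b).
    by rewrite wE /J; ring.
  have n1 : `|s1 * (sinh m * E2 - sinh (mu * e) * sinh e / cosh (mu * e))| <=
      lam * b ^+ 2 * S0 * (K1 * e ^+ 3).
    rewrite normrM ler_pM//; apply: le_trans s1b _.
    by rewrite ler_wpM2r ?(ltW S0_gt0)// ler_peMr.
  have n2 : `|s2 * (cosh m * E2 - cosh e)| <= 2 * lam * b ^+ 2 * S0 * (K2 * e ^+ 3).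
    by rewrite normrM ler_pM.
  have n3 : E * Q <= E * Q0 by rewrite ler_wpM2l.
  apply: le_trans (lerD (le_trans (ler_normB _ _) (lerD (le_trans (ler_normD _ _)
    (lerD n1 n2)) bt)) n3) _.
  by rewrite /E /C' le_eqVlt; apply/orP; left; apply/eqP; ring.
have S0w : S0 <= expR lam * w by rewrite /w -abl; exact: smoothed0_le_bernoulli.
have {S0w}JW : `|J - w| + E * Q <= C' * expR lam * (e ^+ 3 * b ^+ 2) * w.
  apply: le_trans JW _; rewrite (_ : C' * expR lam * (e ^+ 3 * b ^+ 2) * w =
    C' * (e ^+ 3 * b ^+ 2) * (expR lam * w)); last by ring.
  by rewrite ler_wpM2l// mulr_ge0// mulr_ge0// sqr_ge0.
move: JW; rewrite -lerBrDr ler_norml => /andP[JW1 JW2].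
split.
  apply: (@le_trans _ _ (J + - E * Q)%:E).
    by rewrite lee_fin mulNr mulrBl mul1r; move: JW1; set X := _ * w; lra.
  apply: (has_mean_ge (hmean (- E)) mS) => y; first exact/ltW/smoothed_gt0.
  rewrite Sdec -baseE lerD2l; have := tE (m + c * y); rewrite ler_norml mulNr.
  by case/andP.
apply: (@le_trans _ _ (J + E * Q)%:E); last first.
  by rewrite lee_fin mulrDl mul1r; move: JW2; set X := _ * w; lra.
apply: (has_mean_le (hmean E) mS) => y; rewrite ltW ?smoothed_gt0//=.
by rewrite Sdec -baseE lerD2l; have := tE (m + c * y); rewrite ler_norml => /andP[].
Qed.

End gaussian_swap.

(** * Lindeberg replacement of the weights *)

(** The integral of a nonnegative function is a supremum over simple functions below it, so
    monotonicity holds without measurability. *)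
Lemma ge0_le_integralT d (T : measurableType d) (R : realType)
    (mu : {measure set T -> \bar R}) (f g : T -> \bar R) :
  (forall x, 0 <= f x)%E -> (forall x, f x <= g x)%E ->
  (\int[mu]_x f x <= \int[mu]_x g x)%E.
Proof.
move=> f0 fg; rewrite !ge0_integralTE//; last by move=> x; exact: le_trans (fg x).
apply: ereal_sup_le => _ [h hf <-]; exists h => //= x; exact: le_trans (fg x).
Qed.

Lemma ge0_integral_convex d (T : measurableType d) (R : realType)
    (mu : {measure set T -> \bar R}) (p : R) (f g : T -> R) : 0 <= p <= 1 ->
  (forall x, 0 <= f x) -> (forall x, 0 <= g x) ->
  measurable_fun setT f -> measurable_fun setT g ->
  (\int[mu]_x (p * f x + (1 - p) * g x)%:E =
   p%:E * \int[mu]_x (f x)%:E + (1 - p)%:E * \int[mu]_x (g x)%:E)%E.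
Proof.
move=> /andP[p0 p1] f0 g0 /measurable_EFinP mf /measurable_EFinP mg.
have q0 : 0 <= 1 - p by rewrite subr_ge0.
have pf0 x : (0 <= p%:E * (f x)%:E)%E by rewrite mule_ge0 ?lee_fin.
have qg0 x : (0 <= (1 - p)%:E * (g x)%:E)%E by rewrite mule_ge0 ?lee_fin.
rewrite -!ge0_integralZl_EFin//; try by move=> x _; rewrite lee_fin.
by rewrite -ge0_integralD//; exact: measurable_funeM.
Qed.

(** * Integrating out one independent variable *)

Section decoupling.
Context d (T : measurableType d) (R : realType) (P : probability T R).
Local Open Scope ereal_scope.

(** As functions of [E] both sides are finite measures, so agreement on the pi-system [G] extends to
    the generated sigma-algebra. *)
Lemma independent_sigma (G : set (set T)) (D : set T) : measurable D ->
  G `<=` measurable -> setI_closed G -> G setT ->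
  (forall E, G E -> P (D `&` E) = P D * P E) ->
  forall E, <<s G >> E -> P (D `&` E) = P D * P E.
Proof.
move=> mD Gm GI GT h E sE.
have fD : P D \is a fin_num by exact: fin_num_measure.
have r0 : (0 <= fine (P D))%R by rewrite fine_ge0.
have E1 A : mrestr P mD A = P (D `&` A) by rewrite /mrestr setIC.
have E2 A : mscale (NngNum r0) P A = P D * P A by rewrite /mscale /= fineK.
have := @g_sigma_algebra_measure_unique _ _ _ G Gm (fun=> setT) (fun=> GT) _
  (mrestr P mD) (mscale (NngNum r0) P) GI _ _ E sE.
rewrite -E1 -E2; apply.
- by rewrite bigcup_const//; exists 0%N.
- by move=> A GA; apply: etrans (E1 A) _; rewrite h//; exact/esym/E2.
- by move=> _; apply: le_lt_trans (probability_le1 P (measurableI _ _ measurableT mD)) (ltry _).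
Qed.

(** The sample point itself, seen through the smaller sigma-algebra, plays the second variable. Its
    joint law with [Y] is a product by independence, and Tonelli applies. *)
Lemma decoupling (N : probability (measurableTypeR R) R) (Y : T -> measurableTypeR R)
    (G : set (set T)) (Psi : measurableTypeR R * g_sigma_algebraType G -> \bar R) :
  measurable_fun setT Y -> (forall A, measurable A -> P (Y @^-1` A) = N A) ->
  G `<=` measurable -> setI_closed G -> G setT ->
  (forall A E, measurable A -> G E -> P (Y @^-1` A `&` E) = P (Y @^-1` A) * P E) ->
  measurable_fun setT Psi -> (forall z, 0 <= Psi z) ->
  \int[P]_w Psi (Y w, w) = \int[P]_w \int[N]_y Psi (y, w).
Proof.
move=> mY YN Gm GI GT ind mPsi Psi0.
have sGm : <<s G >> `<=` @measurable _ T.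
  by apply: smallest_sub => //; exact: sigma_algebra_measurable.
pose S := g_sigma_algebraType G.
have mid : measurable_fun setT (id : T -> S).
  by move=> _ B mB; rewrite setTI preimage_id; exact: sGm.
pose idRV : {mfun T >-> S} := HB.pack (id : T -> S) (isMeasurableFun.Build _ _ _ _ _ mid).
pose m2 := distribution P idRV.
have mYid : measurable_fun setT (fun w : T => (Y w, w : S)).
  exact: measurable_fun_pair.
pose YRV : {mfun T >-> (measurableTypeR R * S)%type} :=
  HB.pack (fun w : T => (Y w, w : S)) (isMeasurableFun.Build _ _ _ _ _ mYid).
pose m' := distribution P YRV.
have m'E A B : measurable A -> measurable B -> m' (A `*` B) = N A * m2 B.
  move=> mA mB; rewrite -YN//.
  have mYA : measurable (Y @^-1` A) by rewrite -[X in measurable X]setTI; exact: mY.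
  exact: (independent_sigma mYA Gm GI GT (fun E => ind A E mA)).
transitivity (\int[m']_z Psi z).
  by rewrite ge0_integral_distribution.
transitivity (\int[N \x m2]_z Psi z).
  by apply: eq_measure_integral => B mB _; exact/esym/(product_measure_unique m'E mB).
rewrite fubini_tonelli2//= ge0_integral_distribution//.
- exact: measurable_fun_fubini_tonelli_G.
- by move=> w; apply: integral_ge0.
Qed.

End decoupling.

(** * Discrete last passage times and their partition functions *)

Section last_passage_recursion.
Context {R : realType}.
Implicit Types (x : nat -> nat -> R) (k l i : nat) (c : nat * nat).

Fixpoint lpp x k : nat -> R :=
  if k is k'.+1 then
    fix f l := if l is l'.+1 then Num.max (f l' + x l' k'.+1) (lpp x k' l'.+1)
               else lpp x k' 0%N
  else fun l => \sum_(0 <= i < l) x i 0%N.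

(** The recursion of [lpp] with maximum and sum turned into sum and product: the partition function
    of the directed polymer on the same paths. *)
Fixpoint zpp (beta : R) x k : nat -> R :=
  if k is k'.+1 then
    fix f l := if l is l'.+1 then f l' * expR (beta * x l' k'.+1) + zpp beta x k' l'.+1
               else zpp beta x k' 0%N
  else fun l => expR (beta * \sum_(0 <= i < l) x i 0%N).

Lemma zpp_gt0 beta x k l : 0 < zpp beta x k l.
Proof.
elim: k l => [|k IHk] l /=; first exact: expR_gt0.
elim: l => [|l IHl]; first exact: IHk.
by rewrite addr_gt0// mulr_gt0// expR_gt0.
Qed.

Lemma le_zpp beta x k l : 0 <= beta -> expR (beta * lpp x k l) <= zpp beta x k l.
Proof.
move=> b0; elim: k l => [//|k IHk]; elim=> [|l IHl] /=; first exact: IHk.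
have [h|h] := leP (lpp x k.+1 l + x l k.+1) (lpp x k l.+1).
  by rewrite ler_wpDl// ltW// mulr_gt0 ?expR_gt0//; exact: (zpp_gt0 _ _ k.+1).
rewrite ler_wpDr ?(ltW (zpp_gt0 _ _ _ _))// mulrDr expRD ler_wpM2r ?expR_ge0//.
Qed.

(** The prefactor bounds the number of paths: each of the [k] upward jumps has at most [l.+1]
    places. *)
Lemma zpp_le beta x k l : 0 <= beta ->
  zpp beta x k l <= (l.+1 ^ k)%:R * expR (beta * lpp x k l).
Proof.
move=> b0; elim: k l => [|k IHk]; first by move=> l; rewrite expn0 mul1r.
elim=> [|l IHl] /=; first by rewrite exp1n; have := IHk 0%N; rewrite exp1n.
set M := Num.max _ _.
have h1 : expR (beta * (lpp x k.+1 l + x l k.+1)) <= expR (beta * M).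
  by rewrite ler_expR ler_wpM2l// le_max lexx.
have h2 : expR (beta * lpp x k l.+1) <= expR (beta * M).
  by rewrite ler_expR ler_wpM2l// le_max lexx orbT.
have n1 : (l.+1 ^ k.+1 + l.+2 ^ k <= l.+2 ^ k.+1)%N.
  rewrite !expnS [X in (_ <= X)%N]mulSn addnC leq_add2l leq_mul2l; apply/orP; right.
  by case: (k) => // k'; rewrite leq_exp2r.
apply: (@le_trans _ _ ((l.+1 ^ k.+1)%:R * expR (beta * M) + (l.+2 ^ k)%:R * expR (beta * M))).
  apply: lerD; last by apply: le_trans (IHk _) _; rewrite ler_wpM2l.
  apply: le_trans (ler_wpM2r (expR_ge0 _) IHl) _.
  by rewrite -mulrA -expRD -mulrDr ler_wpM2l.
by rewrite -mulrDl -natrD ler_wpM2r ?expR_ge0// ler_nat.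
Qed.

Lemma eq_zpp beta x x' k l :
  (forall i j, (i < l)%N -> (j <= k)%N -> x i j = x' i j) ->
  zpp beta x k l = zpp beta x' k l.
Proof.
elim: k l => [|k IHk] l H /=.
  by congr (expR (_ * _)); apply: eq_big_nat => i /andP[_ il]; exact: H.
elim: l H => [|l IHl] H; first by apply: IHk => i j il jk; apply: H => //; exact: ltnW.
rewrite IHl; last by move=> i j il jk; apply: H => //; exact: ltnW.
by rewrite H// (IHk l.+1)// => i j il jk; apply: H => //; exact: ltnW.
Qed.

Definition upd x c (v : R) := fun l k => if (l, k) == c then v else x l k.

(** A path crosses a given cell at most once: the first coefficient collects the paths through [c],
    the second the others. *)
Lemma zpp_affine beta x c k l : exists UV : R * R, [/\ 0 <= UV.1, 0 <= UV.2 &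
  forall v, zpp beta (upd x c v) k l = UV.1 * expR (beta * v) + UV.2].
Proof.
case: c => i0 k0; elim: k l => [|k IHk] l /=.
- have [h|h] := boolP ((i0 < l)%N && (k0 == 0%N)).
  + case/andP: h => il /eqP ->.
    exists (expR (beta * \sum_(0 <= i < l | i != i0) x i 0%N), 0).
    split=> /=; [exact: expR_ge0|by []|move=> v].
    rewrite addr0 -expRD -mulrDr; congr (expR (_ * _)).
    rewrite big_mkord (bigD1 (Ordinal il))//= addrC; congr (_ + _).
      rewrite big_mkord; apply: eq_big => // i; rewrite -val_eqE/= => ine.
      by rewrite /upd xpair_eqE (negbTE ine).
    by rewrite /upd eqxx.
  + exists (0, expR (beta * \sum_(0 <= i < l) x i 0%N)); split=> /=;
      [by []|exact: expR_ge0|move=> v].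
    rewrite mul0r add0r; congr (expR (_ * _)); apply: eq_big_nat => i /andP[_ il].
    rewrite /upd xpair_eqE; case: eqP => //= ii; case: eqP => // kk.
    by move: h; rewrite -ii il -kk eqxx.
- elim: l => [|l [[U V] [/= U0 V0 UV]]]; first exact: IHk.
  have [[U' V'] [/= U'0 V'0 UV']] := IHk l.+1.
  have [/andP[/eqP il /eqP kk]|h] := boolP ((i0 == l) && (k0 == k.+1)).
  + exists (zpp beta x k.+1 l + U', V').
    split=> /=; [|exact: V'0|move=> v].
      by rewrite addr_ge0// ltW// (zpp_gt0 beta x k.+1).
    rewrite UV' /upd -il -kk eqxx mulrDl addrA; congr (_ * _ + _ + _).
    have := @eq_zpp beta (upd x (l, k.+1) v) x k.+1 l; rewrite -/(zpp _ _ k.+1) /=.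
    rewrite -il -kk; apply => i j il' _.
    by rewrite /upd xpair_eqE; move: il'; case: eqP => // ->; rewrite il ltnn.
  + exists (U * expR (beta * x l k.+1) + U', V * expR (beta * x l k.+1) + V').
    split=> [||v] /=; first by rewrite addr_ge0// mulr_ge0// expR_ge0.
      by rewrite addr_ge0// mulr_ge0// expR_ge0.
    rewrite UV' UV /upd xpair_eqE eq_sym (eq_sym k.+1) (negbTE h).
    by ring.
Qed.

End last_passage_recursion.

Section lindeberg_replacement.
Context {R : realType}.
Variables (n N m : nat) (beta lam mu e : R).
Hypotheses (beta0 : 0 < beta) (e0 : 0 < e).
Implicit Types (x : nat -> nat -> R) (c : nat * nat) (s : seq (nat * nat)).

Definition zpp_centered x := zpp beta x n N * expR (- (beta * \sum_(0 <= i < m) x i 0%N)).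
Definition soft_moment x := expR (lam / beta * ln (zpp_centered x)).
Definition lpp_centered x := lpp x n N - \sum_(0 <= i < m) x i 0%N.
Definition hard_moment x := expR (lam * lpp_centered x).

Lemma zpp_centered_gt0 x : 0 < zpp_centered x.
Proof. by rewrite mulr_gt0 ?expR_gt0// zpp_gt0. Qed.

Lemma hard_le_soft x : 0 <= lam -> hard_moment x <= soft_moment x.
Proof.
move=> lam0; rewrite ler_expR -mulrA ler_wpM2l// mulrC ler_pdivlMr//.
rewrite -(expRK (lpp_centered x * beta)).
rewrite ler_ln ?posrE ?expR_gt0 ?zpp_centered_gt0//.
rewrite /lpp_centered /zpp_centered mulrC mulrBr expRD.
by rewrite ler_wpM2r ?expR_ge0// le_zpp// ltW.
Qed.

Lemma soft_le_hard x : 0 <= lam ->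
  soft_moment x <= expR (lam / beta * ln ((N.+1 ^ n)%:R)) * hard_moment x.
Proof.
move=> lam0; have N0 : 0 < (N.+1 ^ n)%:R :> R by rewrite ltr0n expn_gt0.
rewrite /soft_moment /hard_moment -expRD ler_expR.
rewrite -[X in _ + X](_ : lam / beta * (beta * lpp_centered x) = _); last first.
  by rewrite mulrA divfK// gt_eqF.
rewrite -mulrDr ler_wpM2l ?divr_ge0// ?(ltW beta0)//.
rewrite -(expRK (beta * _)) -lnM ?posrE ?expR_gt0//.
rewrite ler_ln ?posrE ?mulr_gt0 ?expR_gt0 ?zpp_centered_gt0 ?zpp_gt0//.
rewrite /zpp_centered /lpp_centered mulrBr expRD mulrA.
by rewrite ler_wpM2r ?expR_ge0// zpp_le// ltW.
Qed.

(** For a bottom cell before time 0 the centering divides by exp(beta v), so the two coefficients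
    exchange roles and the exponent becomes [- beta]. This is why only the absolute value of the
    exponent is fixed. *)
Lemma zpp_centered_affine x c : exists bUV : R * R * R,
  [/\ `|bUV.1.1| = beta, 0 <= bUV.1.2, 0 <= bUV.2, 0 < bUV.1.2 + bUV.2 &
  forall v, zpp_centered (upd x c v) = affexp bUV.1.2 bUV.2 bUV.1.1 v].
Proof.
have [[U V] [/= U0 V0 UV]] := zpp_affine beta x c n N.
have UV0 : 0 < U + V.
  have := zpp_gt0 beta (upd x c 0) n N; rewrite UV mulr0 expR0 mulr1.
  by [].
have [h|h] := boolP ((c.1 < m)%N && (c.2 == 0%N)).
- case: c h UV => i0 k0 /= /andP[im /eqP ->] UV.
  pose K := expR (- (beta * \sum_(0 <= i < m | i != i0) x i 0%N)).
  have K0 : 0 < K := expR_gt0 _.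
  exists (- beta, V * K, U * K); split=> /=.
  + by rewrite normrN gtr0_norm.
  + by rewrite mulr_ge0// ltW.
  + by rewrite mulr_ge0// ltW.
  + by rewrite -mulrDl mulr_gt0// addrC.
  + move=> v; rewrite /zpp_centered UV /affexp.
    have -> : \sum_(0 <= i < m) upd x (i0, 0%N) v i 0 =
        v + \sum_(0 <= i < m | i != i0) x i 0%N.
      rewrite big_mkord (bigD1 (Ordinal im))//= {1}/upd eqxx; congr (_ + _).
      rewrite big_mkord; apply: eq_big => // i; rewrite -val_eqE/= => ine.
      by rewrite /upd xpair_eqE (negbTE ine).
    rewrite mulrDr opprD expRD -/K mulNr.
    have := expRxMexpNx_1 (beta * v); move: (expR (beta * v)) (expR (- (beta * v))).
    move=> E E' EE; transitivity (V * K * E' + U * K * (E * E')); first by ring.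
    by rewrite EE mulr1.
- pose K := expR (- (beta * \sum_(0 <= i < m) x i 0%N)).
  have K0 : 0 < K := expR_gt0 _.
  exists (beta, U * K, V * K); split=> /=.
  + by rewrite gtr0_norm.
  + by rewrite mulr_ge0// ltW.
  + by rewrite mulr_ge0// ltW.
  + by rewrite -mulrDl mulr_gt0.
  + move=> v; rewrite /zpp_centered UV /affexp.
    have -> : \sum_(0 <= i < m) upd x c v i 0 = \sum_(0 <= i < m) x i 0%N.
      apply: eq_big_nat => i /andP[_ im]; rewrite /upd; case: eqP => // ic.
      by move: h; rewrite -ic /= im.
    by rewrite -/K; ring.
Qed.

Lemma measurable_soft_moment d (S : measurableType d) (X : nat -> nat -> S -> R) :
  (forall l k, measurable_fun setT (X l k)) ->
  measurable_fun setT (fun w => soft_moment (fun l k => X l k w)).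
Proof.
move=> mX; apply: measurableT_comp => //; apply: measurable_funM => //.
apply: measurableT_comp => //; apply: measurable_funM.
  elim: n (N) => [|k IHk] l /=.
    apply: measurableT_comp => //; apply: measurable_funM => //.
    by apply: measurable_sum.
  elim: l => [|l IHl]; first exact: IHk.
  apply: measurable_funD => //; apply: measurable_funM => //.
  by apply: measurableT_comp => //; exact: measurable_funM.
apply: measurableT_comp => //; apply: measurableT_comp => //.
by apply: measurable_funM => //; exact: measurable_sum.
Qed.

Lemma measurable_hard_moment d (S : measurableType d) (X : nat -> nat -> S -> R) :
  (forall l k, measurable_fun setT (X l k)) ->
  measurable_fun setT (fun w => hard_moment (fun l k => X l k w)).
Proof.
move=> mX; apply: measurableT_comp => //; apply: measurable_funM => //.
apply: measurable_funB; last exact: measurable_sum.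
elim: n (N) => [|k IHk] l /=; first exact: measurable_sum.
elim: l => [|l IHl]; first exact: IHk.
apply: measurable_maxr => //; exact: measurable_funD.
Qed.

Definition drift c : R := if c.2 == 0%N then mu else 0.
(** The bottom level contributes mu s_0 - B_0(s_0), hence drift and reversed sign there; the other
    levels carry plain Brownian increments. *)
Definition sgn0 c : R := if c.2 == 0%N then -1 else 1.
Definition step_prob c : R := prob (expR (- (2 * (drift c * e)))).

Fixpoint walk_mean s (F : (nat -> nat -> R) -> R) x : R :=
  if s is c :: s' then
    bernoulli_mean (step_prob c) e (fun v => walk_mean s' F (upd x c v))
  else F x.

Lemma step_prob01 c : 0 <= step_prob c <= 1.
Proof. exact: prob01 (expR_ge0 _). Qed.

Lemma le_walk_mean s (F G : (nat -> nat -> R) -> R) x : (forall x, F x <= G x) ->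
  walk_mean s F x <= walk_mean s G x.
Proof.
move=> FG; elim: s x => [//|c s IH] x /=; have /andP[p0 p1] := step_prob01 c.
by rewrite /bernoulli_mean lerD// ler_wpM2l ?subr_ge0 ?IH.
Qed.

Lemma walk_meanZ s (K : R) F x :
  walk_mean s (fun x => K * F x) x = K * walk_mean s F x.
Proof.
elim: s x => [//|c s IH] x /=; rewrite /bernoulli_mean !IH.
by ring.
Qed.

Section randomised.
Context d (T : measurableType d) (P : probability T R).
Variable Y : nat * nat -> T -> R.
Hypothesis mY : forall c, measurable_fun setT (Y c).
Hypothesis lawY : forall c A, measurable A -> P (Y c @^-1` A) = normal_prob 0 e A.

Definition rectangle s (A : nat * nat -> set R) : set T :=
  \bigcap_(c in [set` s]) (Y c @^-1` A c).

Definition independent_family s := forall A : nat * nat -> set R,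
  (forall c, measurable (A c)) ->
  P (rectangle s A) = (\prod_(c <- s) P (Y c @^-1` A c))%E.

(** The hybrid environment of Lindeberg's method: Gaussian on the cells of [s], the prescribed
    values of [x] elsewhere. *)
Definition noisy s x (w : T) : nat -> nat -> R := fun l k =>
  if (l, k) \in s then drift (l, k) * e ^+ 2 + sgn0 (l, k) * Y (l, k) w else x l k.

Lemma noisy_upd s x c v w : c \notin s ->
  noisy s (upd x c v) w = upd (noisy s x w) c v.
Proof.
move=> cs; apply/funext => l; apply/funext => k; rewrite /noisy /upd.
by case: ifPn => // h; case: eqP => // ce; move: cs; rewrite -ce h.
Qed.

Lemma noisy_cons c s x w : c \notin s ->
  noisy (c :: s) x w = noisy s (upd x c (drift c * e ^+ 2 + sgn0 c * Y c w)) w.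
Proof.
move=> cs; apply/funext => l; apply/funext => k; rewrite /noisy /upd in_cons.
case: (eqVneq (l, k) c) => [->|h] /=; first by rewrite (negbTE cs).
by [].
Qed.

Let preY c A : measurable A -> measurable (Y c @^-1` A).
Proof. by move=> mA; rewrite -[X in measurable X]setTI; exact: mY. Qed.

Lemma rectangle_cons c s A :
  rectangle (c :: s) A = Y c @^-1` A c `&` rectangle s A.
Proof.
rewrite /rectangle; apply/seteqP; split => w.
  move=> h; split; first by apply: h; rewrite /= mem_head.
  by move=> c' /= c's; apply: h; rewrite /= in_cons c's orbT.
move=> [h1 h2] c' /=; rewrite in_cons => /orP[/eqP ->//|]; exact: h2.
Qed.

Lemma measurable_rectangle s A : (forall c, measurable (A c)) ->
  measurable (rectangle s A).
Proof.
move=> mA; elim: s => [|c s IH].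
  by rewrite /rectangle (_ : [set` [::]] = set0) ?bigcap_set0//; apply/seteqP; split.
by rewrite rectangle_cons; apply: measurableI => //; exact: preY.
Qed.

Lemma independent_cons c s : c \notin s -> independent_family (c :: s) ->
  independent_family s /\
  forall A B, (forall c', measurable (A c')) -> measurable B ->
    P (Y c @^-1` B `&` rectangle s A) = (P (Y c @^-1` B) * P (rectangle s A))%E.
Proof.
move=> cs ind.
pose ext (A : nat * nat -> set R) B c' := if c' == c then B else A c'.
have mext A B : (forall c', measurable (A c')) -> measurable B ->
    forall c', measurable (ext A B c').
  by move=> mA mB c'; rewrite /ext; case: ifP.
have exts A B : rectangle s (ext A B) = rectangle s A.
  apply: eq_bigcapr => c' /= c's; rewrite /ext; case: eqP => // ce.
  by move: cs; rewrite -ce c's.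
have extp A B : (\prod_(c' <- s) P (Y c' @^-1` ext A B c') =
    \prod_(c' <- s) P (Y c' @^-1` A c'))%E.
  rewrite big_seq [RHS]big_seq; apply: eq_bigr => c' c's; rewrite /ext; case: eqP => // ce.
  by move: cs; rewrite -ce c's.
have key A B : (forall c', measurable (A c')) -> measurable B ->
    P (Y c @^-1` B `&` rectangle s A) =
    (P (Y c @^-1` B) * \prod_(c' <- s) P (Y c' @^-1` A c'))%E.
  move=> mA mB; have := ind _ (mext A B mA mB).
  by rewrite rectangle_cons exts big_cons extp {1 2}/ext eqxx.
have inds : independent_family s.
  move=> A mA; have := key A setT mA measurableT.
  by rewrite preimage_setT setTI probability_setT mul1e.
by split=> // A B mA mB; rewrite key// inds.
Qed.

Definition rectangles s : set (set T) :=
  [set E | exists2 A, (forall c, measurable (A c)) & E = rectangle s A].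

Lemma rectanglesI s : setI_closed (rectangles s).
Proof.
move=> _ _ [A mA ->] [B mB ->]; exists (fun c => A c `&` B c).
  by move=> c; exact: measurableI.
by rewrite /rectangle -bigcapI.
Qed.

Lemma rectanglesT s : rectangles s setT.
Proof.
exists (fun=> setT) => //; rewrite /rectangle; apply/seteqP; split => // w _ c _.
Qed.

Lemma measurable_rectangles s c : c \in s ->
  measurable_fun setT (Y c : g_sigma_algebraType (rectangles s) -> R).
Proof.
move=> cs _ B mB; rewrite setTI; apply: sub_sigma_algebra.
exists (fun c' => if c' == c then B else setT); first by move=> c'; case: ifP.
rewrite /rectangle; apply/seteqP; split => w /=.
  by move=> h c' /=; case: eqP => [->//|].
by move=> /(_ c cs); rewrite eqxx.
Qed.

Variable eta : R.
Hypotheses (eta0 : 0 <= eta) (eta1 : eta <= 1).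
Hypothesis swap : forall c (U V b : R), 0 <= U -> 0 <= V -> 0 < U + V -> `|b| = beta ->
  swap_bounds (drift c) e (sgn0 c) eta (smoothed U V (lam / beta) b).

Let measurable_soft_noisy s x :
  measurable_fun setT (fun w => soft_moment (noisy s x w)).
Proof.
apply: measurable_soft_moment => l k; rewrite /noisy; case: ((l, k) \in s) => //.
by apply: measurable_funD => //; apply: measurable_funM => //; exact: mY.
Qed.

Lemma measurable_hard_noisy s x :
  measurable_fun setT (fun w => hard_moment (noisy s x w)).
Proof.
apply: measurable_hard_moment => l k; rewrite /noisy; case: ((l, k) \in s) => //.
by apply: measurable_funD => //; apply: measurable_funM => //; exact: mY.
Qed.

Lemma soft_moment_upd x c : exists bUV : R * R * R,
  [/\ `|bUV.1.1| = beta, 0 <= bUV.1.2, 0 <= bUV.2, 0 < bUV.1.2 + bUV.2 &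
  forall v, soft_moment (upd x c v) = smoothed bUV.1.2 bUV.2 (lam / beta) bUV.1.1 v].
Proof.
have [bUV [h1 h2 h3 h4 h]] := zpp_centered_affine x c; exists bUV; split=> // v.
by rewrite /soft_moment h.
Qed.

Lemma integral_soft_cons c s x : c \notin s -> independent_family (c :: s) ->
  (\int[P]_w (soft_moment (noisy (c :: s) x w))%:E =
   \int[P]_w \int[normal_prob 0 e]_y
     (soft_moment (upd (noisy s x w) c (drift c * e ^+ 2 + sgn0 c * y)))%:E)%E.
Proof.
move=> cs ind; have [inds indc] := independent_cons cs ind.
pose Psi (z : measurableTypeR R * g_sigma_algebraType (rectangles s)) : \bar R :=
  (soft_moment (noisy s (upd x c (drift c * e ^+ 2 + sgn0 c * z.1)) z.2))%:E.
have mPsi : measurable_fun setT Psi.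
  apply/measurable_EFinP; apply: measurable_soft_moment => l k.
  rewrite /noisy; case: (boolP ((l, k) \in s)) => [lks|_].
    apply: measurable_funD => //; apply: measurable_funM => //.
    exact: (measurableT_comp (measurable_rectangles lks)).
  rewrite /upd; case: ((l, k) == c) => //.
  by apply: measurable_funD => //; exact: measurable_funM.
transitivity (\int[P]_w Psi (Y c w, w))%E.
  by apply: eq_integral => w _; rewrite /Psi noisy_cons.
transitivity (\int[P]_w \int[normal_prob 0 e]_y Psi (y, w))%E; last first.
  apply: eq_integral => w _; apply: eq_integral => y _.
  by rewrite /Psi /= noisy_upd.
apply: (@decoupling _ _ _ P (normal_prob 0 e) (Y c) (rectangles s) Psi).
- exact: mY.
- by move=> A mA; exact: lawY.
- by move=> _ [A mA ->]; exact: measurable_rectangle.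
- exact: rectanglesI.
- exact: rectanglesT.
- by move=> A _ mA [B mB ->]; exact: indc.
- exact: mPsi.
- by move=> z; rewrite lee_fin expR_ge0.
Qed.

Lemma integral_bernoulli_soft c s x : c \notin s ->
  (\int[P]_w (bernoulli_mean (step_prob c) e
     (fun v => soft_moment (upd (noisy s x w) c v)))%:E =
   (step_prob c)%:E * \int[P]_w (soft_moment (noisy s (upd x c (- e)) w))%:E +
   (1 - step_prob c)%:E * \int[P]_w (soft_moment (noisy s (upd x c e) w))%:E)%E.
Proof.
move=> cs; pose f v w := soft_moment (noisy s (upd x c v) w).
have f0 v w : 0 <= f v w by exact: expR_ge0.
have mf v : measurable_fun setT (f v) by exact: measurable_soft_noisy.
rewrite -(@ge0_integral_convex _ _ _ P _ _ _ (step_prob01 c) (f0 _) (f0 _) (mf _) (mf _)).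
by apply: eq_integral => w _; rewrite /bernoulli_mean -!noisy_upd.
Qed.

(** Cell [c] is integrated first with the others frozen, where [swap] applies. Its two Bernoulli
    values are then written into [x], and the induction hypothesis handles the remaining cells; the
    relative errors multiply. *)
Lemma soft_moment_swap s x : uniq s -> independent_family s ->
  (((1 - eta) ^+ size s * walk_mean s soft_moment x)%:E <=
   \int[P]_w (soft_moment (noisy s x w))%:E)%E /\
  (\int[P]_w (soft_moment (noisy s x w))%:E <=
   ((1 + eta) ^+ size s * walk_mean s soft_moment x)%:E)%E.
Proof.
elim: s x => [|c s IH] x.
  move=> _ _; rewrite !expr0 !mul1r /=.
  rewrite (eq_integral (cst (soft_moment x)%:E)).
    by rewrite integral_cst// [X in (_ * X)%E]probability_setT mule1.
  by move=> w _; congr (soft_moment _)%:E.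
rewrite cons_uniq => /andP[cs us] ind.
have [inds _] := independent_cons cs ind.
have /andP[p0 p1] := step_prob01 c.
rewrite integral_soft_cons//.
have mb : measurable_fun setT (fun w => (bernoulli_mean (step_prob c) e
     (fun v => soft_moment (upd (noisy s x w) c v)))%:E).
  apply/measurable_EFinP; rewrite /bernoulli_mean.
  under eq_fun do rewrite -!noisy_upd//.
  by apply: measurable_funD; apply: measurable_funM => //.
have b0 w : 0 <= bernoulli_mean (step_prob c) e
     (fun v => soft_moment (upd (noisy s x w) c v)).
  by rewrite /bernoulli_mean addr_ge0// mulr_ge0 ?expR_ge0// subr_ge0.
have sw w : swap_bounds (drift c) e (sgn0 c) eta
    (fun v => soft_moment (upd (noisy s x w) c v)).
  have [bUV [h1 h2 h3 h4 h]] := soft_moment_upd (noisy s x w) c.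
  have -> : (fun v => soft_moment (upd (noisy s x w) c v)) =
            smoothed bUV.1.2 bUV.2 (lam / beta) bUV.1.1 by apply/funext.
  exact: swap.
have [lo1 up1] := IH (upd x c (- e)) us inds.
have [lo2 up2] := IH (upd x c e) us inds.
have p0E : (0 <= (step_prob c)%:E)%E by rewrite lee_fin.
have q0E : (0 <= (1 - step_prob c)%:E)%E by rewrite lee_fin subr_ge0.
have bE (K A B : R) : (K%:E * ((step_prob c)%:E * A%:E + (1 - step_prob c)%:E * B%:E))%E =
  (K * (step_prob c * A + (1 - step_prob c) * B))%:E by [].
have Zb (K : R) : 0 <= K -> (\int[P]_w (K%:E * (bernoulli_mean (step_prob c) e
     (fun v => soft_moment (upd (noisy s x w) c v)))%:E) =
     K%:E * ((step_prob c)%:E * \int[P]_w (soft_moment (noisy s (upd x c (- e)) w))%:E +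
   (1 - step_prob c)%:E * \int[P]_w (soft_moment (noisy s (upd x c e) w))%:E))%E.
  move=> K0; rewrite -integral_bernoulli_soft// ge0_integralZl_EFin//.
  by move=> w _; rewrite lee_fin.
split.
- apply: (@le_trans _ _ (\int[P]_w ((1 - eta)%:E * (bernoulli_mean (step_prob c) e
     (fun v => soft_moment (upd (noisy s x w) c v)))%:E)%E)%E); last first.
    by apply: ge0_le_integralT => w; [rewrite -EFinM lee_fin mulr_ge0 ?subr_ge0|case: (sw w)].
  rewrite Zb ?subr_ge0//.
  apply: (@le_trans _ _ ((1 - eta)%:E * ((step_prob c)%:E *
     ((1 - eta) ^+ size s * walk_mean s soft_moment (upd x c (- e)))%:E +
     (1 - step_prob c)%:E *
     ((1 - eta) ^+ size s * walk_mean s soft_moment (upd x c e))%:E))%E).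
    rewrite bE lee_fin le_eqVlt; apply/orP; left; apply/eqP => /=.
    by rewrite /bernoulli_mean exprS; ring.
  rewrite lee_wpmul2l ?lee_fin ?subr_ge0//.
  exact: (leeD (lee_wpmul2l p0E lo1) (lee_wpmul2l q0E lo2)).
- apply: (@le_trans _ _ (\int[P]_w ((1 + eta)%:E * (bernoulli_mean (step_prob c) e
     (fun v => soft_moment (upd (noisy s x w) c v)))%:E)%E)%E).
    apply: ge0_le_integralT => w; last by case: (sw w).
    by apply: integral_ge0 => y _; rewrite lee_fin expR_ge0.
  rewrite Zb ?addr_ge0//.
  apply: (@le_trans _ _ ((1 + eta)%:E * ((step_prob c)%:E *
     ((1 + eta) ^+ size s * walk_mean s soft_moment (upd x c (- e)))%:E +
     (1 - step_prob c)%:E *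
     ((1 + eta) ^+ size s * walk_mean s soft_moment (upd x c e))%:E))%E); last first.
    rewrite bE lee_fin le_eqVlt; apply/orP; left; apply/eqP => /=.
    by rewrite /bernoulli_mean exprS; ring.
  rewrite lee_wpmul2l ?lee_fin ?addr_ge0//.
  exact: (leeD (lee_wpmul2l p0E up1) (lee_wpmul2l q0E up2)).
Qed.

(** Each direction pays the number of paths once: on the Gaussian side for the lower bound, on the
    walk side for the upper one. *)
Lemma hard_moment_swap s x : 0 <= lam -> uniq s -> independent_family s ->
  (((1 - eta) ^+ size s * walk_mean s hard_moment x)%:E <=
   (expR (lam / beta * ln ((N.+1 ^ n)%:R)))%:E *
   \int[P]_w (hard_moment (noisy s x w))%:E)%E /\
  (\int[P]_w (hard_moment (noisy s x w))%:E <=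
   ((1 + eta) ^+ size s * expR (lam / beta * ln ((N.+1 ^ n)%:R)) *
    walk_mean s hard_moment x)%:E)%E.
Proof.
move=> lam0 us ind; have [lo up] := soft_moment_swap x us ind; split.
- apply: (@le_trans _ _ ((1 - eta) ^+ size s * walk_mean s soft_moment x)%:E).
    rewrite lee_fin ler_wpM2l ?exprn_ge0 ?subr_ge0// le_walk_mean// => y.
    exact: hard_le_soft.
  apply: (le_trans lo); rewrite -ge0_integralZl_EFin ?expR_ge0//; last 2 first.
  + by move=> w _; rewrite lee_fin expR_ge0.
  + by apply/measurable_EFinP; exact: measurable_hard_noisy.
  apply: ge0_le_integralT => w; first by rewrite lee_fin expR_ge0.
  by rewrite -EFinM lee_fin soft_le_hard.
- apply: (@le_trans _ _ ((1 + eta) ^+ size s * walk_mean s soft_moment x)%:E); last first.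
    rewrite lee_fin -(mulrA (_ ^+ _)) -(walk_meanZ _ (expR _)) ler_wpM2l// ?exprn_ge0 ?addr_ge0//.
    by apply: le_walk_mean => y; exact: soft_le_hard.
  apply: le_trans up; apply: ge0_le_integralT => w; rewrite lee_fin ?expR_ge0//.
  exact: hard_le_soft.
Qed.

End randomised.
End lindeberg_replacement.

(** * Averaging over the cells column by column gives the queueing dynamics *)

Section random_walk_recursion.
Context {R : realType}.
Implicit Types (x : nat -> nat -> R) (k l i r : nat) (s : seq (nat * nat)).

Lemma eq_lpp x x' k l :
  (forall i j, (i < l)%N -> (j <= k)%N -> x i j = x' i j) ->
  lpp x k l = lpp x' k l.
Proof.
elim: k l => [|k IHk] l H /=.
  by apply: eq_big_nat => i /andP[_ il]; exact: H.
elim: l H => [|l IHl] H; first by apply: IHk => i j il jk; apply: H => //; exact: ltnW.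
rewrite IHl; last by move=> i j il jk; apply: H => //; exact: ltnW.
by rewrite H// (IHk l.+1)// => i j il jk; apply: H => //; exact: ltnW.
Qed.

Lemma eq_hard_moment n N m lam x x' : (m <= N)%N ->
  (forall i j, (i < N)%N -> (j <= n)%N -> x i j = x' i j) ->
  hard_moment n N m lam x = hard_moment n N m lam x'.
Proof.
move=> mN H; rewrite /hard_moment /lpp_centered (eq_lpp H).
by under eq_big_nat => i /andP[_ im] do rewrite H ?(leq_trans im)//.
Qed.

Lemma lppS x k l :
  lpp x k.+1 l.+1 = Num.max (lpp x k.+1 l + x l k.+1) (lpp x k l.+1).
Proof. by []. Qed.

Lemma lpp0 x k : lpp x k 0 = 0.
Proof. by elim: k => //=; rewrite big_geq. Qed.

Variables (n N m : nat) (lam mu e : R).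

Local Notation p := (step_prob mu e (0%N, 0%N)).
Local Notation walk_mean := (walk_mean mu e).

Definition row x l := [seq lpp x j l | j <- iota 1 n].
Definition cells_at l := [seq (l, j) | j <- iota 0 n.+1].
Definition cells_from l r := flatten [seq cells_at i | i <- iota l r].

Lemma cells_fromS l r : cells_from l r.+1 = cells_at l ++ cells_from l.+1 r.
Proof. by []. Qed.

(** The hypothesis ranges over all environments agreeing with [x] on the cells already read, because
    the rest is still to be overwritten; the passage times in question depend only on those
    cells. *)
Lemma walk_mean_levX l k r s F x (K : seq R -> \bar R) :
  (forall x', (forall i j, (i < l)%N || (i == l) && (j <= k)%N -> x' i j = x i j) ->
     (walk_mean s F x')%:E = K [seq lpp x' j l.+1 | j <- iota k.+1 r]) ->
  (walk_mean ([seq (l, j) | j <- iota k.+1 r] ++ s) F x)%:E =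
  levX e (lpp x k l.+1) [seq lpp x j l | j <- iota k.+1 r] K.
Proof.
elim: r k x K => [|r IH] k x K H; first exact: (H x).
have half : step_prob mu e (l, k.+1) = 2^-1.
  by rewrite /step_prob /drift /= mul0r mulr0 oppr0 expR0 /prob div1r.
have agree v : forall i j, (i < l)%N || (i == l) && (j <= k)%N ->
    upd x (l, k.+1) v i j = x i j.
  move=> i j ij; rewrite /upd xpair_eqE; case: (eqVneq i l) ij => //= il.
  by rewrite il ltnn /= => jk; case: eqP => // jE; move: jk; rewrite jE ltnn.
rewrite /= /bernoulli_mean half EFinD !EFinM; set A := _ ++ s.
have st v : (walk_mean A F (upd x (l, k.+1) v))%:E =
    levX e (Num.max (lpp x k.+1 l + v) (lpp x k l.+1)) [seq lpp x j l | j <- iota k.+2 r]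
     (fun ys => K (Num.max (lpp x k.+1 l + v) (lpp x k l.+1) :: ys)).
  have lv : lpp (upd x (l, k.+1) v) k.+1 l.+1 =
      Num.max (lpp x k.+1 l + v) (lpp x k l.+1).
    rewrite lppS {2}/upd eqxx; congr (Num.max (_ + _) _).
      apply: (@eq_lpp _ _ k.+1) => i j il jk; rewrite /upd xpair_eqE.
      by rewrite (ltn_eqF il).
    apply: eq_lpp => i j il jk; apply: agree.
    by rewrite jk andbT orbC -leq_eqVlt.
  rewrite -lv (IH k.+1 _ (fun ys => K (lpp (upd x (l, k.+1) v) k.+1 l.+1 :: ys))).
    congr (levX _ _ _ _); apply: eq_map => j; apply: eq_lpp => i j' il _.
    by rewrite /upd xpair_eqE (ltn_eqF il).
  move=> x' x'E; have lpE : lpp x' k.+1 l.+1 = lpp (upd x (l, k.+1) v) k.+1 l.+1.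
    by apply: eq_lpp => i j il jk; apply: x'E; rewrite jk andbT orbC -leq_eqVlt.
  rewrite H; first by rewrite -lpE.
  move=> i j ij; rewrite x'E ?agree//.
  by case/orP: ij => [->//|/andP[-> jk]]; rewrite (leqW jk) orbT.
by rewrite !st.
Qed.

Lemma walk_mean_stepX l s F x (h : R -> seq R -> \bar R) :
  (forall x', (forall i j, (i < l)%N -> x' i j = x i j) ->
     (walk_mean s F x')%:E = h (lpp x' 0 l.+1) (row x' l.+1)) ->
  (walk_mean (cells_at l ++ s) F x)%:E = stepX e p h (lpp x 0 l) (row x l).
Proof.
move=> H; rewrite /= /bernoulli_mean EFinD !EFinM.
have st v : (walk_mean ([seq (l, j) | j <- iota 1 n] ++ s) F (upd x (l, 0%N) v))%:E =
    levX e (lpp x 0 l + v) (row x l) (h (lpp x 0 l + v)).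
  have old i j : (i < l)%N -> upd x (l, 0%N) v i j = x i j.
    by move=> il; rewrite /upd xpair_eqE (ltn_eqF il).
  have lv : lpp (upd x (l, 0%N) v) 0 l.+1 = lpp x 0 l + v.
    rewrite /= big_nat_recr//= {2}/upd eqxx; congr (_ + _).
    by apply: eq_big_nat => i /andP[_ il]; rewrite old.
  rewrite -lv (@walk_mean_levX _ _ _ _ _ _ (h (lpp (upd x (l, 0%N) v) 0 l.+1))).
    by congr (levX _ _ _ _); apply: eq_map => j; apply: eq_lpp => i j' il _; exact: old.
  move=> x' x'E; rewrite H.
    congr (h _ _); apply: eq_lpp => i j il; rewrite leqn0 => /eqP ->.
    by apply: x'E; rewrite andbT orbC -leq_eqVlt.
  by move=> i j il; rewrite x'E ?il// old.
by rewrite !st.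
Qed.

Lemma levXZ (eps u : R) xs (c : R) (k : seq R -> \bar R) : (forall ys, 0 <= k ys)%E ->
  levX eps u xs (fun ys => c%:E * k ys)%E = (c%:E * levX eps u xs k)%E.
Proof.
have h01 : 0 <= (2^-1 : R) <= 1 by lra.
elim: xs u k => [//|x xs IH] u k k0 /=.
by rewrite !IH// mixZ// levX_ge0.
Qed.

Lemma stepXZ (eps q c : R) h y ys : 0 <= q <= 1 -> (forall z zs, 0 <= h z zs)%E ->
  stepX eps q (fun z zs => c%:E * h z zs)%E y ys = (c%:E * stepX eps q h y ys)%E.
Proof. by move=> q01 h0; rewrite /stepX !levXZ// mixZ// levX_ge0. Qed.

Let p01 : 0 <= p <= 1. Proof. exact: step_prob01. Qed.

Lemma last_row x l : last (lpp x 0 l) (row x l) = lpp x n l.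
Proof.
rewrite /row (last_map (fun j => lpp x j l) (iota 1 n) 0%N).
by case: n => // k; rewrite -nth_last size_iota nth_iota.
Qed.

Lemma walk_mean_iter_expX l r x : (m <= l)%N -> (l + r = N)%N ->
  (walk_mean (cells_from l r) (hard_moment n N m lam) x)%:E =
  ((expR (- (lam * \sum_(0 <= i < m) x i 0%N)))%:E *
   iter r (stepX e p) (expX lam) (lpp x 0 l) (row x l))%E.
Proof.
elim: r l x => [|r IH] l x ml lr.
  rewrite -EFinM last_row -expRD -lr addn0 /=; congr (expR _)%:E.
  by rewrite /lpp_centered; ring.
rewrite cells_fromS (@walk_mean_stepX _ _ _ _ (fun y ys =>
  ((expR (- (lam * \sum_(0 <= i < m) x i 0%N)))%:E *
   iter r (stepX e p) (expX lam) y ys)%E)).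
  by rewrite stepXZ//; apply: iter_stepX_ge0 => // *; exact: expX_ge0.
move=> x' x'E; rewrite IH; last 2 first.
- exact: leqW.
- by rewrite addSnnS.
congr ((expR (- (_ * _)))%:E * _)%E; apply: eq_big_nat => i /andP[_ im].
by apply: x'E; exact: leq_trans ml.
Qed.

(** At column [m] the subtracted bottom sum is [lpp x 0 m], the current bottom position, which is
    exactly what [centered] removes; later columns leave it unchanged. *)
Lemma walk_mean_iter_centered l r x : (l + r = m)%N -> (m <= N)%N ->
  (walk_mean (cells_from l (N - l)) (hard_moment n N m lam) x)%:E =
  iter r (stepX e p) (centered e lam (N - m) p) (lpp x 0 l) (row x l).
Proof.
elim: r l x => [|r IH] l x lr mN.
  move: lr; rewrite addn0 => lm.
  by rewrite walk_mean_iter_expX ?lm// subnKC.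
have lN : (l < N)%N by apply: leq_trans mN; rewrite -lr addnS ltnS leq_addr.
rewrite -(subnSK lN) [cells_from _ _]/= (@walk_mean_stepX _ _ _ _
  (iter r (stepX e p) (centered e lam (N - m) p))) => // x' x'E.
by rewrite IH// addSnnS.
Qed.

Lemma walk_momentE : (m <= N)%N ->
  (walk_mean (cells_from 0 N) (hard_moment n N m lam) (fun _ _ => 0))%:E =
  walk_moment e lam n (N - m) m (expR (- (2 * (mu * e)))).
Proof.
move=> mN; have := @walk_mean_iter_centered 0 m (fun _ _ => 0) erefl mN.
rewrite subn0 => ->; rewrite /walk_moment lpp0; congr (iter _ _ _ _ _).
rewrite /row; elim: n 1%N => //= k IH j; by rewrite lpp0 IH.
Qed.

Lemma mem_cells_from l r i j :
  ((i, j) \in cells_from l r) = (l <= i < l + r)%N && (j <= n)%N.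
Proof.
apply/flatten_mapP/idP => [[i']|/andP[ir jn]].
  rewrite mem_iota => i'r /mapP[j' +] [-> ->].
  by rewrite mem_iota add0n ltnS i'r.
exists i; first by rewrite mem_iota.
by apply/mapP; exists j => //; rewrite mem_iota add0n ltnS.
Qed.

Lemma uniq_cells_from l r : uniq (cells_from l r).
Proof.
elim: r l => [//|r IH] l; rewrite cells_fromS cat_uniq IH andbT.
rewrite map_inj_uniq ?iota_uniq/=; last by move=> a b [].
apply/hasPn => -[i j]; rewrite mem_cells_from => /andP[/andP[li _] _].
by apply/negP => /mapP[j' _ [il _]]; rewrite il ltnn in li.
Qed.

Lemma size_cells_from l r : size (cells_from l r) = (r * n.+1)%N.
Proof.
elim: r l => [//|r IH] l; rewrite /cells_from /= -/(cells_from l.+1 r).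
by rewrite size_cat size_map size_iota IH mulSn.
Qed.

End random_walk_recursion.

(** * Brownian paths on a grid *)

Section brownian_increments.
Context d (T : measurableType d) (R : realType) (P : probability T R).
Variable B : nat -> R -> {RV P >-> R}.
Hypothesis hB : iid_two_sided_brownian_motions B.

Lemma increment_process_sigma_algebra k (r t : R) A : measurable A ->
  process_sigma_algebra (B k) (increment (B k) r t @^-1` A).
Proof.
move=> mA; pose G := \bigcup_(t in [set: R]) preimage_set_system setT (B k t) measurable.
have mX t' : measurable_fun setT (B k t' : g_sigma_algebraType G -> R).
  move=> _ C mC; apply: sub_sigma_algebra; exists t' => //.
  by exists C.
have : measurable_fun setT (increment (B k) r t : g_sigma_algebraType G -> R).
  exact: measurable_funB.
by move=> /(_ measurableT A mA); rewrite setTI.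
Qed.

(** Combines the two sources of independence: all conditions on motion [k] form one event [E k] of
    its sigma-algebra, motions are independent of each other, and each [E k] factors over its own
    increments. *)
Lemma independent_increment_grid (u : nat -> R) n N : (forall l, u l < u l.+1) ->
  independent_family P (fun c => increment (B c.2) (u c.1) (u c.1.+1)) (cells_from n 0 N).
Proof.
move=> u_incr A mA; have [bm indep] := hB.
pose Y c := increment (B c.2) (u c.1) (u c.1.+1).
pose E k : set T := \bigcap_(l in [set: 'I_N]) (Y (val l, k) @^-1` A (val l, k)).
pose J := seq_fset tt (iota 0 n.+1).
have memJ k : (k \in J) = (k <= n)%N.
  by rewrite seq_fsetE mem_iota add0n ltnS.
have bigJ (f : nat -> \bar R) : (\prod_(k <- J) f k = \prod_(k <- iota 0 n.+1) f k)%E.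
  apply: perm_big; apply: uniq_perm; [exact: fset_uniq|exact: iota_uniq|].
  by move=> k; rewrite memJ mem_iota add0n ltnS.
have PE k : P (E k) = (\prod_(l < N) P (Y (val l, k) @^-1` A (val l, k)))%E.
  have [_ _ inc _] := bm k.
  have := inc N u (fun l _ => u_incr l) (seq_fset tt (enum 'I_N))
    (fun l => Y (val l, k) @^-1` A (val l, k)).
  have memI l : l \in (seq_fset tt (enum 'I_N)) by rewrite seq_fsetE mem_enum.
  rewrite (_ : \bigcap_(j in _) _ = E k); last first.
    by apply/seteqP; split => w h l _; apply: h => //; exact: memI.
  move=> ->; last by move=> l _; exists (A (val l, k)) => //; rewrite setTI.
  rewrite -big_enum; apply: perm_big; apply: uniq_perm; [exact: fset_uniq|exact: enum_uniq|].
  by move=> l; rewrite memI mem_enum.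
have sE k : process_sigma_algebra (B k) (E k).
  pose G := \bigcup_(t in [set: R]) preimage_set_system setT (B k t) measurable.
  apply: (@fin_bigcap_measurable _ (g_sigma_algebraType G)) => // l _.
  exact: increment_process_sigma_algebra.
have := indep J E (fun k _ => sE k).
rewrite bigJ; under eq_bigr do rewrite PE.
move=> PJ; transitivity (P (\bigcap_(j in [set` J]) E j)).
  rewrite /rectangle; apply: congr1; apply/seteqP; split => w.
    move=> h k /= kJ l _; apply: (h (val l, k)) => /=; rewrite mem_cells_from /=.
    by rewrite add0n ltn_ord -memJ.
  move=> h [l k] /=; rewrite mem_cells_from /= add0n => /andP[lN kn].
  have kJ : k \in J by rewrite memJ.
  exact: (h k kJ (Ordinal lN)).
rewrite PJ exchange_big /cells_from big_flatten big_map.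
rewrite -[in RHS](subn0 N) -/(index_iota 0 N) big_mkord.
apply: eq_bigr => l _.
by rewrite big_map.
Qed.

End brownian_increments.

(** * Lattice paths as step times of Brownian paths *)

Section grid_paths.
Context {R : realType}.
Implicit Types (x : nat -> nat -> R) (a : nat -> nat) (k l n : nat).

Definition path_sum x a n : R :=
  \sum_(0 <= i < a 0%N) x i 0%N +
  \sum_(1 <= k < n.+1) \sum_(a k.-1 <= i < a k) x i k.

Lemma path_sum0 x a : path_sum x a 0 = lpp x 0 (a 0%N).
Proof. by rewrite /path_sum [X in _ + X]big_geq// addr0. Qed.

Lemma path_sumS x a n :
  path_sum x a n.+1 = path_sum x a n + \sum_(a n <= i < a n.+1) x i n.+1.
Proof. by rewrite /path_sum big_nat_recr//= addrA. Qed.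

Lemma lpp_up x k l0 r :
  lpp x k l0 + \sum_(l0 <= i < l0 + r) x i k.+1 <= lpp x k.+1 (l0 + r).
Proof.
elim: r => [|r IH].
  rewrite addn0 big_geq// addr0; case: l0 => [//|l].
  by rewrite lppS le_max lexx orbT.
rewrite addnS big_nat_recr ?leq_addr//= -lppS.
by rewrite lppS le_max addrA lerD2r IH.
Qed.

Lemma path_sum_le x a n : (forall k, (k < n)%N -> (a k <= a k.+1)%N) ->
  path_sum x a n <= lpp x n (a n).
Proof.
elim: n => [|n IH] an; first by rewrite path_sum0.
rewrite path_sumS -(subnKC (an n (ltnSn n))).
apply: le_trans (lpp_up _ _ _ _); rewrite lerD2r.
by apply: IH => k kn; apply: an; exact: ltnW.
Qed.

Lemma path_sum_attained x n l : exists a,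
  [/\ forall k, (k < n)%N -> (a k <= a k.+1)%N, a n = l & lpp x n l = path_sum x a n].
Proof.
elim: n l => [|n IH] l.
  by exists (fun=> l); split=> //; rewrite path_sum0.
have [l0 l0l E] : exists2 l0, (l0 <= l)%N &
    lpp x n.+1 l = lpp x n l0 + \sum_(l0 <= i < l) x i n.+1.
  elim: l => [|l [l0 l0l E]]; first by exists 0%N; rewrite ?big_geq ?addr0.
  rewrite lppS; have [h|h] := leP (lpp x n.+1 l + x l n.+1) (lpp x n l.+1).
    by exists l.+1 => //; rewrite big_geq// addr0.
  by exists l0; [exact: leqW|rewrite E big_nat_recr//= addrA].
have [a [an al pE]] := IH l0.
exists (fun k => if (k <= n)%N then a k else l); split.
- move=> k; rewrite ltnS => kn; rewrite kn; case: (ltnP k n) => [|nk]; first exact: an.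
  by have -> : k = n; [apply/eqP; rewrite eqn_leq nk kn|rewrite al].
- by rewrite ltnn.
rewrite path_sumS leqnn ltnn E pE al; congr (_ + _).
rewrite /path_sum; congr (_ + _); apply: eq_big_nat => k /andP[k1 kn].
by rewrite (leq_trans (leq_pred k)) -ltnS kn.
Qed.

Section energy.
Variables (b : nat -> R -> R) (mu : R).

Definition energy (s : nat -> R) n : R :=
  mu * s 0%N - b 0%N (s 0%N) + \sum_(1 <= j < n.+1) (b j (s j) - b j (s j.-1)).

Lemma energy0 s : energy s 0 = mu * s 0%N - b 0%N (s 0%N).
Proof. by rewrite /energy big_geq// addr0. Qed.

Lemma energyS s n : energy s n.+1 = energy s n + (b n.+1 (s n.+1) - b n.+1 (s n)).
Proof. by rewrite /energy big_nat_recr//= addrA. Qed.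

Lemma energy_cvg (u : nat -> nat -> R) (s : nat -> R) n :
  (forall k, continuous (b k)) ->
  (forall k, (k <= n)%N -> u i k @[i --> \oo] --> s k) ->
  energy (u i) n @[i --> \oo] --> energy s n.
Proof.
move=> cb; elim: n => [|n IH] us.
  rewrite energy0; under eq_fun do rewrite energy0.
  apply: cvgB; first by apply: cvgMr; exact: us.
  by apply: continuous_cvg; [exact: cb|exact: us].
rewrite energyS; under eq_fun do rewrite energyS.
apply: cvgD; first by apply: IH => k kn; apply: us; exact: leqW.
by apply: cvgB; apply: continuous_cvg; (try exact: cb); exact: us.
Qed.

Variables (e : R) (m : nat).

Definition grid_time l : R := (l%:R - m%:R) * e ^+ 2.

Definition grid_env l k : R := drift mu (l, k) * e ^+ 2 +
  sgn0 (l, k) * (b k (grid_time l.+1) - b k (grid_time l)).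

Lemma grid_env_side l0 l k : (0 < k)%N -> (l0 <= l)%N ->
  \sum_(l0 <= i < l) grid_env i k = b k (grid_time l) - b k (grid_time l0).
Proof.
move=> k0 l0l; rewrite -(telescope_sumr (fun i => b k (grid_time i)) l0l).
apply: eq_big_nat => i _.
by rewrite /grid_env /drift /sgn0 /= gtn_eqF// mul0r add0r mul1r.
Qed.

Lemma grid_env_bottom l : \sum_(0 <= i < l) grid_env i 0 =
  mu * (grid_time l - grid_time 0) - (b 0%N (grid_time l) - b 0%N (grid_time 0)).
Proof.
rewrite -(telescope_sumr (fun i => b 0%N (grid_time i)) (leq0n l)).
rewrite -(telescope_sumr grid_time (leq0n l)) mulr_sumr -sumrB.
apply: eq_big_nat => i _; rewrite /grid_env /drift /sgn0 /= mulN1r; congr (_ - _).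
by rewrite /grid_time -natr1; ring.
Qed.

(** The bottom row is summed from the start of the grid, whereas the energy counts from time 0.
    Index [m] is time 0, so removing the first [m] bottom weights corrects exactly this. *)
Lemma path_sum_energy a n : b 0%N 0 = 0 -> (forall k, (k < n)%N -> (a k <= a k.+1)%N) ->
  path_sum grid_env a n - \sum_(0 <= i < m) grid_env i 0 =
  energy (fun k => grid_time (a k)) n.
Proof.
move=> b0; elim: n => [|n IH] an.
  rewrite path_sum0 /= energy0 !grid_env_bottom.
  have -> : grid_time m = 0 by rewrite /grid_time subrr mul0r.
  by rewrite b0; ring.
rewrite path_sumS energyS -IH; last by move=> k kn; apply: an; exact: ltnW.
by rewrite grid_env_side ?an//; ring.
Qed.

Lemma lpp_centered_attained n N : b 0%N 0 = 0 -> exists a,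
  [/\ forall k, (k < n)%N -> (a k <= a k.+1)%N, a n = N &
      lpp_centered n N m grid_env = energy (fun k => grid_time (a k)) n].
Proof.
move=> b0; have [a [an aN pE]] := path_sum_attained grid_env n N.
by exists a; split=> //; rewrite /lpp_centered pE path_sum_energy.
Qed.

Lemma energy_le_lpp_centered n N a : b 0%N 0 = 0 ->
  (forall k, (k < n)%N -> (a k <= a k.+1)%N) -> a n = N ->
  energy (fun k => grid_time (a k)) n <= lpp_centered n N m grid_env.
Proof.
by move=> b0 an <-; rewrite -path_sum_energy// lerD2r path_sum_le.
Qed.

End energy.
End grid_paths.

Section passage_time.
Context {R : realType}.
Variables (b : nat -> R -> R) (mu : R) (n : nat).
Hypotheses (b_start : b 0%N 0 = 0) (b_cont : forall k, continuous (b k)).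

Definition passage_time (t : R) : \bar R :=
  ereal_sup [set x | exists s : nat -> R,
    [/\ forall j, (j < n)%N -> s j < s j.+1, s n = t & x = (energy b mu s n)%:E]].

(* The supremum is over strictly increasing sequences; continuity of the
   paths gives access to the nondecreasing ones produced by the grid. *)
Lemma energy_le_passage_time (s : nat -> R) :
  (forall j, (j < n)%N -> s j <= s j.+1) ->
  ((energy b mu s n)%:E <= passage_time (s n))%E.
Proof.
move=> sn; pose u i j : R := s j + (j%:R - n%:R) * i.+1%:R^-1.
have uE i : (energy b mu (u i) n)%:E \is a fin_num by [].
have ule i : ((energy b mu (u i) n)%:E <= passage_time (s n))%E.
  apply: ereal_sup_ubound; exists (u i); split=> //.
  - move=> j jn; rewrite /u ler_ltD ?sn// ltr_pM2r ?invr_gt0//.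
    by rewrite ltrD2r ltr_nat.
  - by rewrite /u subrr mul0r addr0.
have us : energy b mu (u i) n @[i --> \oo] --> energy b mu s n.
  apply: energy_cvg => // k _; rewrite -[X in _ --> X]addr0; apply: cvgD; first exact: cvg_cst.
  rewrite -(mulr0 (k%:R - n%:R)); apply: cvgMr; exact: cvg_harmonic.
have usE : (energy b mu (u i) n)%:E @[i --> \oo] --> (energy b mu s n)%:E.
  by apply: cvg_EFin => //; exact: nearW.
by rewrite -(cvg_lim _ usE)//; apply: lime_le; [exact: cvgP usE|exact: nearW].
Qed.

Variables (t lam : R).
Hypotheses (t0 : 0 < t) (lam0 : 0 < lam).

(** The squared mesh is t/64^j, so [64 ^ j] steps fill the time [t]. With the origin at [j * 64 ^ j]
    the grid covers [-j t, t]: it is refined and reaches further into the past at once. *)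
Definition mesh j : R := Num.sqrt t / 8 ^+ j.

Definition grid_origin j : nat := j * 64 ^ j.
Definition grid_steps j : nat := j.+1 * 64 ^ j.

Definition grid_moment j : R := hard_moment n (grid_steps j) (grid_origin j) lam
  (grid_env b mu (mesh j) (grid_origin j)).

Lemma mesh2 j : mesh j ^+ 2 = t / 64 ^+ j.
Proof.
by rewrite /mesh expr_div_n sqr_sqrtr ?ltW// -exprM mulnC exprM; congr (_ / _ ^+ _); ring.
Qed.

Lemma grid_time_end j : grid_time (mesh j) (grid_origin j) (grid_steps j) = t.
Proof.
rewrite /grid_time /grid_steps mulSn natrD addrK mesh2 natrX mulrCA divff ?mulr1//.
Qed.

Lemma grid_moment_le j : ((grid_moment j)%:E <= expeR (lam%:E * passage_time t))%E.
Proof.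
have [a [an aN E]] := @lpp_centered_attained _ b mu (mesh j) (grid_origin j) n (grid_steps j) b_start.
rewrite /grid_moment /hard_moment E.
have := @energy_le_passage_time (fun k => grid_time (mesh j) (grid_origin j) (a k)).
rewrite aN grid_time_end => h.
rewrite -[X in (X <= _)%E]/(expeR (_%:E)) lee_expeR EFinM lee_wpmul2l ?lee_fin ?(ltW lam0)//.
apply: h => k kn; rewrite /grid_time ler_wpM2r ?sqr_ge0// lerD2r ler_nat.
exact: an.
Qed.

(** Rounding the times down to the grid keeps their order and, by continuity of the paths, their
    energy in the limit. The terminal time [t] is a grid point and is not moved. *)
Lemma energy_le_liminf (s : nat -> R) :
  (forall j, (j < n)%N -> s j < s j.+1) -> s n = t ->
  ((expR (lam * energy b mu s n))%:E <= limn_einf (fun j => (grid_moment j)%:E))%E.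
Proof.
move=> sn st; pose m := grid_origin.
have M0 j : 0 < 64 ^+ j :> R by exact: exprn_gt0.
have e0 j : 0 < mesh j ^+ 2 by rewrite mesh2 divr_gt0.
pose a j k := Num.truncn (s k / mesh j ^+ 2 + (m j)%:R).
pose u j k := grid_time (mesh j) (m j) (a j k).
have aN j : a j n = grid_steps j.
  rewrite /a st mesh2 invf_div mulrCA divff ?gt_eqF// mulr1.
  by rewrite -natrX -natrD -mulSn natrK.
have u_le j : (expR (lam * energy b mu (u j) n) <= grid_moment j)%R.
  rewrite ler_expR ler_wpM2l ?(ltW lam0)// energy_le_lpp_centered// => k kn.
  apply: le_truncn; rewrite lerD2r ler_wpM2r ?invr_ge0 ?(ltW (e0 j))//.
  exact/ltW/sn.
have M_cvg : (mesh j ^+ 2) @[j --> \oo] --> (0 : R).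
  rewrite (_ : (fun j => _) = geometric t (64^-1)).
    by apply: cvg_geometric; rewrite ger0_norm; lra.
  by apply/funext => j; rewrite /= mesh2 exprVn.
have u_cvg k : u j k @[j --> \oo] --> s k.
  have : (s k - mesh j ^+ 2) @[j --> \oo] --> s k.
    by rewrite -[X in _ --> X]subr0; apply: cvgB => //; exact: cvg_cst.
  move=> lo; apply: (squeeze_cvgr _ lo (cvg_cst _)).
  (* Only from some [j] on does the grid reach back to [s k]; before that, truncation at index 0
     does not approximate it. *)
  near=> j; have jt : 0 <= s k / mesh j ^+ 2 + (m j)%:R.
    have -> : s k / mesh j ^+ 2 + (m j)%:R = (s k / t + j%:R) * 64 ^+ j.
      by rewrite mesh2 invf_div /m /grid_origin natrM natrX mulrDl; congr (_ + _); rewrite mulrAC mulrA.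
    rewrite mulr_ge0 ?(ltW (M0 j))// -lerBlDl sub0r.
    by near: j; exact: nbhs_infty_ger.
  have /andP[l1 l2] := truncn_itv jt.
  have -> : s k = (s k / mesh j ^+ 2 + (m j)%:R - (m j)%:R) * mesh j ^+ 2.
    by rewrite addrK divfK// gt_eqF.
  rewrite -[X in _ - X <= _]mul1r -mulrBl !ler_pM2r// -/(a j k) in l1 l2 *.
  by rewrite lerD2r l1 andbT; rewrite -natr1 in l2; lra.
have g_cvg : (expR (lam * energy b mu (u j) n))%:E @[j --> \oo] -->
    (expR (lam * energy b mu s n))%:E.
  apply: cvg_EFin; first exact: nearW.
  apply: continuous_cvg; first exact: continuous_expR.
  by apply: cvgMr; apply: energy_cvg.
rewrite -(cvg_limn_einf_sup g_cvg).1 !limn_einf_lim.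
apply: lee_lim; [exact: is_cvg_einfs|exact: is_cvg_einfs|apply: nearW => j].
apply: le_ereal_inf_tmp => _ [k /= jk <-].
apply: (@le_trans _ _ (expR (lam * energy b mu (u k) n))%:E); last by rewrite lee_fin.
by apply: ereal_inf_lbound; exists k.
Unshelve. all: by end_near. Qed.

Lemma passage_time_le_liminf :
  (expeR (lam%:E * passage_time t) <= limn_einf (fun j => (grid_moment j)%:E))%E.
Proof.
set L := limn_einf _.
have L0 : (0 <= L)%E.
  (* Any admissible sequence ending at [t] would do; unit spacing is one. *)
  have := @energy_le_liminf (fun k => t + k%:R - n%:R); rewrite -/L => h.
  apply: le_trans (h _ _); [by rewrite lee_fin expR_ge0| |by rewrite addrK].
  by move=> j _; rewrite ltrD2r ltrD2l ltr_nat.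
rewrite -[L]lneK ?in_itv/= ?L0 ?leey// lee_expeR -lee_pdivlMl//.
apply: ge_ereal_sup => _ [s [sn st ->]].
rewrite lee_pdivlMl// -lee_expeR lneK ?in_itv/= ?L0 ?leey//.
exact: energy_le_liminf.
Qed.

End passage_time.

Section ae_comparison.
Context d (T : measurableType d) (R : realType) (P : probability T R).
Variables f g : T -> \bar R.
Hypotheses (f0 : forall x, (0 <= f x)%E) (g0 : forall x, (0 <= g x)%E).
Hypothesis fg : {ae P, forall x, (f x <= g x)%E}.
Local Open Scope ereal_scope.

(** With the smaller function measurable, it is replaced by 0 on the null set, after which the
    comparison holds everywhere. *)
Lemma ae_ge0_le_integral_measl : measurable_fun setT f ->
  \int[P]_x f x <= \int[P]_x g x.
Proof.
move=> mf; have [N [mN PN hN]] := fg.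
have mf' : measurable_fun setT (fun x => f x * (\1_(~` N) x)%:E).
  by apply: emeasurable_funM => //; apply/measurable_EFinP;
    apply: measurable_indic; exact: measurableC.
rewrite (@ge0_ae_eq_integral _ _ _ P setT f _ measurableT mf mf')//; last 2 first.
- by move=> x _; rewrite mule_ge0// lee_fin.
- exists N; split=> // x /= /existsNP[_ nx]; apply: contrapT => Nx; apply: nx.
  by rewrite indicE mem_set// mule1.
apply: ge0_le_integralT => x; first by rewrite mule_ge0// lee_fin.
rewrite indicE; have [/set_mem Nx|_] := boolP (x \in ~` N); last by rewrite mule0.
by rewrite mule1; apply: contrapT => nfg; apply: Nx; exact: hN.
Qed.

(** With the larger function measurable, it is raised to infinity on the null set instead. *)
Lemma ae_ge0_le_integral_measr : measurable_fun setT g ->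
  \int[P]_x f x <= \int[P]_x g x.
Proof.
move=> mg; have [N [mN PN hN]] := fg.
have mg' : measurable_fun setT (fun x => g x + +oo * (\1_N x)%:E).
  apply: emeasurable_funD => //; apply: measurable_funeM.
  by apply/measurable_EFinP; exact: measurable_indic.
have g'0 x : 0 <= g x + +oo * (\1_N x)%:E by rewrite adde_ge0// mule_ge0// lee_fin.
rewrite -(@ge0_ae_eq_integral _ _ _ P setT _ g measurableT mg' mg)//; last first.
  exists N; split=> // x /= /existsNP[_ nx]; apply: contrapT => Nx; apply: nx.
  by rewrite indicE memNset// mule0 adde0.
apply: ge0_le_integralT => // x; rewrite indicE.
have [_|/negP Nx] := boolP (x \in N).
  by rewrite mule1 addey ?leey// -ltNye (lt_le_trans _ (g0 x)).
rewrite mule0 adde0; apply: contrapT => nfg; apply: Nx; rewrite inE; exact: hN.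
Qed.

End ae_comparison.

Section discretised_moment.
Context d (T : measurableType d) (R : realType) (P : probability T R).
Variable B : nat -> R -> {RV P >-> R}.
Hypothesis hB : iid_two_sided_brownian_motions B.
Variables (mu lam t : R) (n : nat).
Hypotheses (mu0 : 0 < mu) (lam0 : 0 < lam) (t0 : 0 < t).

Definition sample_grid_moment j (w : T) : R :=
  grid_moment (fun k r => B k r w) mu n t lam j.

Let L := last_passage_time B mu n t.

Lemma measurable_sample_grid_moment j : measurable_fun setT (sample_grid_moment j).
Proof.
apply: measurable_hard_moment => l k; apply: measurable_funD => //.
by apply: measurable_funM => //; exact: measurable_funB.
Qed.

Lemma ae_regular_paths :
  {ae P, forall w, B 0%N 0 w = 0 /\ forall k, continuous (fun r => B k r w)}.
Proof.
have [bm _] := hB; apply: filterI; first by case: (bm 0%N).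
by apply/ae_foralln => k; case: (bm k).
Qed.

(* The random variable [L] is not known to be measurable, so the comparisons
   take place off a measurable null set. *)
Lemma exp_moment_ge_grid j :
  (\int[P]_w (sample_grid_moment j w)%:E <= exp_moment P lam L)%E.
Proof.
apply: ae_ge0_le_integral_measl.
- by move=> w; rewrite lee_fin expR_ge0.
- by move=> w; exact: expeR_ge0.
- by apply: filterS ae_regular_paths => w [b0 bc]; exact: grid_moment_le.
- by apply/measurable_EFinP; exact: measurable_sample_grid_moment.
Qed.

Lemma exp_moment_le_liminf :
  (exp_moment P lam L <=
   limn_einf (fun j => \int[P]_w (sample_grid_moment j w)%:E))%E.
Proof.
have mf j : measurable_fun setT (fun w => (sample_grid_moment j w)%:E).
  by apply/measurable_EFinP; exact: measurable_sample_grid_moment.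
have f0 j w : [set: T] w -> (0 <= (sample_grid_moment j w)%:E)%E.
  by move=> _; rewrite lee_fin expR_ge0.
apply: (le_trans _ (fatou P measurableT mf f0)).
have mlim : measurable_fun setT
    (fun w => limn_einf (fun j => (sample_grid_moment j w)%:E)).
  have -> : (fun w => limn_einf (fun j => (sample_grid_moment j w)%:E)) =
      (fun w => - limn_esup (fun j => - (sample_grid_moment j w)%:E))%E by [].
  apply: measurableT_comp => //; apply: measurable_fun_limn_esup => j.
  exact: measurableT_comp.
apply: ae_ge0_le_integral_measr => //.
- by move=> w; exact: expeR_ge0.
- move=> w; rewrite limn_einf_lim; apply: lime_ge; first exact: is_cvg_einfs.
  apply: nearW => j; apply: le_ereal_inf_tmp => _ [k /= _ <-].
  by rewrite lee_fin expR_ge0.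
- by apply: filterS ae_regular_paths => w [b0 bc]; exact: passage_time_le_liminf.
Qed.

Let cell_noise j c := increment (B c.2) (grid_time (mesh t j) (grid_origin j) c.1)
  (grid_time (mesh t j) (grid_origin j) c.1.+1).

Lemma mesh_gt0 j : 0 < mesh t j.
Proof. by rewrite divr_gt0 ?sqrtr_gt0// exprn_gt0. Qed.

Lemma sample_grid_moment_noisy j w : sample_grid_moment j w =
  hard_moment n (grid_steps j) (grid_origin j) lam
    (noisy mu (mesh t j) (cell_noise j) (cells_from n 0 (grid_steps j)) (fun _ _ => 0) w).
Proof.
have E l k : (l < grid_steps j)%N -> (k <= n)%N ->
    grid_env (fun k r => B k r w) mu (mesh t j) (grid_origin j) l k =
    noisy mu (mesh t j) (cell_noise j) (cells_from n 0 (grid_steps j)) (fun _ _ => 0) w l k.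
  by move=> ll kn; rewrite /noisy mem_cells_from add0n ll kn.
by apply: eq_hard_moment => //; rewrite leq_mul2r leqnSn orbT.
Qed.

Lemma cell_noise_law j c A : measurable A ->
  P (cell_noise j c @^-1` A) = normal_prob 0 (mesh t j) A.
Proof.
move=> mA; have e0 := mesh_gt0 j; have [bm _] := hB.
have incr : grid_time (mesh t j) (grid_origin j) c.1 < grid_time (mesh t j) (grid_origin j) c.1.+1.
  by rewrite /grid_time ltr_pM2r ?exprn_gt0// ltrD2r ltr_nat.
rewrite /cell_noise (bm_normal (bm c.2) incr mA); congr (normal_prob _ _ _).
rewrite /grid_time -mulrBl -natr1 (_ : _ - _ = 1); last by ring.
by rewrite mul1r sqrtr_sqr gtr0_norm.
Qed.

Lemma sample_grid_moment_walk : exists2 C, 0 <= C & forall j (e := mesh t j)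
    (eta := C * (e ^+ 3 * (2 ^+ j) ^+ 2))
    (W := walk_moment e lam n (64 ^ j) (grid_origin j) (expR (- (2 * (mu * e)))))
    (Q := expR (lam / 2 ^+ j * ln ((grid_steps j).+1 ^ n)%:R)),
  e <= 1 -> lam <= 2 ^+ j -> eta <= 1 ->
  (((1 - eta) ^+ (grid_steps j * n.+1))%:E * W <=
   Q%:E * \int[P]_w (sample_grid_moment j w)%:E)%E /\
  (\int[P]_w (sample_grid_moment j w)%:E <=
   ((1 + eta) ^+ (grid_steps j * n.+1) * Q)%:E * W)%E.
Proof.
have [C1 C10 swap1] := gaussian_swap (ltW mu0) (ltW lam0).
have [C2 C20 swap2] := gaussian_swap (lexx 0) (ltW lam0).
exists (C1 + C2) => [|j e eta W Q e1 lb eta1]; first exact: addr_ge0.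
have e0 : 0 < e := mesh_gt0 j.
have b0 : 0 < 2 ^+ j :> R by rewrite exprn_gt0.
have eb0 : 0 <= e ^+ 3 * (2 ^+ j) ^+ 2 by rewrite mulr_ge0// exprn_ge0// ltW.
have eta0 : 0 <= eta by rewrite mulr_ge0// addr_ge0.
have mN : (grid_origin j <= grid_steps j)%N by rewrite leq_mul2r leqnSn orbT.
have WE := walk_momentE n lam mu e mN.
rewrite (_ : (grid_steps j - grid_origin j)%N = (64 ^ j)%N) in WE; last first.
  by rewrite /grid_steps mulSn addnK.
rewrite /W -WE.
have swap c U V b : 0 <= U -> 0 <= V -> 0 < U + V -> `|b| = 2 ^+ j ->
    swap_bounds (drift mu c) e (sgn0 c) eta (smoothed U V (lam / 2 ^+ j) b).
  move=> U0 V0 UV0 bE; have B0 : 0 <= bernoulli_mean (step_prob mu e c) e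
      (smoothed U V (lam / 2 ^+ j) b).
    have /andP[p0 p1] := step_prob01 mu e c.
    by rewrite addr_ge0// mulr_ge0 ?subr_ge0// expR_ge0.
  have b1 : 1 <= `|b| by rewrite bE exprn_ege1// ler1n.
  have a1 : lam / 2 ^+ j <= 1 by rewrite ler_pdivrMr// mul1r.
  have a0 : 0 <= lam / 2 ^+ j by rewrite divr_ge0 ?ltW.
  have ab : lam / 2 ^+ j * `|b| = lam by rewrite bE divfK// gt_eqF.
  have b2 : b ^+ 2 = (2 ^+ j) ^+ 2 by rewrite -bE real_normK// num_real.
  (* Bottom cells have drift [mu] and all others drift 0, with two different constants; both are
     enlarged to a common [eta]. *)
  have widen (D : R) : D <= C1 + C2 ->
      swap_bounds (drift mu c) e (sgn0 c) (D * (e ^+ 3 * b ^+ 2))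
        (smoothed U V (lam / 2 ^+ j) b) ->
      swap_bounds (drift mu c) e (sgn0 c) eta (smoothed U V (lam / 2 ^+ j) b).
    move=> DC [lo up]; have De : D * (e ^+ 3 * b ^+ 2) <= eta by rewrite b2 ler_wpM2r.
    split; [apply: le_trans lo|apply: (le_trans up)]; rewrite lee_fin ler_wpM2r//.
      by rewrite lerD2l lerN2.
    by rewrite lerD2l.
  have C12 : C1 <= C1 + C2 by rewrite lerDl.
  have C21 : C2 <= C1 + C2 by rewrite lerDr.
  have [c0|c0] := eqVneq c.2 0%N.
    apply: (widen C1) => //; rewrite /drift /sgn0 c0 eqxx.
    by apply: swap1 => //; rewrite sqrrN expr1n.
  apply: (widen C2) => //; rewrite /drift /sgn0 (negbTE c0).
  by apply: swap2 => //; rewrite expr1n.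
have mY c : measurable_fun setT (cell_noise j c) by exact: measurable_funB.
have ind : independent_family P (cell_noise j) (cells_from n 0 (grid_steps j)).
  apply: (independent_increment_grid hB) => l.
  by rewrite /grid_time ltr_pM2r ?exprn_gt0// ltrD2r ltr_nat.
have [lo up] := hard_moment_swap n (grid_steps j) (grid_origin j) b0 mY (cell_noise_law j)
  eta0 eta1 swap (fun _ _ => 0) (ltW lam0) (uniq_cells_from n 0 (grid_steps j)) ind.
have EI : (\int[P]_w (sample_grid_moment j w)%:E = \int[P]_w (hard_moment n (grid_steps j)
    (grid_origin j) lam (noisy mu (mesh t j) (cell_noise j) (cells_from n 0 (grid_steps j))
      (fun _ _ => 0) w))%:E)%E.
  by apply: eq_integral => w _; rewrite sample_grid_moment_noisy.
by rewrite EI -!EFinM -(size_cells_from n 0 (grid_steps j)).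
Qed.

End discretised_moment.

(** * Limits along the grid *)

Section mesh_limits.
Context {R : realType}.
Variable t : R.
Hypothesis t0 : 0 < t.
Local Notation e j := (mesh t j).

Let e0 j : 0 < e j. Proof. by rewrite divr_gt0 ?sqrtr_gt0// exprn_gt0. Qed.

Lemma mesh_cvg : e j @[j --> \oo] --> (0 : R).
Proof.
rewrite (_ : (fun j => _) = geometric (Num.sqrt t) 8^-1).
  by apply: cvg_geometric; rewrite ger0_norm; lra.
by apply/funext => j; rewrite /= /mesh exprVn.
Qed.

Lemma scaled_mesh_cvg (c d : R) : c * (d * e j) @[j --> \oo] --> (0 : R).
Proof.
rewrite (_ : (fun j => _) = (fun j => c * d * e j)); last first.
  by apply/funext => j; rewrite mulrA.
by rewrite -[X in _ --> X](mulr0 (c * d)); apply: cvgMr; exact: mesh_cvg.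
Qed.

Lemma expn_mesh2 j : (64 ^ j)%:R * e j ^+ 2 = t.
Proof. by rewrite mesh2// natrX mulrC divfK// gt_eqF// exprn_gt0. Qed.

(** Squeezed between powers by exp(v/(1 + v)) <= 1 + v <= exp(v). *)
Lemma pow1D_cvg (v : nat -> R) (x : R) : (forall j, 0 <= v j) ->
  v j @[j --> \oo] --> (0 : R) -> (64 ^ j)%:R * v j @[j --> \oo] --> x ->
  (1 + v j) ^+ (64 ^ j) @[j --> \oo] --> expR x.
Proof.
move=> v0 vc Mv.
have lo : expR ((64 ^ j)%:R * v j * (1 + v j)^-1) @[j --> \oo] --> expR x.
  apply: continuous_cvg; first exact: continuous_expR.
  rewrite -[X in _ --> X]mulr1 -[X in _ * X]invr1 -[X in _ * X^-1]addr0.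
  apply: cvgM => //; apply: cvgV; first by rewrite addr0 oner_eq0.
  by apply: cvgD => //; exact: cvg_cst.
have up : expR ((64 ^ j)%:R * v j) @[j --> \oo] --> expR x.
  by apply: continuous_cvg => //; exact: continuous_expR.
apply: (squeeze_cvgr _ lo up); apply: nearW => j.
have v1 : 0 < 1 + v j by rewrite ltr_pwDl.
rewrite -mulrA !expRM_natl !lerXn2r ?nnegrE ?expR_ge0 ?(ltW v1)//.
  exact: expR_ge1Dx.
have h := expR_ge1Dx (- (v j / (1 + v j))).
rewrite -[leLHS]invrK -expRN -[leRHS]invrK lef_pV2 ?posrE ?invr_gt0 ?expR_gt0//.
apply: le_trans h; rewrite le_eqVlt; apply/orP; left; apply/eqP.
by field; rewrite gt_eqF.
Qed.

Lemma cosh_pow_cvg (c : R) :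
  cosh (c * e j) ^+ (64 ^ j) @[j --> \oo] --> expR (t * (c ^+ 2 / 2)).
Proof.
have [C C0 jet] := jet_cosh1 c.
have near1 : \forall j \near \oo, e j <= 1.
  by have /cvgr_le := mesh_cvg; apply.
have small := scaled_mesh_cvg C t.
have lin : (64 ^ j)%:R * (cosh (c * e j) - 1) @[j --> \oo] --> t * (c ^+ 2 / 2).
  have lo : t * (c ^+ 2 / 2) - C * (t * e j) @[j --> \oo] --> t * (c ^+ 2 / 2).
    by rewrite -[X in _ --> X]subr0; apply: cvgB => //; exact: cvg_cst.
  have up : t * (c ^+ 2 / 2) + C * (t * e j) @[j --> \oo] --> t * (c ^+ 2 / 2).
    by rewrite -[X in _ --> X]addr0; apply: cvgD => //; exact: cvg_cst.
  apply: (squeeze_cvgr _ lo up); near=> j.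
  have e1 : e j <= 1 by near: j.
  have := jet (e j); rewrite e1 ltW// mul0r addr0 => /(_ isT).
  have M0 : 0 <= (64 ^ j)%:R :> R by [].
  have tE := expn_mesh2 j.
  rewrite ler_norml => /andP[l1 l2].
  have := ler_wpM2l M0 l1; have := ler_wpM2l M0 l2.
  have -> : (64 ^ j)%:R * - (C * e j ^+ 3) = - (C * ((64 ^ j)%:R * e j ^+ 2 * e j)).
    by ring.
  have -> : (64 ^ j)%:R * (C * e j ^+ 3) = C * ((64 ^ j)%:R * e j ^+ 2 * e j).
    by ring.
  have -> : (64 ^ j)%:R * (cosh (c * e j) - (1 + c ^+ 2 / 2 * e j ^+ 2)) =
      (64 ^ j)%:R * (cosh (c * e j) - 1) - (64 ^ j)%:R * e j ^+ 2 * (c ^+ 2 / 2).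
    by ring.
  rewrite tE.
  by move=> u1 u2; apply/andP; split; lra.
have cE j : cosh (c * e j) = 1 + (cosh (c * e j) - 1) by rewrite addrC subrK.
under eq_fun do rewrite cE.
apply: pow1D_cvg => //; first by move=> j; rewrite subr_ge0 cosh_ge1.
have inv : ((64 ^ j)%:R : R)^-1 @[j --> \oo] --> (0 : R).
  rewrite (_ : (fun j => _) = geometric 1 64^-1).
    by apply: cvg_geometric; rewrite ger0_norm; lra.
  by apply/funext => j; rewrite /= mul1r natrX exprVn.
rewrite -[X in _ --> X](mul0r (t * (c ^+ 2 / 2))).
rewrite (_ : (fun j => _) = (fun j => ((64 ^ j)%:R : R)^-1 * ((64 ^ j)%:R * (cosh (c * e j) - 1)))).
  exact: cvgM.
by apply/funext => j; rewrite mulKf// pnatr_eq0 expn_eq0.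
Unshelve. all: by end_near. Qed.

(** Since the odds are exp(-2 nu x), the two-point law is itself an exponential tilt of the fair
    one, and its moments are ratios of hyperbolic cosines. *)
Lemma tilted_mean_cosh (l nu x : R) :
  tilted_mean (l * x) (prob (expR (- (2 * (nu * x))))) =
  cosh ((nu + l) * x) / cosh (nu * x).
Proof.
rewrite prob_cosh /tilted_mean /weight.
have c0 : cosh (nu * x) != 0 by rewrite gt_eqF// (lt_le_trans _ (cosh_ge1 _)).
have c2 : 2 * cosh (nu * x) = expR (nu * x) + expR (- (nu * x)).
  by rewrite /cosh mulrC divfK.
have -> : 1 - expR (- (nu * x)) / (2 * cosh (nu * x)) =
    expR (nu * x) / (2 * cosh (nu * x)).
  have n0 : 2 * cosh (nu * x) != 0 by rewrite mulf_neq0.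
  by rewrite -[X in X - _](divff n0) -mulrBl [X in X - _]c2 addrK.
have -> : cosh ((nu + l) * x) =
    (expR (nu * x) * expR (l * x) + expR (- (nu * x)) * expR (- (l * x))) / 2.
  by rewrite /cosh -!expRD; congr ((expR _ + expR _) / _); ring.
by field.
Qed.

Lemma tilted_mean_pow_cvg (l nu : R) :
  tilted_mean (l * e j) (prob (expR (- (2 * (nu * e j))))) ^+ (64 ^ j)
    @[j --> \oo] --> expR (t * (((nu + l) ^+ 2 - nu ^+ 2) / 2)).
Proof.
under eq_fun do rewrite tilted_mean_cosh expr_div_n.
have -> : t * (((nu + l) ^+ 2 - nu ^+ 2) / 2) =
    t * ((nu + l) ^+ 2 / 2) - t * (nu ^+ 2 / 2) by ring.
rewrite expRB; apply: cvgM; first exact: cosh_pow_cvg.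
by apply: cvgV; [rewrite gt_eqF// expR_gt0|exact: cosh_pow_cvg].
Qed.

(** Numerator and denominator are controlled by x/(1 + x) <= 1 - exp(-x) <= x. *)
Lemma expRN_ratio_cvg (a b : R) : 0 < a -> 0 < b ->
  (1 - expR (- (2 * (a * e j)))) / (1 - expR (- (2 * (b * e j)))) @[j --> \oo] --> a / b.
Proof.
move=> a0 b0.
have up : a / b * (1 + 2 * (b * e j)) @[j --> \oo] --> a / b.
  rewrite -[X in _ --> X]mulr1; apply: cvgMr; rewrite -[X in _ --> X]addr0.
  apply: cvgD; first exact: cvg_cst.
  exact: scaled_mesh_cvg.
have lo : a / b / (1 + 2 * (a * e j)) @[j --> \oo] --> a / b.
  rewrite -[X in _ --> X]divr1; apply: cvgMr; apply: cvgV; first by rewrite oner_eq0.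
  rewrite -[X in _ --> X]addr0; apply: cvgD; first exact: cvg_cst.
  exact: scaled_mesh_cvg.
have bound (c : R) j : 0 < c ->
    2 * (c * e j) / (1 + 2 * (c * e j)) <= 1 - expR (- (2 * (c * e j))) <= 2 * (c * e j).
  move=> c0; have x0 : 0 < 2 * (c * e j) by rewrite mulr_gt0// (mulr_gt0 c0 (e0 j)).
  move: (2 * (c * e j)) x0 => x x0; apply/andP; split; last first.
    by have := expR_ge1Dx (- x); lra.
  have x1 : 0 < 1 + x by lra.
  rewrite expRN; have := expR_ge1Dx x => h.
  have : (expR x)^-1 <= (1 + x)^-1 by rewrite lef_pV2 ?posrE ?expR_gt0.
  have -> : x / (1 + x) = 1 - (1 + x)^-1 by field; rewrite gt_eqF.
  by lra.
apply: (squeeze_cvgr _ lo up); apply: nearW => j.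
have /andP[a1 a2] := bound a j a0; have /andP[b1 b2] := bound b j b0.
have pos (c : R) : 0 < c -> 0 < 1 + 2 * (c * e j).
  by move=> c0; rewrite addr_gt0// mulr_gt0// (mulr_gt0 c0 (e0 j)).
have ea := pos a a0; have eb := pos b b0; have ej := e0 j.
have ae := mulr_gt0 a0 ej; have be := mulr_gt0 b0 ej.
have D0 : 0 < 1 - expR (- (2 * (b * e j))).
  by apply: lt_le_trans b1; rewrite divr_gt0// mulr_gt0.
apply/andP; split.
  rewrite ler_pdivlMr//; apply: le_trans a1.
  apply: (@le_trans _ _ (a / b / (1 + 2 * (a * e j)) * (2 * (b * e j)))).
    by rewrite ler_wpM2l// !divr_ge0 ?ltW.
  rewrite le_eqVlt; apply/orP; left; apply/eqP.
  by field; rewrite !gt_eqF.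
rewrite ler_pdivrMr//; apply: (le_trans a2).
apply: (@le_trans _ _ (a / b * (1 + 2 * (b * e j)) *
    (2 * (b * e j) / (1 + 2 * (b * e j))))); last first.
  by rewrite ler_wpM2l// mulr_ge0 ?divr_ge0 ?ltW.
rewrite le_eqVlt; apply/orP; left; apply/eqP.
by field; rewrite !gt_eqF.
Qed.

End mesh_limits.

Section rates.
Context {R : realType}.

Lemma cvg_pow (u : nat -> R) (l : R) k : u j @[j --> \oo] --> l ->
  u j ^+ k @[j --> \oo] --> l ^+ k.
Proof.
move=> ul; elim: k => [|k IH]; first exact: cvg_cst.
by rewrite exprS; under eq_fun do rewrite exprS; exact: cvgM.
Qed.

Lemma powX_cvg0 (u : nat -> R) (q : R) : (forall j, 0 <= u j) ->
  u j @[j --> \oo] --> q -> q < 1 -> u j ^+ j @[j --> \oo] --> (0 : R).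
Proof.
move=> u0 uq q1; pose q' := (1 + q) / 2.
have q0 : 0 <= q.
  by apply: (@ler_cvg_to nat \oo _ R (cst 0) u) => //; [exact: cvg_cst|exact: nearW].
have qq' : q < q' by rewrite /q'; lra.
have q'1 : `|q'| < 1 by rewrite ger0_norm /q'; lra.
have up : q' ^+ j @[j --> \oo] --> (0 : R) by exact: cvg_expr.
apply: (squeeze_cvgr _ (cvg_cst 0) up).
have /cvgr_le/(_ _ qq') := uq; apply: filterS => j uj.
by rewrite exprn_ge0// lerXn2r// nnegrE (le_trans (u0 j)).
Qed.

Lemma linear_over_pow_cvg : j.+1%:R / 2 ^+ j @[j --> \oo] --> (0 : R).
Proof.
have up : geometric (2 : R) (3 / 4) j @[j --> \oo] --> (0 : R).
  by apply: cvg_geometric; rewrite ger0_norm; lra.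
apply: (squeeze_cvgr _ (cvg_cst 0) up); apply: nearW => j.
have b0 : 0 < 2 ^+ j :> R by rewrite exprn_gt0.
rewrite divr_ge0 ?(ltW b0)//= ler_pdivrMr// -mulrA -exprMn.
rewrite (_ : 3 / 4 * 2 = 3 / 2 :> R); last by field.
elim: j {b0} => [|j IH]; first by rewrite expr0; lra.
have h : 1 <= (3 / 2 : R) ^+ j by apply: exprn_ege1; lra.
have : (1 : R) <= j.+1%:R by rewrite ler1n.
by rewrite exprS -natr1 => ?; lra.
Qed.

Lemma bernoulli_lower (x : R) k : 0 <= x <= 1 -> 1 - k%:R * x <= (1 - x) ^+ k.
Proof.
move=> /andP[x0 x1]; elim: k => [|k IH]; first by rewrite mul0r subr0 expr0.
have := @ler_wpM2l R (1 - x) _ _ _ IH; rewrite subr_ge0 -exprS => /(_ x1).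
apply: le_trans; rewrite -natr1; have : 0 <= k%:R * x ^+ 2 by rewrite mulr_ge0 ?sqr_ge0.
by lra.
Qed.

Lemma softmax_cost_cvg (lam : R) n : 0 < lam ->
  expR (lam / 2 ^+ j * ln ((grid_steps j).+1 ^ n)%:R) @[j --> \oo] --> (1 : R).
Proof.
move=> lam0; pose K := lam * n%:R * (7 * ln 2).
have up : expR (K * (j.+1%:R / 2 ^+ j)) @[j --> \oo] --> (1 : R).
  rewrite -[X in _ --> X]expR0; apply: continuous_cvg; first exact: continuous_expR.
  by rewrite -[X in _ --> X](mulr0 K); apply: cvgMr; exact: linear_over_pow_cvg.
apply: (squeeze_cvgr _ (cvg_cst (1 : R)) up); apply: nearW => j.
have b0 : 0 < 2 ^+ j :> R by rewrite exprn_gt0.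
rewrite -{1}expR0 !ler_expR natrX lnXn ?ltr0n// -[ln _ *+ n]mulr_natl.
have l0 : 0 <= ln ((grid_steps j).+1%:R : R) by rewrite ln_ge0// ler1n.
apply/andP; split; first by rewrite !mulr_ge0 ?invr_ge0 ?(ltW b0) ?(ltW lam0).
(* From [j < 2 ^ j] the number of steps plus one is at most 2^(7 (j + 1)), so its logarithm is
   linear in [j] and loses against beta = 2^j. *)
have l7 : ln ((grid_steps j).+1%:R : R) <= j.+1%:R * (7 * ln 2).
  have -> : j.+1%:R * (7 * ln 2) = ln ((2 ^ (7 * j.+1))%:R : R).
    by rewrite natrX lnXn// -[ln _ *+ _]mulr_natl natrM; ring.
  rewrite ler_ln ?posrE ?ltr0n ?expn_gt0// ler_nat /grid_steps.
  have -> : (64 ^ j = 2 ^ (6 * j))%N by rewrite expnM.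
  have j2 : (j < 2 ^ j)%N by rewrite ltn_expl.
  have -> : (7 * j.+1 = (j + 6 * j).+1 + 6)%N by lia.
  rewrite expnD expnS expnD.
  have p1 : (0 < 2 ^ (6 * j))%N by rewrite expn_gt0.
  move: (2 ^ (6 * j))%N (2 ^ j)%N p1 j2 => X Y X1 jY.
  have : (j.+1 * X <= Y * X)%N by rewrite leq_mul2r jY orbT.
  by nia.
rewrite /K (_ : _ * (j.+1%:R / 2 ^+ j) = lam / 2 ^+ j * (n%:R * (j.+1%:R * (7 * ln 2)))).
  by rewrite !ler_wpM2l// divr_ge0 ?(ltW b0) ?(ltW lam0).
by field; rewrite gt_eqF.
Qed.

End rates.

Section moment_limits.
Context {R : realType}.
Variables (t lam mu : R) (n : nat).
Hypotheses (t0 : 0 < t) (lam0 : 0 < lam) (lam_mu : lam < mu).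
Local Notation e j := (mesh t j).

Let e0 j : 0 < e j. Proof. by rewrite divr_gt0 ?sqrtr_gt0// exprn_gt0. Qed.
Let mu0 : 0 < mu. Proof. exact: lt_trans lam_mu. Qed.

Definition bottom_limit : R :=
  expR (t * (lam ^+ 2 / 2 + mu * lam)) * ((mu + lam) / mu) ^+ n.
Definition side_limit (nu : R) : R :=
  expR (t * (- (lam ^+ 2 / 2) + nu * lam)) * (nu / (nu - lam)) ^+ n.

Lemma bottom_moment_cvg :
  bottom_moment (e j) lam n (64 ^ j) (expR (- (2 * (mu * e j)))) @[j --> \oo] -->
  bottom_limit.
Proof.
rewrite /bottom_moment /bottom_limit; apply: cvgM.
  rewrite (_ : lam ^+ 2 / 2 + mu * lam = ((mu + lam) ^+ 2 - mu ^+ 2) / 2).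
    exact: tilted_mean_pow_cvg.
  by field.
apply: cvg_pow.
rewrite (_ : (fun j => _) = (fun j => (1 - expR (- (2 * ((mu + lam) * e j)))) /
  (1 - expR (- (2 * (mu * e j)))))); first by apply: expRN_ratio_cvg; rewrite ?addr_gt0.
by apply/funext => j; rewrite -expRB; congr ((1 - expR _) / _); ring.
Qed.

Lemma mulRy_mesh (nu : R) j :
  expR (- (2 * (nu * e j))) * expR (2 * (lam * e j)) = expR (- (2 * ((nu - lam) * e j))).
Proof. by rewrite -expRD; congr expR; ring. Qed.

Lemma side_moment_cvg (nu : R) : lam < nu ->
  side_moment (e j) lam n (expR (- (2 * (nu * e j)))) (64 ^ j) @[j --> \oo] -->
  side_limit nu.
Proof.
move=> lnu; rewrite /side_moment /side_limit mulrC; apply: cvgM.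
  apply: cvg_pow.
  under eq_fun do rewrite mulRy_mesh.
  by apply: expRN_ratio_cvg; rewrite ?subr_gt0// (lt_trans lam0).
under eq_fun do rewrite mulRy_mesh.
rewrite (_ : - (lam ^+ 2 / 2) + nu * lam =
  (((nu - lam) + lam) ^+ 2 - (nu - lam) ^+ 2) / 2).
  exact: tilted_mean_pow_cvg.
by field.
Qed.

(** The free ratio is exp(-2 nu eps) with nu halfway between [lam] and [mu]: nu < mu places it above
    the stationary ratio, and nu > lam keeps its tilt below 1. *)
Definition origin_error j : R :=
  tilted_mean (- (lam * e j)) (prob (expR (- (2 * (mu * e j))))) ^+ grid_origin j *
  side_moment (e j) lam n (expR (- (2 * ((lam + mu) / 2 * e j)))) (grid_origin j + 64 ^ j).

Lemma tilted_mean_ge0 (theta p : R) : 0 <= p <= 1 -> 0 <= tilted_mean theta p.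
Proof.
by move=> /andP[p0 p1]; rewrite addr_ge0// mulr_ge0 ?subr_ge0// expR_ge0.
Qed.

(* With nu = (lam + mu)/2 the exponents add up to -lam(mu - nu)t < 0 per block. *)
Lemma origin_error_cvg : origin_error j @[j --> \oo] --> (0 : R).
Proof.
pose nu := (lam + mu) / 2.
have lnu : lam < nu by rewrite /nu; have := lam_mu; lra.
pose A j := tilted_mean (- lam * e j) (prob (expR (- (2 * (mu * e j))))) ^+ (64 ^ j).
pose D j := tilted_mean (lam * e j) (prob (expR (- (2 * ((nu - lam) * e j))))) ^+ (64 ^ j).
have E : origin_error = (fun j => (A j * D j) ^+ j *
    side_moment (e j) lam n (expR (- (2 * (nu * e j)))) (64 ^ j)).
  apply/funext => j; rewrite /origin_error /side_moment -/nu mulRy_mesh -mulNr.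
  rewrite /grid_origin exprD !(mulnC j) !exprM /A /D.
  rewrite [(_ * _ : R) ^+ j]exprMn -[RHS]mulrA; congr (_ * _); exact: mulrCA.
rewrite E -[X in _ --> X](mul0r (side_limit nu)); apply: cvgM; last exact: side_moment_cvg.
have AD : A j * D j @[j --> \oo] --> expR (t * (((mu - lam) ^+ 2 - mu ^+ 2) / 2)) *
    expR (t * (((nu - lam + lam) ^+ 2 - (nu - lam) ^+ 2) / 2)).
  by apply: cvgM; exact: tilted_mean_pow_cvg.
apply: powX_cvg0 AD _.
  by move=> j; rewrite mulr_ge0// exprn_ge0// tilted_mean_ge0// prob01// expR_ge0.
rewrite -expRD -[X in _ < X]expR0 ltr_expR -mulrDr pmulr_rlt0//.
rewrite (_ : _ + _ = - (lam * (mu - lam) / 2)); last by rewrite /nu; field.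
by rewrite oppr_lt0 divr_gt0// mulr_gt0// subr_gt0.
Qed.

Section errors.
Variable C : R.
Hypothesis C0 : 0 <= C.
Definition swap_error j : R := C * (e j ^+ 3 * (2 ^+ j) ^+ 2).

Lemma swap_error_ge0 j : 0 <= swap_error j.
Proof. by rewrite mulr_ge0// mulr_ge0 ?exprn_ge0// ltW. Qed.

(** Per cell the error is of order 8^(-3j) 4^j = 128^-j, against (j + 1) 64^j (n + 1) cells. *)
Lemma total_swap_error_cvg :
  (grid_steps j * n.+1)%:R * swap_error j @[j --> \oo] --> (0 : R).
Proof.
pose K := n.+1%:R * (C * (t * Num.sqrt t)).
rewrite (_ : (fun j => _) = (fun j => K * (j.+1%:R / 2 ^+ j))).
  by rewrite -[X in _ --> X](mulr0 K); apply: cvgMr; exact: linear_over_pow_cvg.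
apply/funext => j; rewrite /swap_error /grid_steps !natrM /K.
have -> : e j ^+ 3 = e j ^+ 2 * e j by rewrite exprSr.
rewrite mesh2// /mesh natrX.
have -> : (64 : R) ^+ j = 8 ^+ j * 8 ^+ j by rewrite -exprMn; congr (_ ^+ _); ring.
have -> : (8 : R) ^+ j = 2 ^+ j * 2 ^+ j * 2 ^+ j.
  by rewrite -!exprMn; congr (_ ^+ _); ring.
have : (2 : R) ^+ j != 0 by rewrite expf_neq0.
by move: (2 ^+ j) (Num.sqrt t) => b s b0; field.
Qed.

Lemma swap_error_le1 : \forall j \near \oo, swap_error j <= 1.
Proof.
have /cvgr_le := total_swap_error_cvg; move=> /(_ 1 ltr01).
apply: filterS => j; apply: le_trans; rewrite ler_peMl ?swap_error_ge0// ler1n.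
by rewrite !muln_gt0 expn_gt0.
Qed.

Lemma swap_upper_cvg :
  (1 + swap_error j) ^+ (grid_steps j * n.+1) @[j --> \oo] --> (1 : R).
Proof.
have up : expR ((grid_steps j * n.+1)%:R * swap_error j) @[j --> \oo] --> (1 : R).
  rewrite -[X in _ --> X]expR0; apply: continuous_cvg; first exact: continuous_expR.
  exact: total_swap_error_cvg.
apply: (squeeze_cvgr _ (cvg_cst (1 : R)) up); apply: nearW => j.
have h := swap_error_ge0 j.
rewrite exprn_ege1 ?lerDl//= expRM_natl lerXn2r ?nnegrE ?expR_ge0 ?addr_ge0//.
exact: expR_ge1Dx.
Qed.

Lemma swap_lower_cvg :
  (1 - swap_error j) ^+ (grid_steps j * n.+1) @[j --> \oo] --> (1 : R).
Proof.
have lo : 1 - (grid_steps j * n.+1)%:R * swap_error j @[j --> \oo] --> (1 : R).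
  rewrite -[X in _ --> X]subr0; apply: cvgB; first exact: cvg_cst.
  exact: total_swap_error_cvg.
apply: (squeeze_cvgr _ lo (cvg_cst (1 : R))); apply: filterS swap_error_le1 => j h1.
have h0 := swap_error_ge0 j.
by rewrite bernoulli_lower ?h0//= exprn_ile1 ?subr_ge0// gerBl.
Qed.

End errors.

Lemma mesh_params j (nu : R) : 0 < nu -> 0 <= expR (- (2 * (nu * e j))) < 1.
Proof.
move=> nu0; rewrite expR_ge0/= -expR0 ltr_expR oppr_lt0 mulr_gt0//.
by rewrite (mulr_gt0 nu0 (e0 j)).
Qed.

Lemma mesh_walk_bounds j
    (W := walk_moment (e j) lam n (64 ^ j) (grid_origin j) (expR (- (2 * (mu * e j)))))
    (bottom := bottom_moment (e j) lam n (64 ^ j) (expR (- (2 * (mu * e j)))))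
    (side := side_moment (e j) lam n (expR (- (2 * (mu * e j)))) (64 ^ j)) :
  ((Num.max bottom side - origin_error j)%:E <= W)%E /\ (W <= (bottom + side)%:E)%E.
Proof.
have ry (nu : R) : lam < nu -> expR (- (2 * (nu * e j))) * expR (2 * (lam * e j)) < 1.
  by rewrite -subr_gt0 mulRy_mesh => lnu; case/andP: (mesh_params j lnu).
split; last by apply: walk_moment_le (ry _ lam_mu); rewrite ?(ltW (e0 j)) ?(ltW lam0)//; exact: mesh_params.
rewrite EFinB leeBlDr//.
apply: walk_moment_ge_max; rewrite ?(ltW (e0 j)) ?(ltW lam0)//; first exact: mesh_params.
- rewrite ler_expR lerN2 ler_wpM2l// ler_wpM2r ?(ltW (e0 j))//; have := lam_mu; lra.
- by apply: ry; have := lam_mu; lra.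
Qed.

End moment_limits.

(** * Exponential moments of the last passage time *)

Lemma lee_limn_einf_near (R : realType) (u v : nat -> \bar R) :
  (\forall j \near \oo, (u j <= v j)%E) -> (limn_einf u <= limn_einf v)%E.
Proof.
move=> uv; rewrite !limn_einf_lim.
apply: lee_lim; [exact: is_cvg_einfs|exact: is_cvg_einfs|].
case: uv => N _ uv; exists N => // j /= Nj.
apply: le_ereal_inf_tmp => _ [k /= jk <-].
apply: le_trans (uv k (leq_trans Nj jk)).
by apply: ereal_inf_lbound; exists k.
Qed.

Section exp_moment_bounds.
Context d (T : measurableType d) (R : realType) (P : probability T R).
Variable B : nat -> R -> {RV P >-> R}.
Hypothesis hB : iid_two_sided_brownian_motions B.
Variables (mu lam t : R) (n : nat).
Hypotheses (t0 : 0 < t) (lam0 : 0 < lam) (lam_mu : lam < mu).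

Let mu0 : 0 < mu. Proof. exact: lt_trans lam_mu. Qed.
Let I j : \bar R := (\int[P]_w (sample_grid_moment B mu lam t n j w)%:E)%E.
Let bottom j := bottom_moment (mesh t j) lam n (64 ^ j) (expR (- (2 * (mu * mesh t j)))).
Let side j := side_moment (mesh t j) lam n (expR (- (2 * (mu * mesh t j)))) (64 ^ j).
Let Q j := expR (lam / 2 ^+ j * ln ((grid_steps j).+1 ^ n)%:R) : R.

Lemma grid_integral_bounds : exists lo up : nat -> R,
  [/\ lo j @[j --> \oo] --> (1 : R), up j @[j --> \oo] --> (1 : R) &
  \forall j \near \oo, (0 <= lo j)%R /\
    ((lo j * (Num.max (bottom j) (side j) - origin_error t lam mu n j))%:E <=
     (Q j)%:E * I j)%E /\
    (I j <= (up j * Q j * (bottom j + side j))%:E)%E].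
Proof.
have [C C0 H] := sample_grid_moment_walk hB n mu0 lam0 t0.
exists (fun j => (1 - swap_error t C j) ^+ (grid_steps j * n.+1)).
exists (fun j => (1 + swap_error t C j) ^+ (grid_steps j * n.+1)).
split; [exact: swap_lower_cvg|exact: swap_upper_cvg|].
have near_mesh : \forall j \near \oo, mesh t j <= 1.
  by have /cvgr_le := mesh_cvg t; apply.
have near_beta : \forall j \near \oo, lam <= 2 ^+ j.
  have : \forall j \near \oo, lam <= j%:R by exact: nbhs_infty_ger.
  apply: filterS => j /le_trans; apply; rewrite -natrX ler_nat ltnW//.
  exact: ltn_expl.
near=> j.
have e1 : mesh t j <= 1 by near: j.
have b1 : lam <= 2 ^+ j by near: j.
have s1 : swap_error t C j <= 1 by near: j; exact: swap_error_le1.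
have s0 : 0 <= swap_error t C j by exact: swap_error_ge0.
have lo0 : 0 <= (1 - swap_error t C j) ^+ (grid_steps j * n.+1).
  by rewrite exprn_ge0// subr_ge0.
have up0 : 0 <= (1 + swap_error t C j) ^+ (grid_steps j * n.+1).
  by rewrite exprn_ge0// addr_ge0.
have [lo up] := H j e1 b1 s1.
have [wlo wup] := mesh_walk_bounds n t0 lam0 lam_mu j.
split=> //; split.
  by apply: le_trans lo; rewrite EFinM lee_wpmul2l.
apply: (le_trans up); rewrite [X in (_ <= X)%E]EFinM lee_wpmul2l// lee_fin mulr_ge0//.
Unshelve. all: by end_near. Qed.

Lemma exp_moment_le_sum :
  (exp_moment P lam (last_passage_time B mu n t) <=
   (bottom_limit t lam mu n + side_limit t lam n mu)%:E)%E.
Proof.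
apply: (le_trans (exp_moment_le_liminf hB mu n lam0 t0)).
have [lo [up [_ upc near_b]]] := grid_integral_bounds.
have cv : (up j * Q j * (bottom j + side j))%:E @[j --> \oo] -->
    (bottom_limit t lam mu n + side_limit t lam n mu)%:E.
  apply: cvg_EFin; first exact: nearW.
  rewrite -[X in _ --> X]mul1r -[X in X * _]mulr1; apply: cvgM.
    by apply: cvgM => //; exact: softmax_cost_cvg.
  by apply: cvgD; [exact: bottom_moment_cvg|exact: side_moment_cvg].
rewrite -(cvg_limn_einf_sup cv).1; apply: lee_limn_einf_near.
by apply: filterS near_b => j [_ []].
Qed.

Lemma exp_moment_ge_max :
  ((Num.max (bottom_limit t lam mu n) (side_limit t lam n mu))%:E <=
   exp_moment P lam (last_passage_time B mu n t))%E.
Proof.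
have E0 : (0 <= exp_moment P lam (last_passage_time B mu n t))%E.
  by apply: integral_ge0 => w _; exact: expeR_ge0.
have := exp_moment_le_sum; have Ige := exp_moment_ge_grid hB mu n lam0 t0.
(* The upper bound rules out an infinite moment, so limits can be taken among real numbers. *)
case: (exp_moment _ _ _) E0 Ige => [r| |]// r0 Ige _; rewrite lee_fin.
have [lo [up [loc _ near_b]]] := grid_integral_bounds.
(* Passing to the limit with each of the two terms separately avoids a limit of maxima. *)
have main (u : nat -> R) l : (forall j, u j <= Num.max (bottom j) (side j)) ->
    u j @[j --> \oo] --> l -> l <= r.
  move=> ub ul.
  have c1 : lo j * (u j - origin_error t lam mu n j) @[j --> \oo] --> l.
    rewrite -[X in _ --> X]mul1r; apply: cvgM => //.
    by rewrite -[X in _ --> X]subr0; apply: cvgB => //; exact: origin_error_cvg.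
  have c2 : Q j * r @[j --> \oo] --> r.
    rewrite -[X in _ --> X]mul1r; apply: cvgM; last exact: cvg_cst.
    by exact: softmax_cost_cvg.
  apply: (ler_cvg_to c1 c2); apply: filterS near_b => j [lo0 [h _]].
  rewrite -lee_fin; apply: le_trans (_ : _ <= (Q j)%:E * I j)%E _.
    apply: le_trans h; rewrite lee_fin ler_wpM2l// lerD2r; exact: ub.
  by rewrite EFinM lee_wpmul2l ?Ige// lee_fin expR_ge0.
rewrite ge_max; apply/andP; split.
  apply: (main bottom); last exact: bottom_moment_cvg.
  by move=> j; rewrite le_max lexx.
apply: (main side); last exact: side_moment_cvg.
by move=> j; rewrite le_max lexx orbT.
Qed.

End exp_moment_bounds.

Section supercritical.
Context d (T : measurableType d) (R : realType) (P : probability T R).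
Variable B : nat -> R -> {RV P >-> R}.
Hypothesis hB : iid_two_sided_brownian_motions B.
Variables (mu lam t : R) (n : nat).
Hypotheses (t0 : 0 < t) (mu0 : 0 < mu) (mu_lam : mu <= lam).

(* Compared on the grid, since additivity of the integral is not available for
   the possibly non-measurable last passage time. *)
Lemma exp_moment_le1D l : 0 < l -> l < lam ->
  (exp_moment P l (last_passage_time B mu n t) <=
   1 + exp_moment P lam (last_passage_time B mu n t))%E.
Proof.
move=> l0 llam; have lam0 := lt_trans l0 llam.
apply: (le_trans (exp_moment_le_liminf hB mu n l0 t0)).
rewrite -(cvg_limn_einf_sup (cvg_cst (1 + exp_moment P lam (last_passage_time B mu n t)))%E).1.
apply: lee_limn_einf_near; apply: nearW => j.
apply: (@le_trans _ _ (1 + \int[P]_w (sample_grid_moment B mu lam t n j w)%:E)%E); last first.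
  by rewrite leeD2l// exp_moment_ge_grid.
have mg l' : measurable_fun setT (fun w => (sample_grid_moment B mu l' t n j w)%:E).
  by apply/measurable_EFinP; exact: measurable_sample_grid_moment.
rewrite (_ : 1%E = (\int[P]_w (cst 1%E) w)%E :> \bar R); last first.
  by rewrite integral_cst// [X in (_ * X)%E]probability_setT mule1.
rewrite -ge0_integralD//; last first.
  by move=> w _; rewrite lee_fin expR_ge0.
apply: ge0_le_integralT => w; first by rewrite lee_fin expR_ge0.
rewrite /sample_grid_moment /grid_moment /hard_moment -EFinD lee_fin.
move: (lpp_centered _ _ _ _) => c; have [c0|c0] := leP 0 c.
  by rewrite ler_wpDl// ler_expR ler_wpM2r// ltW.
by rewrite ler_wpDr ?expR_ge0// -expR0 ler_expR pmulr_rle0// ltW.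
Qed.

Lemma exp_moment_supercritical : (0 < n)%N ->
  exp_moment P lam (last_passage_time B mu n t) = +oo%E.
Proof.
move=> n0; set E := exp_moment _ _ _.
have E0 : (0 <= E)%E by apply: integral_ge0 => w _; exact: expeR_ge0.
have big K : 1 < K -> (K%:E <= 1 + E)%E.
  move=> K1; have K0 : 0 < K := lt_trans ltr01 K1.
  (* Chosen so that mu/(mu - l) equals [K]; monotonicity in the exponent then transfers the bound
     from [l] to [lam]. *)
  pose l := mu * (1 - K^-1).
  have i0 : 0 < K^-1 by rewrite invr_gt0.
  have i1 : K^-1 < 1 by rewrite invf_lt1.
  have l0 : 0 < l by rewrite mulr_gt0// subr_gt0.
  have lmu : l < mu by rewrite gtr_pMr// gtrBl.
  apply: (le_trans _ (exp_moment_le1D l0 (lt_le_trans lmu mu_lam))).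
  apply: (le_trans _ (exp_moment_ge_max hB n t0 l0 lmu)).
  rewrite lee_fin le_max; apply/orP; right; rewrite /side_limit.
  have -> : mu / (mu - l) = K.
    by rewrite /l; field; rewrite ?gt_eqF//= -mulrBr mulr_gt0// subKr.
  (* Here at least one level above the bottom is used: with none, the side term would not blow
     up. *)
  have Kn : K <= K ^+ n by rewrite -{1}(expr1 K) ler_weXn2l// ltW.
  apply: (le_trans Kn); rewrite ler_peMl ?exprn_ge0 ?(ltW K0)//.
  rewrite -[X in X <= _]expR0 ler_expR mulr_ge0 ?(ltW t0)//.
  by nra.
case: E E0 big => [r| |]// r0 big.
have r0' : 0 <= r by [].
have r2 : 1 < 2 + r by lra.
by have := big _ r2; rewrite -EFinD lee_fin lerD2r leNgt ltr1n.
Qed.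

End supercritical.

Section free_energy.
Context {R : realType}.

Lemma natrV_cvg : (k%:R : R)^-1 @[k --> \oo] --> (0 : R).
Proof. by rewrite -cvg_shiftS; exact: cvg_harmonic. Qed.

Lemma truncn_ratio_cvg (s : R) : 0 < s ->
  (Num.truncn (k%:R * s))%:R / k%:R @[k --> \oo] --> s.
Proof.
move=> s0.
have lo : s - k%:R^-1 @[k --> \oo] --> s.
  by rewrite -[X in _ --> X]subr0; apply: cvgB; [exact: cvg_cst|exact: natrV_cvg].
apply: (squeeze_cvgr _ lo (cvg_cst s)).
have : \forall k \near \oo, (0 < k)%N by exact: nbhs_infty_gt.
apply: filterS => k k0; have kR : 0 < k%:R :> R by rewrite ltr0n.
have /andP[l u] := truncn_itv (ltW (mulr_gt0 kR s0)).
rewrite ler_pdivlMr// ler_pdivrMr// mulrBl mulVf ?gt_eqF// (mulrC s) l andbT.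
by rewrite lerBlDr natr1 ltW.
Qed.

Lemma cvg_maxr (u v : nat -> R) (a b : R) :
  u k @[k --> \oo] --> a -> v k @[k --> \oo] --> b ->
  Num.max (u k) (v k) @[k --> \oo] --> Num.max a b.
Proof.
move=> ua vb; rewrite maxr_absE; under eq_fun do rewrite maxr_absE.
by apply: cvgMl; apply: cvgD; [exact: cvgD|apply: cvg_norm; exact: cvgB].
Qed.

(* A quantity between [max(F, G)] and [F + G] is known up to a factor 2, which
   is invisible on the exponential scale. *)
Lemma log_rate_squeeze (E : nat -> \bar R) (F G : nat -> R) (a b : R) :
  (forall k, 0 < F k) -> (forall k, 0 < G k) ->
  ln (F k) / k%:R @[k --> \oo] --> a -> ln (G k) / k%:R @[k --> \oo] --> b ->
  (forall k, (0 < k)%N -> ((Num.max (F k) (G k))%:E <= E k <= (F k + G k)%:E)%E) ->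
  ((k%:R^-1)%:E * lne (E k))%E @[k --> \oo] --> (Num.max a b)%:E.
Proof.
move=> F0 G0 Fa Gb bounds.
pose x k := ln (fine (E k)) / k%:R.
pose M k := Num.max (F k) (G k).
have M0 k : 0 < M k by rewrite lt_max F0.
have lnME k : ln (M k) / k%:R = Num.max (ln (F k) / k%:R) (ln (G k) / k%:R).
  rewrite -maxr_pMl ?invr_ge0//; congr (_ * _); rewrite /M.
  have [h|h] := leP (F k) (G k).
    by rewrite max_r// ler_ln ?posrE.
  by rewrite max_l// ler_ln ?posrE// ltW.
have lo : ln (M k) / k%:R @[k --> \oo] --> Num.max a b.
  by under eq_fun do rewrite lnME; exact: cvg_maxr.
have up : ln 2 * k%:R^-1 + ln (M k) / k%:R @[k --> \oo] --> Num.max a b.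
  rewrite -[X in _ --> X]add0r; apply: cvgD => //.
  by rewrite -[X in _ --> X](mulr0 (ln 2)); apply: cvgMr; exact: natrV_cvg.
have posk : \forall k \near \oo, (0 < k)%N by exact: nbhs_infty_gt.
have fin k : (0 < k)%N -> exists2 r, E k = r%:E & M k <= r <= 2 * M k.
  move=> k0; have := bounds k k0; case: (E k) => [r| |]//; last by rewrite andbF.
  rewrite !lee_fin => /andP[l u]; exists r => //; rewrite l /=; apply: (le_trans u).
  by rewrite mulr_natl mulr2n lerD// le_max lexx ?orbT.
have xc : x k @[k --> \oo] --> Num.max a b.
  apply: (squeeze_cvgr _ lo up); apply: filterS posk => k k0.
  have [r Er /andP[l u]] := fin k k0; have r0 := lt_le_trans (M0 k) l.
  rewrite /x Er /= -mulrDl !ler_pM2r ?invr_gt0 ?ltr0n// -lnM ?posrE//.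
  by rewrite !ler_ln ?posrE ?mulr_gt0// l u.
have xcE : (x k)%:E @[k --> \oo] --> (Num.max a b)%:E.
  by apply: cvg_EFin => //; exact: nearW.
apply: cvg_trans xcE.
apply: near_eq_cvg; apply: filterS posk => k k0.
have [r Er /andP[l u]] := fin k k0.
by rewrite /x Er lne_EFin ?(lt_le_trans (M0 k) l)// -EFinM mulrC.
Qed.

(** The time enters linearly and exactly; only the number of levels is rounded, and its ratio to k
    tends to [s]. *)
Lemma growth_rate_cvg (s t a b : R) : 0 < s -> 0 < b ->
  ln (expR (k%:R * t * a) * b ^+ Num.truncn (k%:R * s)) / k%:R @[k --> \oo] -->
  t * a + s * ln b.
Proof.
move=> s0 b0.
have E : \forall k \near \oo,
    t * a + (Num.truncn (k%:R * s))%:R / k%:R * ln b =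
    ln (expR (k%:R * t * a) * b ^+ Num.truncn (k%:R * s)) / k%:R.
  have : \forall k \near \oo, (0 < k)%N by exact: nbhs_infty_gt.
  apply: filterS => k k0; have kR : k%:R != 0 :> R by rewrite pnatr_eq0 -lt0n.
  rewrite lnM ?posrE ?expR_gt0 ?exprn_gt0// expRK lnXn// -[ln _ *+ _]mulr_natl.
  by field.
apply: cvg_trans (near_eq_cvg _) _; last first.
  apply: cvgD; first exact: cvg_cst.
  by apply: cvgMl; exact: truncn_ratio_cvg.
exact: E.
Qed.

End free_energy.

Theorem theorem1p4 (d : measure_display) (T : measurableType d) (R : realType)
    (P : probability T R) (B : nat -> R -> {RV P >-> R})
    (hB : iid_two_sided_brownian_motions B)
    (mu s t lambda : R) (hmu : 0 < mu) (hs : 0 < s) (ht : 0 < t)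
    (hlambda : 0 <= lambda) :
  (fun n : nat =>
     ((n%:R^-1)%:E *
      lne (exp_moment P lambda
             (last_passage_time B mu (Num.truncn (n%:R * s)) (n%:R * t))))%E)
    @ \oo -->
  (if lambda < mu then
     (Num.max
        (t * (lambda ^+ 2 / 2 + mu * lambda) + s * ln ((mu + lambda) / mu))
        (t * (- (lambda ^+ 2 / 2) + mu * lambda)
         + s * ln (mu / (mu - lambda))))%:E
   else +oo%E).
Proof.
have tn n : (0 < n)%N -> 0 < n%:R * t by move=> n0; rewrite mulr_gt0// ltr0n.
have [lam_mu|mu_lam] := ltP lambda mu.
(* The moment bounds assume a positive exponent; at 0 the moment is 1 and both expressions in the
   maximum vanish. *)
- have [lam0|lam0] := eqVneq lambda 0.
    have E n : exp_moment P lambda (last_passage_time B mu (Num.truncn (n%:R * s))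
        (n%:R * t)) = 1%E.
      rewrite /exp_moment lam0; under eq_integral do rewrite mul0e expeR0.
      by rewrite integral_cst// [X in (_ * X)%E]probability_setT mule1.
    under eq_fun do rewrite E lne1 mule0.
    rewrite lam0 expr0n /= !(mul0r, mulr0, oppr0, addr0, subr0) divff ?gt_eqF// ln1.
    by rewrite mulr0 addr0 maxxx; exact: cvg_cst.
  have lambda0 : 0 < lambda by rewrite lt0r lam0.
  apply: (log_rate_squeeze
    (F := fun n => bottom_limit (n%:R * t) lambda mu (Num.truncn (n%:R * s)))
    (G := fun n => side_limit (n%:R * t) lambda (Num.truncn (n%:R * s)) mu)).
  + move=> n; rewrite /bottom_limit mulr_gt0 ?expR_gt0// exprn_gt0// divr_gt0//.
    exact: addr_gt0.
  + move=> n; rewrite /side_limit mulr_gt0 ?expR_gt0// exprn_gt0// divr_gt0//.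
    by rewrite subr_gt0.
  + by apply: growth_rate_cvg => //; rewrite divr_gt0// addr_gt0.
  + by apply: growth_rate_cvg => //; rewrite divr_gt0// subr_gt0.
  + move=> n n0; rewrite exp_moment_le_sum ?exp_moment_ge_max//; exact: tn.
(* Divergence requires a level above the bottom, which is present as soon as n s >= 1. *)
- have levels : \forall n \near \oo, (0 < Num.truncn (n%:R * s))%N.
    have : \forall n \near \oo, s^-1 <= n%:R by exact: nbhs_infty_ger.
    apply: filterS => n sn; rewrite truncn_gt_nat.
    by rewrite -ler_pdivrMr// mul1r.
  apply: cvg_near_cst; near=> n.
  have n0 : (0 < n)%N by near: n; exact: nbhs_infty_gt.
  rewrite (exp_moment_supercritical hB (tn n n0) hmu mu_lam); last by near: n.
  by rewrite /= gt0_muley// lte_fin invr_gt0 ltr0n.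
Unshelve. all: by end_near. Qed.
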